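(* There is an absolute constant $C_0>0$ such that the following holds. Assume: (a) $d\le n$ and $\eta_1 := C_0\sigma_x^2\sqrt{d/n}<\tfrac12$; (b) $\eta_2:=C_0\sigma_x^2\sqrt{\frac{4n^2}{r_d(\Sigma)^2}+\frac{2n}{r_d(\Sigma)}}\le\frac12$; (c) for some constant $0<\delta_2<1$, $\dfrac{\Vert\theta^*_{(d+1):p}\Vert^2_{\Sigma_{(d+1):p}}}{\Vert\theta^*_{1:d}\Vert^2_{\Sigma_{1:d}^{-1}}}\le \dfrac{\delta_2}{4(1+\sigma_x^2)}\Big(\dfrac1{\lambda_d}+\dfrac{4n}{\sum_{j>d}\lambda_j}\Big)^{-2}$. Assume further that $\sigma^2\asymp1$ and $\Vert\theta^*_{1:d}\Vert^2_{\Sigma_{1:d}^{-1}}\lambda_d^2\asymp1$. (i) A sufficient condition for $\mathrm{MSE}_{\mathrm{in}}=O(\frac dn)$ with a probability approaching 1 as $n\to\infty$ is that $\frac{\lambda_{d+1}}{\lambda_d}\lesssim\frac{d}{r_d(\Sigma)}$ and the ridge parameter $\tau\ge0$ is chosen such that $$\lambda_{d+1}\frac{r_d(\Sigma)}{n}\sqrt{\frac nd}\lesssim\tau+\lambda_{d+1}\frac{r_d(\Sigma)}{n}\lesssim\lambda_d\sqrt{\frac dn}.$$ (ii) Suppose that $n\gg d$ and $64\frac{\sqrt{\delta_2}}{1-\sqrt{\delta_2}}<1$. Then a necessary condition for $\mathrm{MSE}_{\mathrm{in}}=O(\frac dn)$ with a probability bounded away from $0$ is that $\frac{\lambda_{d+1}}{\lambda_d}\lesssim\frac{d}{r_d(\Sigma)}$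 and the ridge parameter $\tau$ is chosen in the range $\lambda_{d+1}\frac{r_d(\Sigma)}{n}\sqrt{\frac nd}\lesssim\tau+\lambda_{d+1}\frac{r_d(\Sigma)}{n}\lesssim\lambda_d\sqrt{\frac dn}$. In the case where $n\gg d$ in addition to the assumptions stated (including those of (ii)), the sufficient and necessary conditions on $\frac{\lambda_{d+1}}{\lambda_d}$ become matched: $\frac{\lambda_{d+1}}{\lambda_d}\lesssim\frac{d}{r_d(\Sigma)}$.
   Context: Model. Let $1\le d<p$ be integers. The data $(y_1,x_1),\dots,(y_n,x_n)$ are i.i.d. from $y_i=x_i^\top\theta^*+\epsilon_i$, where $\theta^*\in\mathbb R^p$, $x_i\in\mathbb R^p$ is random with $E(x_i)=0$, $\mathrm{Var}(x_i)=\Sigma$ non-singular, and $\epsilon_i\in\mathbb R$ is independent of $x_i$ with $E(\epsilon_i)=0$, $\mathrm{Var}(\epsilon_i)=\sigma^2$. Throughout, $\Sigma=\mathrm{Diag}(\lambda_1,\dots,\lambda_p)$ with $\lambda_1\ge\dots\ge\lambda_p>0$. The vector $\Sigma^{-1/2}x_i$ is sub-gaussian with sub-gaussian norm $\sigma_x$, where a real random variable $z$ has norm $\Vert z\Vert_{\psi_2}=\inf\{t>0: E\exp(z^2/t^2)\le 2\}$ and a random vector $Z$ has norm $\sup_{s\ne 0}\Vert\langle s,Z\rangle/\Vert s\Vert\,\Vert_{\psi_2}$. $Y=(y_1,\dots,y_n)^\top$, $X=(x_1,\dots,x_n)^\top$, $\hat\Sigma=X^\top X/n$. For $\tau>0$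 the ridge estimator is $\hat\theta(\tau)=X^\top(XX^\top+n\tau I_n)^{-1}Y$ (minimizer of $\frac1n\Vert Y-X\theta\Vert^2+\tau\Vert\theta\Vert^2$), and $\hat\theta(0)=\lim_{\tau\to0+}\hat\theta(\tau)$. $\Vert b\Vert_M=(b^\top Mb)^{1/2}$. $\mathrm{MSE}_{\mathrm{in}}=E[\Vert\hat\theta(\tau)-\theta^*\Vert_{\hat\Sigma}^2\mid X]=E[\frac1n\Vert X(\hat\theta(\tau)-\theta^* )\Vert^2\mid X]$. $\theta^*_{1:d}$, $\theta^*_{(d+1):p}$ are the first $d$ and last $p-d$ entries of $\theta^*$; $\Sigma_{1:d}=\mathrm{Diag}(\lambda_1,\dots,\lambda_d)$, $\Sigma_{(d+1):p}=\mathrm{Diag}(\lambda_{d+1},\dots,\lambda_p)$; $r_d(\Sigma)=\frac{\sum_{j>d}\lambda_j}{\lambda_{d+1}}$. Asymptotics. One considers a sequence of such models indexed by $n\to\infty$; $p,d,\Sigma,\theta^*,\sigma^2$ and the (deterministic) $\tau\ge0$ may depend on $n$, while $\sigma_x,\delta_2$ are fixed. For positive sequences, $a_n\lesssim b_n$ (or $a_n=O(b_n)$) means $a_n\le c\,b_n$ for all large $n$ for some constant $c>0$; $a_n\asymp b_n$ means $a_n\lesssim b_n$ and $b_n\lesssim a_n$; $a_n\gg b_n$ means $b_n/a_n\to0$. ''$\mathrm{MSE}=O(d/n)$ with a probability approaching 1'' means that for some constant $C$, $P(\mathrm{MSE}\le C\,d/n)\to1$; ''with a probability bounded away from 0'' means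 that for some constants $C,\epsilon>0$, $P(\mathrm{MSE}\le C\,d/n)\ge\epsilon$ for all large $n$. *)

(* Defs.v *)
From HB Require Import structures.
From mathcomp Require Import all_boot all_order all_algebra.
From mathcomp Require Import all_classical all_reals all_analysis.
Set Implicit Arguments.
Unset Strict Implicit.
Unset Printing Implicit Defensive.
Import Order.TTheory GRing.Theory Num.Theory.
Import numFieldNormedType.Exports.
Local Open Scope classical_set_scope.
Local Open Scope ring_scope.

Section Linear.
Context {R : realType}.

Definition wnorm p (M : 'M[R]_p) (b : 'cV[R]_p) : R :=
  Num.sqrt ((b^T *m M *m b) 0 0).

Definition enorm p (b : 'cV[R]_p) : R := wnorm 1%:M b.

Definition ridge_pos n p (tau : R) (X : 'M[R]_(n, p)) (Y : 'cV[R]_n) :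
    'cV[R]_p :=
  X^T *m invmx (X *m X^T + (n%:R * tau)%:M) *m Y.

Definition ridge n p (tau : R) (X : 'M[R]_(n, p)) (Y : 'cV[R]_n) :
    'cV[R]_p :=
  if tau == 0 then lim (ridge_pos t X Y @[t --> 0^'+])
  else ridge_pos tau X Y.

End Linear.

Section Probability.
Context {R : realType} {d : measure_display} {T : measurableType d}.
Variable P : probability T R.

(* +oo when no admissible t exists. *)
Definition psi2_norm (z : T -> R) : \bar R :=
  ereal_inf [set t%:E | t in
    [set t : R | 0 < t /\ ('E_P[fun w => expR (z w ^+ 2 / t ^+ 2)] <= 2%:E)%E]].

Definition psi2_vnorm p (Z : T -> 'cV[R]_p) : \bar R :=
  ereal_sup [set psi2_norm (fun w => (s^T *m Z w) 0 0 / enorm s) | s in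
    [set s : 'cV[R]_p | s != 0]].

Definition mutually_independent d' (U : measurableType d') n
    (Z : 'I_n -> T -> U) : Prop :=
  forall (J : {set 'I_n}) (A : 'I_n -> set U), (forall i, measurable (A i)) ->
    P (\bigcap_(i in [set` J]) (Z i @^-1` A i)) =
    (\prod_(i in J) P (Z i @^-1` A i))%E.

Definition identically_distributed d' (U : measurableType d') n
    (Z : 'I_n -> T -> U) : Prop :=
  forall i j (A : set U), measurable A -> P (Z i @^-1` A) = P (Z j @^-1` A).

Definition independent2 d1 (U1 : measurableType d1) d2 (U2 : measurableType d2)
    (Z1 : T -> U1) (Z2 : T -> U2) : Prop :=
  forall (A : set U1) (B : set U2), measurable A -> measurable B ->
    P (Z1 @^-1` A `&` Z2 @^-1` B) = (P (Z1 @^-1` A) * P (Z2 @^-1` B))%E.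

(* g is a version of E[f | G], G being a sub-sigma-algebra. *)
Definition is_cond_exp (G : set (set T)) (f g : T -> R) : Prop :=
  [/\ P.-integrable setT (EFin \o g),
      forall B : set R, measurable B -> G (g @^-1` B)
    & forall A, G A ->
        (\int[P]_(w in A) (g w)%:E = \int[P]_(w in A) (f w)%:E)%E].

(* A chosen version of E[f | G]; one exists, and is unique up to P-null sets,
   as soon as f is integrable. *)
Definition cond_exp (G : set (set T)) (f : T -> R) : T -> R :=
  xget (cst 0) [set g | is_cond_exp G f g].

End Probability.

(* The model with n observations.  Coordinates are numbered from 0, so that
   lambda_j is [lambda 0 j'] with j' = j - 1. *)
Record ridge_model {R : realType} (sigma_x : R) (n : nat) := RidgeModel {
  dimp : nat;
  dimd : nat;
  dimd_gt0 : (0 < dimd)%N;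
  dimd_ltp : (dimd < dimp)%N;
  theta : 'cV[R]_dimp;
  lambda : 'rV[R]_dimp;
  sigma2 : R;
  lambda_gt0 : forall j, 0 < lambda 0 j;
  lambda_noninc : forall j k : 'I_dimp, (j <= k)%N -> lambda 0 k <= lambda 0 j;
  disp : measure_display;
  Om : measurableType disp;
  Pr : probability Om R;
  xs : 'I_n -> {RV Pr >-> dimp.-tuple R};
  eps : 'I_n -> {RV Pr >-> R};
  ys : 'I_n -> Om -> R :=
    fun i w => \sum_(j < dimp) tnth (xs i w) j * theta j 0 + eps i w;
  data_indep :
    mutually_independent Pr (fun i w => (ys i w, xs i w) : R * dimp.-tuple R);
  data_ident :
    identically_distributed Pr (fun i w => (ys i w, xs i w) : R * dimp.-tuple R);
  eps_xs_indep : forall i, independent2 Pr (eps i) (xs i);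
  xs_mean : forall i j, ('E_Pr[fun w => tnth (xs i w) j] = 0)%E;
  xs_var : forall i j k,
    covariance Pr (fun w => tnth (xs i w) j) (fun w => tnth (xs i w) k) =
    (diag_mx lambda j k)%:E;
  eps_mean : forall i, ('E_Pr[eps i] = 0)%E;
  eps_var : forall i, ('V_Pr[eps i] = sigma2%:E)%E;
  xs_psi2 : forall i,
    psi2_vnorm Pr (fun w => diag_mx (\row_j (Num.sqrt (lambda 0 j))^-1)
                            *m \col_j tnth (xs i w) j) = sigma_x%:E
}.
Arguments xs {R sigma_x n} r i.
Arguments eps {R sigma_x n} r i.
Arguments ys {R sigma_x n} r i w.

Section Quantities.
Context {R : realType} {sigma_x : R} {n : nat}.
Variable M : ridge_model sigma_x n.
Local Notation p := (dimp M).
Local Notation d := (dimd M).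

Definition design (w : Om M) : 'M[R]_(n, p) :=
  \matrix_(i, j) tnth (xs M i w) j.

Definition response (w : Om M) : 'cV[R]_n := \col_i ys M i w.

Definition sigma_design : set (set (Om M)) :=
  g_sigma_algebra_preimage
    (fun w => [tuple (xs M i w : p.-tuple R) | i < n] : n.-tuple (p.-tuple R)).

Definition Sigma_hat (w : Om M) : 'M[R]_p :=
  n%:R^-1 *: ((design w)^T *m design w).

Definition MSE_in (tau : R) : Om M -> R :=
  cond_exp (Pr M) sigma_design
    (fun w => wnorm (Sigma_hat w)
                (ridge tau (design w) (response w) - theta M) ^+ 2).

Definition head_idx (i : 'I_d) : 'I_p := widen_ord (ltnW (dimd_ltp M)) i.

Definition tail_idx (i : 'I_(p - d)) : 'I_p :=
  cast_ord (subnKC (ltnW (dimd_ltp M))) (rshift d i).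

Definition theta_head : 'cV[R]_d := \col_i theta M (head_idx i) 0.
Definition theta_tail : 'cV[R]_(p - d) := \col_i theta M (tail_idx i) 0.
Definition Sigma_head : 'M[R]_d := diag_mx (\row_i lambda M 0 (head_idx i)).
Definition Sigma_tail : 'M[R]_(p - d) :=
  diag_mx (\row_i lambda M 0 (tail_idx i)).

(* lambda_d and lambda_(d+1), i.e. 0-based positions d - 1 and d *)
Definition lambda_d : R :=
  lambda M 0 (Ordinal (leq_ltn_trans (leq_pred d) (dimd_ltp M))).
Definition lambda_d1 : R := lambda M 0 (Ordinal (dimd_ltp M)).

Definition tail_sum : R := \sum_(i < p - d) lambda M 0 (tail_idx i).
Definition eff_rank : R := tail_sum / lambda_d1.

Definition head_norm2 : R := wnorm (invmx Sigma_head) theta_head ^+ 2.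
Definition tail_norm2 : R := wnorm Sigma_tail theta_tail ^+ 2.

Definition d_over_n : R := d%:R / n%:R.
Definition n_over_d : R := n%:R / d%:R.

Definition eta1 (C0 : R) : R := C0 * sigma_x ^+ 2 * Num.sqrt d_over_n.

Definition eta2 (C0 : R) : R :=
  C0 * sigma_x ^+ 2 *
  Num.sqrt (4 * n%:R ^+ 2 / eff_rank ^+ 2 + 2 * n%:R / eff_rank).

Definition cond_a (C0 : R) : Prop := (d <= n)%N /\ eta1 C0 < 1 / 2.
Definition cond_b (C0 : R) : Prop := eta2 C0 <= 1 / 2.
Definition cond_c (delta2 : R) : Prop :=
  tail_norm2 / head_norm2 <=
  delta2 / (4 * (1 + sigma_x ^+ 2)) *
  ((lambda_d^-1 + 4 * n%:R / tail_sum) ^+ 2)^-1.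

End Quantities.
Arguments MSE_in {R sigma_x n} M tau w.

Section Asymptotics.
Context {R : realType}.

Definition lesssim (a b : nat -> R) : Prop :=
  exists2 c : R, 0 < c & \forall n \near \oo, a n <= c * b n.

Definition asymp (a b : nat -> R) : Prop := lesssim a b /\ lesssim b a.

Definition much_larger (a b : nat -> R) : Prop :=
  b n / a n @[n --> \oo] --> (0 : R).

Context {sigma_x : R}.
Variable M : forall n, ridge_model sigma_x n.

Definition ratio_cond : Prop :=
  lesssim (fun n => lambda_d1 (M n) / lambda_d (M n))
          (fun n => (dimd (M n))%:R / eff_rank (M n)).

Definition tau_range (tau : nat -> R) : Prop :=
  let tail n := lambda_d1 (M n) * (eff_rank (M n) / n%:R) in
  lesssim (fun n => tail n * Num.sqrt (n_over_d (M n)))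
          (fun n => tau n + tail n) /\
  lesssim (fun n => tau n + tail n)
          (fun n => lambda_d (M n) * Num.sqrt (d_over_n (M n))).

Definition MSE_event (tau : nat -> R) (C : R) (n : nat) : set (Om (M n)) :=
  [set w | MSE_in (M n) (tau n) w <= C * d_over_n (M n)].

Definition MSE_O_prob_to1 (tau : nat -> R) : Prop :=
  exists C : R, (Pr (M n) (MSE_event tau C (n := n)) @[n --> \oo] --> 1%E).

Definition MSE_O_prob_away0 (tau : nat -> R) : Prop :=
  exists (C e : R), 0 < e /\
    \forall n \near \oo, (e%:E <= Pr (M n) (MSE_event tau C (n := n)))%E.

End Asymptotics.

(* Main.v *)
(* Write H for the ridge smoother X X^T (X X^T + n tau I)^-1 (its limit as tau -> 0+
   when tau = 0).  Since the noise is independent of the design, MSE_in is almost surely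
   (|(H - 1) X theta|^2 + sigma^2 tr (H^T H)) / n.  On an event of probability at
   least 1 - 5 exp (- c n / sigma_x^4) the first d columns of X form a
   well-conditioned design, up to Sigma_{1:d}, while the last p - d ones have
   squared operator norm at most B, and squared Frobenius norm at least a
   multiple of n s, where s is the sum of the lambda_j over j > d and B is a
   multiple of s: a Bernstein bound on a net handles the first part, and a
   coordinatewise Gaussian linearisation of exp (a |Xt^T u|^2) the second one,
   so that only the sub-gaussianity of the vectors is used, not the
   independence of their coordinates.  On that event, with t = n tau, the
   variance lies between multiples of (s / (B + t))^2 and of d / n + (B / t)^2,
   and the squared bias is at most a multiple of h (tau + s / n)^2 and, when
   B <= t, at least one of h min (tau, lambda_d)^2, where h is the squared
   Sigma_{1:d}^-1-norm of theta_{1:d}; condition (c) makes theta_{(d+1):p}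
   negligible.  Comparing both with d / n gives the two ends of the range of
   tau, and multiplying the two ends gives the ratio condition. *)
Require Import Defs.
From HB Require Import structures.
From mathcomp Require Import all_boot all_order all_algebra.
From mathcomp Require Import all_classical all_reals all_analysis.
From mathcomp Require Import measurable_realfun ring lra.
Import Order.TTheory GRing.Theory Num.Theory.
Import numFieldNormedType.Exports.
Local Open Scope classical_set_scope.
Local Open Scope ring_scope.

Set Implicit Arguments.
Unset Strict Implicit.
Unset Printing Implicit Defensive.

(** * Euclidean inner products and quadratic forms of matrices *)

Section InnerProduct.
Context {R : realType}.

(** Three calibrations hold the proof together. The net of the unit ball of dimension [N] has at
    most [expR (18 N)] points. For the head [N = d], and [eta1 < 1/2] makes [18 d] at most half of
    the Bernstein exponent. For the tail the net lies in dimension [n], and [eta2 <= 1/2] forces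
    [n <= r_d], so that the deviation bound [expR (- 20 r_d)] at each point still beats it. This is
    what [C0 = 1000] is for. In the necessary part the bias can be bounded below only once the
    penalty dominates the tail, [B <= t]. This is not assumed: the lower bound on the variance
    forces it as soon as [d / n] is small, so the lower end of the range has to come before the
    upper one. Condition (c) then costs at most half of the bias, since the assumption on the square
    root of [delta2] gives [delta2 <= 1/160]. At [tau = 0] the estimator is a limit, and the bounds
    that survive there are proved for positive penalties first. The upper bound with [B / t] does
    not survive; but the range allows [tau = 0] only if [d / n] is bounded below, and there the
    trivial bound [n] on the trace is enough. *)

Definition dotv n (u v : 'cV[R]_n) : R := \sum_i u i 0 * v i 0.
Definition nsq n (v : 'cV[R]_n) : R := dotv v v.

Lemma dotvE n (u v : 'cV[R]_n) : (u^T *m v) 0 0 = dotv u v.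
Proof. by rewrite mxE; apply: eq_bigr => i _; rewrite !mxE. Qed.

Lemma dotvC n (u v : 'cV[R]_n) : dotv u v = dotv v u.
Proof. by apply: eq_bigr => i _; rewrite mulrC. Qed.

Lemma dotvDl n (u1 u2 v : 'cV[R]_n) : dotv (u1 + u2) v = dotv u1 v + dotv u2 v.
Proof. by rewrite -big_split; apply: eq_bigr => i _; rewrite !mxE mulrDl. Qed.

Lemma dotvDr n (u v1 v2 : 'cV[R]_n) : dotv u (v1 + v2) = dotv u v1 + dotv u v2.
Proof. by rewrite dotvC dotvDl !(dotvC u). Qed.

Lemma dotvZl n a (u v : 'cV[R]_n) : dotv (a *: u) v = a * dotv u v.
Proof. by rewrite mulr_sumr; apply: eq_bigr => i _; rewrite !mxE mulrA. Qed.

Lemma dotvZr n a (u v : 'cV[R]_n) : dotv u (a *: v) = a * dotv u v.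
Proof. by rewrite dotvC dotvZl dotvC. Qed.

Lemma dotvNl n (u v : 'cV[R]_n) : dotv (- u) v = - dotv u v.
Proof. by rewrite -scaleN1r dotvZl mulN1r. Qed.

Lemma dotvNr n (u v : 'cV[R]_n) : dotv u (- v) = - dotv u v.
Proof. by rewrite dotvC dotvNl dotvC. Qed.

Definition dotv_lin := (dotvDl, dotvDr, dotvZl, dotvZr, dotvNl, dotvNr).

Lemma dotv_mulmx m n (A : 'M[R]_(m, n)) u v :
  dotv (A *m u) v = dotv u (A^T *m v).
Proof. by rewrite -!dotvE trmx_mul mulmxA. Qed.

Lemma nsqE n (v : 'cV[R]_n) : nsq v = \sum_i v i 0 ^+ 2.
Proof. by apply: eq_bigr => i _; rewrite expr2. Qed.

Lemma nsq_ge0 n (v : 'cV[R]_n) : 0 <= nsq v.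
Proof. by rewrite nsqE sumr_ge0 // => i _; rewrite sqr_ge0. Qed.
Hint Resolve nsq_ge0 : core.

Lemma nsq_eq0 n (v : 'cV[R]_n) : nsq v = 0 -> v = 0.
Proof.
rewrite nsqE => /eqP; rewrite psumr_eq0 => [/allP v0|i _]; last exact: sqr_ge0.
apply/matrixP => i j; rewrite ord1 mxE; apply/eqP.
by rewrite -sqrf_eq0; apply: v0; rewrite mem_index_enum.
Qed.

Lemma nsq0 n : nsq (0 : 'cV[R]_n) = 0.
Proof. by rewrite nsqE big1 // => i _; rewrite mxE expr0n. Qed.

Lemma nsqZ n a (v : 'cV[R]_n) : nsq (a *: v) = a ^+ 2 * nsq v.
Proof. by rewrite /nsq !dotv_lin mulrA. Qed.

Lemma nsqN n (v : 'cV[R]_n) : nsq (- v) = nsq v.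
Proof. by rewrite /nsq !dotv_lin opprK. Qed.

Lemma nsqD n (u v : 'cV[R]_n) : nsq (u + v) = nsq u + 2 * dotv u v + nsq v.
Proof. by rewrite /nsq !dotv_lin (dotvC v u); ring. Qed.

Lemma dotv_sum_sqr n (v : 'cV[R]_n) i : v i 0 ^+ 2 <= nsq v.
Proof. by rewrite nsqE (bigD1 i) //= lerDl sumr_ge0 // => j _; rewrite sqr_ge0. Qed.

Lemma sum_cauchy_schwarz (I : finType) (f g : I -> R) :
  (\sum_i f i * g i) ^+ 2 <= (\sum_i f i ^+ 2) * (\sum_i g i ^+ 2).
Proof.
set a := \sum_i f i ^+ 2; set b := \sum_i f i * g i; set c := \sum_i g i ^+ 2.
have a0 : 0 <= a by rewrite sumr_ge0 // => i _; rewrite sqr_ge0.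
have q x : 0 <= a * x ^+ 2 - 2 * b * x + c.
  have -> : a * x ^+ 2 - 2 * b * x + c = \sum_i (f i * x - g i) ^+ 2.
    rewrite /a /b /c mulr_suml mulr_sumr mulr_suml -sumrB -big_split /=.
    by apply: eq_bigr => i _; ring.
  by rewrite sumr_ge0 // => i _; rewrite sqr_ge0.
have [a_eq0|an0] := eqVneq a 0.
  have f0 i : f i = 0.
    apply/eqP; rewrite -sqrf_eq0; move/eqP: a_eq0; rewrite psumr_eq0 => [/allP|j _].
      by apply; rewrite mem_index_enum.
    exact: sqr_ge0.
  by rewrite a_eq0 mul0r /b big1 ?expr0n // => i _; rewrite f0 mul0r.
have {a0} a0 : 0 < a by rewrite lt_neqAle eq_sym an0.
(* The quadratic [q] is evaluated at its minimiser. *)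
have := q (b / a).
have -> : a * (b / a) ^+ 2 - 2 * b * (b / a) + c = (a * c - b ^+ 2) / a by field.
by rewrite pmulr_lge0 ?invr_gt0 // subr_ge0.
Qed.

Lemma cauchy_schwarz n (u v : 'cV[R]_n) : dotv u v ^+ 2 <= nsq u * nsq v.
Proof. by rewrite !nsqE; exact: sum_cauchy_schwarz. Qed.

Lemma nsqD_le n (u v : 'cV[R]_n) : nsq (u + v) <= 2 * nsq u + 2 * nsq v.
Proof.
have := nsq_ge0 (u - v); rewrite !nsqD dotvNr nsqN; lra.
Qed.

Lemma nsqD_ge n (u v : 'cV[R]_n) : nsq u / 2 - nsq v <= nsq (u + v).
Proof.
have := nsqD_le (u + v) (- v); rewrite nsqN addrK; lra.
Qed.

Definition vnorm n (v : 'cV[R]_n) : R := Num.sqrt (nsq v).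

Lemma vnorm_ge0 n (v : 'cV[R]_n) : 0 <= vnorm v.
Proof. exact: sqrtr_ge0. Qed.

Lemma sqr_vnorm n (v : 'cV[R]_n) : vnorm v ^+ 2 = nsq v.
Proof. exact: sqr_sqrtr. Qed.

Lemma dotv_le n (u v : 'cV[R]_n) : dotv u v <= vnorm u * vnorm v.
Proof.
apply: (le_trans (ler_norm _)); rewrite -sqrtr_sqr -sqrtrM //.
by apply: ler_wsqrtr; exact: cauchy_schwarz.
Qed.

Lemma vnormD n (u v : 'cV[R]_n) : vnorm (u + v) <= vnorm u + vnorm v.
Proof.
rewrite -(ler_pXn2r (n := 2)) ?nnegrE ?addr_ge0 ?vnorm_ge0 //.
by rewrite sqrrD !sqr_vnorm nsqD; have := dotv_le u v; lra.
Qed.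

Lemma nsq_delta n (i : 'I_n) : nsq (delta_mx i 0 : 'cV[R]_n) = 1.
Proof.
rewrite nsqE (bigD1 i) //= mxE !eqxx expr1n big1 ?addr0 // => j ji.
by rewrite mxE (negPf ji) expr0n.
Qed.

Lemma trmxK_gram m n (A : 'M[R]_(m, n)) : (A *m A^T)^T = A *m A^T.
Proof. by rewrite trmx_mul trmxK. Qed.

Lemma dotv_gram m n (A : 'M[R]_(m, n)) u v :
  dotv u (A *m A^T *m v) = dotv (A^T *m u) (A^T *m v).
Proof. by rewrite dotvC -mulmxA dotv_mulmx dotvC. Qed.

Lemma mxtrace_sqr m n (A : 'M[R]_(m, n)) :
  \tr (A^T *m A) = \sum_i \sum_j A i j ^+ 2.
Proof.
rewrite exchange_big /=; apply: eq_bigr => j _; rewrite mxE.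
by apply: eq_bigr => i _; rewrite mxE.
Qed.

Lemma mxtrace_sqr_col m n (A : 'M[R]_(m, n)) :
  \tr (A^T *m A) = \sum_j nsq (A *m delta_mx j 0).
Proof.
rewrite mxtrace_sqr exchange_big /=; apply: eq_bigr => j _.
by rewrite -colE nsqE; apply: eq_bigr => i _; rewrite !mxE.
Qed.

Lemma dotv_deltal n (i : 'I_n) (v : 'cV[R]_n) : dotv (delta_mx i 0) v = v i 0.
Proof.
rewrite /dotv (bigD1 i) //= mxE !eqxx mul1r big1 ?addr0 // => j ji.
by rewrite mxE (negPf ji) mul0r.
Qed.

(** For [y = A^T *m u], Cauchy-Schwarz on [nsq y = dotv u (A *m y)] bounds [nsq y ^+ 2] by
    [B * nsq u * nsq y], and one factor [nsq y] cancels. *)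
Lemma nsq_trmx_le m n (A : 'M[R]_(m, n)) B : 0 <= B ->
  (forall v, nsq (A *m v) <= B * nsq v) -> forall u, nsq (A^T *m u) <= B * nsq u.
Proof.
move=> B0 AB u; set y := A^T *m u.
have yE : nsq y = dotv u (A *m y) by rewrite dotvC dotv_mulmx.
have := cauchy_schwarz u (A *m y); rewrite -yE => h.
have {}h : nsq y ^+ 2 <= B * nsq u * nsq y.
  by apply: (le_trans h); rewrite (mulrC B) -mulrA ler_wpM2l.
have := nsq_ge0 y; rewrite le_eqVlt => /predU1P[<-|y0].
  by rewrite mulr_ge0.
by rewrite -(ler_pM2r y0) -expr2.
Qed.

End InnerProduct.
#[global] Hint Extern 0 (is_true (0 <= nsq _)) => exact: nsq_ge0 : core.
#[global] Hint Extern 0 (is_true (0 <= vnorm _)) => exact: vnorm_ge0 : core.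

(** * Resolvent and smoother of a Gram matrix *)

Section RidgeAlgebra.
Context {R : realType} {n p : nat}.
Variables (X : 'M[R]_(n, p)) (t : R).
Hypothesis t_gt0 : 0 < t.
Local Notation A := (X *m X^T).
Definition resolvent : 'M[R]_n := invmx (A + t%:M).
Local Notation M := resolvent.

Lemma gram_shift_unit : (A + t%:M : 'M[R]_n) \in unitmx.
Proof.
rewrite -row_free_unit; apply: inj_row_free => v v0.
have : dotv v^T ((A + t%:M)^T *m v^T) = 0.
  by rewrite -trmx_mul v0 trmx0 /dotv big1 // => i _; rewrite !mxE mulr0.
rewrite linearD /= trmxK_gram tr_scalar_mx mulmxDl mul_scalar_mx.
rewrite dotvDr dotvZr dotv_gram.
have := nsq_ge0 (X^T *m v^T); have := nsq_ge0 v^T; rewrite /nsq => h1 h2 h3.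
have h : nsq v^T = 0 by apply/eqP; rewrite eq_le h1 andbT /nsq -(ler_pM2l t_gt0); lra.
by have := nsq_eq0 h; rewrite -[RHS]trmx0 => /trmx_inj.
Qed.

Lemma resolventE (u : 'cV[R]_n) : A *m (M *m u) + t *: (M *m u) = u.
Proof.
rewrite -mul_scalar_mx -mulmxDl mulmxA /resolvent mulmxV ?mul1mx //.
exact: gram_shift_unit.
Qed.

Lemma resolvent_eq (u v : 'cV[R]_n) : A *m v + t *: v = u -> v = M *m u.
Proof.
rewrite -mul_scalar_mx -mulmxDl => <-; rewrite mulmxA mulVmx ?mul1mx //.
exact: gram_shift_unit.
Qed.

Lemma trmx_resolvent : M^T = M.
Proof. by rewrite trmx_inv linearD /= trmxK_gram tr_scalar_mx. Qed.

(** This is why the bias appears throughout as [t *: (M *m u)]: it is, up to sign, what the smoother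
    misses of the signal [u]. *)
Lemma gram_resolventE : A *m M = 1%:M - t *: M.
Proof.
apply/eqP; rewrite eq_sym subr_eq -mul_scalar_mx -mulmxDl mulmxV //.
exact: gram_shift_unit.
Qed.

Lemma trmx_gram_resolvent : (A *m M)^T = A *m M.
Proof.
by rewrite gram_resolventE linearB linearZ /= tr_scalar_mx trmx_resolvent.
Qed.

(** The square of [u = A v + t v] is expanded with [v = M *m u]. All three terms are nonnegative, so
    the smoother and its residual are both contractions. *)
Lemma nsq_resolvent (u : 'cV[R]_n) :
  nsq u = nsq (A *m (M *m u)) + 2 * t * nsq (X^T *m (M *m u))
          + t ^+ 2 * nsq (M *m u).
Proof.
rewrite -{1}(resolventE u); set v := M *m u.
rewrite nsqD nsqZ dotvZr dotvC dotv_gram /nsq; ring.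
Qed.

Lemma nsq_residual_le (u : 'cV[R]_n) : nsq (t *: (M *m u)) <= nsq u.
Proof.
have h : 0 <= t * nsq (X^T *m (M *m u)) by exact: mulr_ge0 (ltW t_gt0) (nsq_ge0 _).
by rewrite (nsq_resolvent u) nsqZ; have := nsq_ge0 (A *m (M *m u)); lra.
Qed.

Lemma nsq_smoother_le (u : 'cV[R]_n) : nsq (A *m M *m u) <= nsq u.
Proof.
have h : 0 <= t * nsq (X^T *m (M *m u)) by exact: mulr_ge0 (ltW t_gt0) (nsq_ge0 _).
have h' : 0 <= t ^+ 2 * nsq (M *m u) by exact: mulr_ge0 (sqr_ge0 _) (nsq_ge0 _).
by rewrite (nsq_resolvent u) -mulmxA; lra.
Qed.

Lemma dotv_smoother (u : 'cV[R]_n) :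
  dotv u (A *m M *m u) = nsq (A *m (M *m u)) + t * nsq (X^T *m (M *m u)).
Proof.
rewrite -mulmxA; set v := M *m u; rewrite -{1}(resolventE u) -/v.
by rewrite dotvDl dotvZl [X in t * X]dotv_gram.
Qed.

Lemma smoother_trace_le : \tr ((A *m M)^T *m (A *m M)) <= n%:R.
Proof.
rewrite mxtrace_sqr_col -[n in n%:R]card_ord -sumr_const.
by apply: ler_sum => j _; rewrite -(nsq_delta j); exact: nsq_smoother_le.
Qed.

End RidgeAlgebra.

(** * Bias and variance for a design split into head and tail *)

Section SplitDesign.
Context {R : realType} {n p d q : nat}.
Variables (X : 'M[R]_(n, p)) (Xh : 'M[R]_(n, d)) (Xt : 'M[R]_(n, q)).
Hypothesis gram_split : X *m X^T = Xh *m Xh^T + Xt *m Xt^T.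
Variables (t B : R).
Hypotheses (t_gt0 : 0 < t) (B_ge0 : 0 <= B).
Hypothesis Xt_le : forall u, nsq (Xt^T *m u) <= B * nsq u.
Local Notation A := (X *m X^T).
Local Notation M := (resolvent X t).
Local Notation H := (A *m M).

Lemma Xt_le' v : nsq (Xt *m v) <= B * nsq v.
Proof.
rewrite -[Xt]trmxK; apply: (nsq_trmx_le B_ge0) => u; exact: Xt_le.
Qed.

Lemma tail_gram_le u : nsq (Xt *m Xt^T *m u) <= B * nsq (Xt^T *m u).
Proof. by rewrite -mulmxA; exact: Xt_le'. Qed.

Lemma tail_gram_le2 u : nsq (Xt *m Xt^T *m u) <= B ^+ 2 * nsq u.
Proof. by rewrite (le_trans (tail_gram_le u)) // expr2 -mulrA ler_wpM2l. Qed.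

Lemma nsq_gram_split u : nsq (X^T *m u) = nsq (Xh^T *m u) + nsq (Xt^T *m u).
Proof. by rewrite /nsq -!dotv_gram -dotvDr -mulmxDl -gram_split. Qed.

(* The quadratic form of the smoother is a supremum over fitted values; the
   bound comes from testing it at a multiple of [Xt *m Xt^T *m u]. *)
Lemma dotv_smoother_ge u : nsq (Xt^T *m u) <= (B + t) * dotv u (H *m u).
Proof.
rewrite dotv_smoother //; set v := M *m u.
set N := nsq (A *m v) + _; set w := Xt *m Xt^T *m u; set y := nsq (Xt^T *m u).
have g0 : 0 < B + t by rewrite ltr_wpDl.
have uw : dotv u w = y by rewrite /w dotv_gram.
have yE : y = dotv (A *m v) w + t * dotv (Xt^T *m v) (Xt^T *m u).
  by rewrite -uw -{1}(resolventE X t_gt0 u) -/v dotvDl dotvZl [X in t * X]dotv_gram.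
have h1 := nsq_ge0 ((B + t) *: (A *m v) - w).
have h2 := mulr_ge0 (ltW t_gt0) (nsq_ge0 ((B + t) *: (Xt^T *m v) - Xt^T *m u)).
have h3 : (B + t) ^+ 2 * (t * nsq (Xt^T *m v)) <= (B + t) ^+ 2 * (t * nsq (X^T *m v)).
  rewrite ler_wpM2l ?sqr_ge0 // ler_wpM2l ?(ltW t_gt0) //.
  by rewrite nsq_gram_split lerDr.
have h4 : nsq w <= B * y by exact: tail_gram_le.
move: h1 h2; rewrite !nsqD !nsqZ !nsqN !dotvNr !dotvZl -/y => h1 h2.
rewrite -(ler_pM2l g0) /N; nra.
Qed.

(** Testing [dotv_smoother_ge] on the basis vectors bounds the trace of [H] from below;
    Cauchy-Schwarz over its [n] diagonal entries then passes from the trace to the Frobenius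
    norm. *)
Lemma smoother_trace_ge :
  \tr (Xt *m Xt^T) ^+ 2 <= n%:R * (B + t) ^+ 2 * \tr (H^T *m H).
Proof.
have g0 : 0 < B + t by rewrite ltr_wpDl.
have trE : \tr (Xt *m Xt^T) = \sum_i nsq (Xt^T *m delta_mx i 0).
  by rewrite -mxtrace_sqr_col trmxK.
have le1 : \tr (Xt *m Xt^T) <= (B + t) * \sum_i H i i.
  rewrite trE mulr_sumr; apply: ler_sum => i _.
  apply: (le_trans (dotv_smoother_ge _)); rewrite dotv_deltal -colE mxE.
  by [].
have tr0 : 0 <= \tr (Xt *m Xt^T) by rewrite trE sumr_ge0.
have le2 : (\sum_i H i i) ^+ 2 <= n%:R * \tr (H^T *m H).
  have := sum_cauchy_schwarz (fun i : 'I_n => 1 : R) (fun i => H i i).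
  under eq_bigr do rewrite mul1r; move=> /le_trans; apply.
  under eq_bigr do rewrite expr1n; rewrite sumr_const card_ord ler_wpM2l //.
  rewrite mxtrace_sqr; apply: ler_sum => i _; rewrite (bigD1 i) //= lerDl.
  by rewrite sumr_ge0 // => j _; rewrite sqr_ge0.
have le3 : \tr (Xt *m Xt^T) ^+ 2 <= ((B + t) * \sum_i H i i) ^+ 2.
  by rewrite ler_pXn2r ?nnegrE // (le_trans tr0).
apply: (le_trans le3).
by rewrite exprMn (mulrC n%:R) -[leRHS]mulrA ler_wpM2l ?sqr_ge0.
Qed.

(** Let [P] be the orthogonal projection onto the column space of [Xh]. The part [P *m H] has
    squared Frobenius norm at most [\tr P = d], since [H] is a contraction. The complementary part
    kills [Xh], so that only [Xt *m Xt^T *m M] is left, of operator norm at most [B / t]; each of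
    the [n] basis vectors contributes its square. *)
Lemma smoother_trace_le_split : Xh^T *m Xh \in unitmx ->
  \tr (H^T *m H) <= d%:R + n%:R * (B / t) ^+ 2.
Proof.
move=> Gu; pose P := Xh *m invmx (Xh^T *m Xh) *m Xh^T.
have PT : P^T = P by rewrite /P !trmx_mul trmx_inv trmx_mul trmxK mulmxA.
have PXh : P *m Xh = Xh by rewrite /P -!mulmxA mulVmx ?mulmx1.
have PP : P *m P = P by rewrite {2}/P !mulmxA PXh.
have trP : \tr P = d%:R.
  by rewrite /P -mulmxA mxtrace_mulC -mulmxA mulVmx // mxtrace_scalar.
have pyth (u : 'cV[R]_n) : nsq u = nsq (P *m u) + nsq (u - P *m u).
  rewrite nsqD nsqN dotvNr -/(nsq (P *m u)).
  have -> : dotv u (P *m u) = nsq (P *m u).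
    by rewrite /nsq dotv_mulmx PT mulmxA PP.
  ring.
have nsqP (u : 'cV[R]_n) : nsq (u - P *m u) <= nsq u by rewrite [leRHS]pyth lerDr.
rewrite mxtrace_sqr_col.
have -> : \sum_j nsq (H *m delta_mx j 0) =
    \sum_j nsq (P *m H *m delta_mx j 0) +
    \sum_j nsq (H *m delta_mx j 0 - P *m (H *m delta_mx j 0)).
  by rewrite -big_split; apply: eq_bigr => j _; rewrite [LHS]pyth mulmxA.
apply: lerD.
  (* The Frobenius norm is invariant under transposition, and in [(P *m H)^T = H *m P] the
     contraction acts last, on the vectors [P *m e_j]. *)
  rewrite -mxtrace_sqr_col mxtrace_mulC -{1}[P *m H]trmxK mxtrace_sqr_col.
  have -> : d%:R = \sum_j nsq (P *m delta_mx j 0).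
    by rewrite -mxtrace_sqr_col PT PP trP.
  apply: ler_sum => j _.
  rewrite trmx_mul PT trmx_gram_resolvent // -[_ *m delta_mx _ _]mulmxA.
  exact: nsq_smoother_le.
rewrite -[X in X%:R * _]card_ord -sumr_const mulr_suml; apply: ler_sum => j _.
set e := delta_mx j 0; set v := M *m e.
have -> : H *m e = Xh *m (Xh^T *m v) + Xt *m Xt^T *m v.
  by rewrite -(mulmxA A) gram_split mulmxDl -mulmxA.
rewrite mulmxDr [P *m (Xh *m _)]mulmxA PXh opprD addrACA subrr add0r mul1r.
apply: (le_trans (nsqP _)); apply: (le_trans (tail_gram_le2 _)).
rewrite exprMn ler_wpM2l ?sqr_ge0 // exprVn.
have := nsq_residual_le X t_gt0 e; rewrite nsq_delta nsqZ -/v => h.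
by rewrite -(ler_pM2l (exprn_gt0 2 t_gt0)) divff ?gt_eqF ?exprn_gt0.
Qed.

Section Head.
Variables (lam : 'I_d -> R) (mu : R) (th : 'cV[R]_d) (k K : R).
Hypotheses (lam_gt0 : forall j, 0 < lam j) (k_gt0 : 0 < k).
Hypothesis Xh_ge : forall u : 'cV[R]_d, k * \sum_j lam j * u j 0 ^+ 2 <= nsq (Xh *m u).
Local Notation hn := (\sum_j th j 0 ^+ 2 / lam j).

Lemma head_gram_unit : Xh^T *m Xh \in unitmx.
Proof.
rewrite -row_free_unit; apply: inj_row_free => v v0.
have hv : nsq (Xh *m v^T) = 0.
  have e : Xh^T *m Xh *m v^T = 0.
    by apply: trmx_inj; rewrite !trmx_mul !trmxK v0 trmx0.
  by rewrite /nsq dotv_mulmx mulmxA e /dotv big1 // => i _; rewrite !mxE mulr0.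
have := Xh_ge v^T; rewrite hv pmulr_rle0 // => s0.
have {}s0 : \sum_j lam j * v^T j 0 ^+ 2 == 0.
  by rewrite eq_le s0 sumr_ge0 // => j _; rewrite mulr_ge0 ?sqr_ge0 // ltW.
move: s0; rewrite psumr_eq0 => [/allP s0|j _]; last by rewrite mulr_ge0 ?sqr_ge0 // ltW.
apply/matrixP => i j; rewrite ord1 !mxE.
have := s0 j; rewrite mem_index_enum mulf_eq0 gt_eqF //= => /(_ isT).
by rewrite sqrf_eq0 !mxE => /eqP.
Qed.

(** A self-bounding argument. The energy [W] of [v] for the form [Xt *m Xt^T + t] equals
    [dotv v (Xh *m u)], where [u] is the coefficient error. It is at most [dotv th u], whose
    Cauchy-Schwarz bound is again controlled by [W]; one factor [W] cancels, and
    [t * nsq v <= W]. *)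
Lemma head_bias_le : nsq (t *: (M *m (Xh *m th))) <= t * (hn * (B + t) / k).
Proof.
set v := M *m _; set u := th - Xh^T *m v; set y := nsq (Xt^T *m v).
have g0 : 0 < B + t by rewrite ltr_wpDl.
have Xu : Xh *m u = Xt *m Xt^T *m v + t *: v.
  apply/eqP; rewrite /u mulmxBr subr_eq [eqbRHS]addrC mulmxA addrA.
  by rewrite -mulmxDl -gram_split resolventE.
pose W := y + t * nsq v.
have WE : W = dotv v (Xh *m u).
  by rewrite Xu dotvDr dotvZr dotv_gram.
have y0 : 0 <= y by exact: nsq_ge0.
have W0 : 0 <= W by rewrite addr_ge0 // mulr_ge0 // ltW.
(* As [Xh^T *m v = th - u], the energy is [dotv th u - nsq u]. *)
have W_le : W <= dotv th u.
  rewrite WE dotvC dotv_mulmx dotvC (_ : Xh^T *m v = th - u).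
    by rewrite dotvDl dotvNl gerDl oppr_le0; exact: nsq_ge0.
  by rewrite /u opprB addrC subrK.
have CS : dotv th u ^+ 2 <= hn * \sum_j lam j * u j 0 ^+ 2.
  have := sum_cauchy_schwarz (fun j => th j 0 / Num.sqrt (lam j))
                             (fun j => Num.sqrt (lam j) * u j 0).
  under eq_bigr => j _.
    rewrite mulrA divfK ?gt_eqF ?sqrtr_gt0 //; over.
  under [X in _ <= X * _]eq_bigr => j _.
    rewrite exprMn exprVn sqr_sqrtr ?(ltW (lam_gt0 j)) //; over.
  under [X in _ <= _ * X]eq_bigr => j _.
    rewrite exprMn sqr_sqrtr ?(ltW (lam_gt0 j)) //; over.
  by [].
have yB : y <= B * nsq v by exact: Xt_le.
have Ev : nsq (Xh *m u) <= (B + t) * W.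
  rewrite Xu nsqD nsqZ dotvZr [dotv _ v]dotvC dotv_gram -/(nsq _) -/y /W.
  have := tail_gram_le v; rewrite -/y.
  have := ler_wpM2l (ltW t_gt0) yB; lra.
have hn0 : 0 <= hn by rewrite sumr_ge0 // => j _; rewrite divr_ge0 ?sqr_ge0 // ltW.
have {}W_le : W ^+ 2 <= hn * ((B + t) * W / k).
  apply: (@le_trans _ _ (dotv th u ^+ 2)).
    by rewrite ler_pXn2r ?nnegrE // (le_trans W0).
  apply: (le_trans CS); rewrite ler_wpM2l // ler_pdivlMr // mulrC.
  exact: (le_trans (Xh_ge u)).
have {}W_le : W <= hn * (B + t) / k.
  move: W0; rewrite le_eqVlt => /predU1P[<-|W0].
    by rewrite divr_ge0 ?(ltW k_gt0) // mulr_ge0 // ltW.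
  by rewrite -(ler_pM2r W0) -expr2 (le_trans W_le) // !mulrA mulrAC.
rewrite nsqZ expr2 -mulrA ler_wpM2l ?(ltW t_gt0) //.
by apply: le_trans W_le; rewrite /W lerDr.
Qed.

Hypothesis Xh_le : forall u : 'cV[R]_d, nsq (Xh *m u) <= K * \sum_j lam j * u j 0 ^+ 2.
Hypothesis mu_gt0 : 0 < mu.
Hypothesis mu_le : forall j, mu <= lam j.
Hypothesis K_ge0 : 0 <= K.

(** Dual form of [Xh_le], obtained by testing it at [a], the image of [Xh^T *m y] under the inverse
    of the diagonal matrix of the [lam j]. *)
Lemma head_dual_le (y : 'cV[R]_n) : \sum_j (Xh^T *m y) j 0 ^+ 2 / lam j <= K * nsq y.
Proof.
set S := \sum_j _; pose a := \col_j ((Xh^T *m y) j 0 / lam j).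
have S1 : S = \sum_j lam j * a j 0 ^+ 2.
  by apply: eq_bigr => j _; rewrite /a mxE; field; rewrite gt_eqF.
have S2 : S = dotv y (Xh *m a).
  rewrite dotvC dotv_mulmx dotvC; apply: eq_bigr => j _.
  by rewrite /a [X in _ = _ * X]mxE expr2 mulrA.
have S0 : 0 <= S by rewrite sumr_ge0 // => j _; rewrite divr_ge0 ?sqr_ge0 // ltW.
have : S ^+ 2 <= nsq y * (K * S).
  rewrite {1}S2; apply: (le_trans (cauchy_schwarz _ _)).
  by rewrite ler_wpM2l // S1 Xh_le.
move: S0; rewrite le_eqVlt => /predU1P[<- _|S0]; first by rewrite mulr_ge0.
by rewrite expr2 mulrA ler_pM2r // mulrC.
Qed.

(* With [B <= t] the tail only perturbs the ridge penalty by a factor 2, so the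
   bias is compared with that of ridge regression on the head alone. *)
Lemma head_bias_ge : B <= t ->
  hn <= 8 * (K + t ^+ 2 / (mu ^+ 2 * k)) * nsq (M *m (Xh *m th)).
Proof.
move=> Bt; set v := M *m _.
(* Here [y] is the analogue of [v] without the tail, in the push-through form
   [Xh (Xh^T Xh + t)^-1 th]. This form exposes [th = Xh^T y + t u], whose two terms are bounded by
   [nsq y] in [S1] and [S2]. *)
pose u := resolvent Xh^T t *m th; pose y := Xh *m u.
have uE : Xh^T *m y + t *: u = th.
  by have := resolventE Xh^T t_gt0 th; rewrite trmxK -/u -mulmxA.
pose r := y - v.
have rE : Xh *m Xh^T *m r + t *: r = Xt *m Xt^T *m v.
  have h1 : Xh *m Xh^T *m y + t *: y = Xh *m th.
    by rewrite -uE mulmxDr -scalemxAr mulmxA.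
  have h2 : Xh *m Xh^T *m v + Xt *m Xt^T *m v + t *: v = Xh *m th.
    by rewrite -mulmxDl -gram_split resolventE.
  apply/eqP; rewrite /r mulmxBr scalerBr addrACA -opprD subr_eq h1 -h2.
  by rewrite -addrA addrCA.
(* The error [r = y - v] solves a ridge equation on the head with right-hand side [Xt *m Xt^T *m v],
   so its norm is at most [B / t <= 1] times that of [v]. *)
have yv : nsq y <= 4 * nsq v.
  have := nsq_residual_le Xh t_gt0 (Xt *m Xt^T *m v).
  rewrite -(resolvent_eq t_gt0 rE) nsqZ => h.
  have {}h : nsq r <= nsq v.
    rewrite -(ler_pM2l (exprn_gt0 2 t_gt0)) (le_trans h) //.
    rewrite (le_trans (tail_gram_le2 _)) // ler_wpM2r //.
    by rewrite ler_pXn2r ?nnegrE // (le_trans B_ge0).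
  have := nsqD_le r v; rewrite /r subrK -/r; lra.
have S2 : \sum_j u j 0 ^+ 2 / lam j <= nsq y / (mu ^+ 2 * k).
  rewrite ler_pdivlMr ?mulr_gt0 ?exprn_gt0 //.
  apply: le_trans (Xh_ge u); rewrite mulrA mulrC ler_wpM2l ?(ltW k_gt0) //.
  rewrite mulr_suml; apply: ler_sum => j _.
  rewrite mulrAC ler_pdivrMr // [leRHS]mulrAC [leRHS]mulrC ler_wpM2l ?sqr_ge0 //.
  by rewrite -expr2 ler_pXn2r ?nnegrE ?(ltW mu_gt0) // ltW.
have S1 := head_dual_le y.
have : hn <= 2 * \sum_j (Xh^T *m y) j 0 ^+ 2 / lam j
             + 2 * t ^+ 2 * \sum_j u j 0 ^+ 2 / lam j.
  rewrite !mulr_sumr -big_split; apply: ler_sum => j _ /=.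
  rewrite !mulrA -mulrDl ler_pdivrMr // divfK ?gt_eqF //.
  have -> : th j 0 = (Xh^T *m y) j 0 + t * u j 0.
    by rewrite -[in LHS]uE mxE [X in _ + X]mxE.
  set a := (Xh^T *m y) j 0; set b := u j 0.
  have := sqr_ge0 (a - t * b); nra.
move=> /le_trans; apply.
have := ler_wpM2l (sqr_ge0 t) S2.
have c0 : 0 <= K + t ^+ 2 / (mu ^+ 2 * k).
  by rewrite addr_ge0 // divr_ge0 ?sqr_ge0 // mulr_ge0 ?sqr_ge0 // ltW.
have := ler_wpM2l c0 yv; set z := t ^+ 2 / (mu ^+ 2 * k) => h.
have -> : t ^+ 2 * (nsq y / (mu ^+ 2 * k)) = z * nsq y by rewrite /z; ring.
lra.
Qed.

End Head.
End SplitDesign.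

(** * The limit of vanishing penalty, and deterministic bounds on the risk *)

Section RidgeLimit.
Context {R : realType}.

Lemma cvg_sumr (I : Type) (r : seq I) (f : I -> nat -> R) (l : I -> R) :
  (forall i, f i k @[k --> \oo] --> l i) ->
  \sum_(i <- r) f i k @[k --> \oo] --> \sum_(i <- r) l i.
Proof.
move=> fl; elim: r => [|i r IHr].
  by rewrite big_nil; under eq_fun do rewrite big_nil; exact: cvg_cst.
by rewrite big_cons; under eq_fun do rewrite big_cons; exact: cvgD.
Qed.

Lemma cvg_sqrr (f : nat -> R) (l : R) :
  f k @[k --> \oo] --> l -> f k ^+ 2 @[k --> \oo] --> l ^+ 2.
Proof. by move=> fl; rewrite expr2; under eq_fun do rewrite expr2; exact: cvgM. Qed.

Lemma nsq_mulmx_le m n (A : 'M[R]_(m, n)) v :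
  nsq (A *m v) <= \tr (A^T *m A) * nsq v.
Proof.
rewrite mxtrace_sqr mulr_suml nsqE; apply: ler_sum => i _.
by rewrite mxE nsqE; exact: sum_cauchy_schwarz.
Qed.

(** At [tau = 0] any generalised inverse of [A *m A] will do: with [C = X^T *m pinvmx (A *m A)] one
    has [X^T = C *m (A *m A)]. For a positive penalty the ridge matrix is then [C *m A *m (A *m M)],
    where [A *m M] tends to the identity on the range of [A], and [C *m A] is its limit. *)
Definition ridge_mx n p (tau : R) (X : 'M[R]_(n, p)) : 'M[R]_(p, n) :=
  let A := X *m X^T in
  if tau == 0 then X^T *m pinvmx (A *m A) *m A
  else X^T *m invmx (A + (n%:R * tau)%:M).

Definition smoother n p (tau : R) (X : 'M[R]_(n, p)) : 'M[R]_n :=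
  X *m ridge_mx tau X.

Section Fixed.
Variables (n p : nat) (X : 'M[R]_(n, p)).
Local Notation A := (X *m X^T).
Hypothesis n_gt0 : (0 < n)%N.

Let nR_gt0 : 0 < n%:R :> R. Proof. by rewrite ltr0n. Qed.

Lemma ridge_mx_gt0 tau : 0 < tau ->
  ridge_mx tau X = X^T *m resolvent X (n%:R * tau).
Proof. by move=> tau0; rewrite /ridge_mx gt_eqF. Qed.

Lemma smoother_gt0 tau : 0 < tau ->
  smoother tau X = A *m resolvent X (n%:R * tau).
Proof. by move=> tau0; rewrite /smoother ridge_mx_gt0 // mulmxA. Qed.

Lemma gram2_ker (y : 'cV[R]_n) : A *m A *m y = 0 -> X^T *m y = 0.
Proof.
move=> AAy; apply: nsq_eq0; rewrite /nsq -dotv_gram.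
suff -> : A *m y = 0 by rewrite /dotv big1 // => k _; rewrite !mxE mulr0.
apply: nsq_eq0; rewrite /nsq dotv_mulmx trmxK_gram mulmxA AAy.
by rewrite /dotv big1 // => k _; rewrite !mxE mulr0.
Qed.

Lemma trmx_sub_gram2 : X^T *m pinvmx (A *m A) *m (A *m A) = X^T.
Proof.
apply: mulmxKpV; rewrite submxE; set K := cokermx _.
have AAK : A *m A *m K = 0 by exact: mulmx_coker.
apply/eqP/matrixP => i j.
have : X^T *m (K *m delta_mx j 0 : 'cV_n) = 0.
  by apply: gram2_ker; rewrite [LHS]mulmxA AAK mul0mx.
by rewrite mulmxA -colE => /matrixP/(_ i 0); rewrite !mxE.
Qed.

(** Since [1 - A *m M = t *: M], the difference is [t *: C *m (A *m M *m y)] with [t = n * tau]. The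
    smoother [A *m M] is a contraction, which leaves an error linear in [tau]. *)
Lemma ridge_mx_dist tau (y : 'cV[R]_n) i : 0 < tau ->
  `|((ridge_mx 0 X - ridge_mx tau X) *m y) i 0| <=
  tau * (n%:R * Num.sqrt (\tr ((X^T *m pinvmx (A *m A))^T *m (X^T *m pinvmx (A *m A)))
                          * nsq y)).
Proof.
move=> tau0; set C := X^T *m _; have t0 : 0 < n%:R * tau by rewrite mulr_gt0.
have -> : (ridge_mx 0 X - ridge_mx tau X) *m y =
    (n%:R * tau) *: (C *m (A *m resolvent X (n%:R * tau) *m y)).
  set M := resolvent X _.
  have -> : ridge_mx 0 X = C *m A by rewrite /ridge_mx eqxx.
  have -> : ridge_mx tau X = C *m (A *m (A *m M)).
    by rewrite (ridge_mx_gt0 tau0) (mulmxA A A) (mulmxA C) trmx_sub_gram2.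
  have tM : 1%:M - A *m M = (n%:R * tau) *: M.
    by rewrite (gram_resolventE X t0) opprB addrC subrK.
  rewrite -mulmxBr -[X in X - _]mulmx1 -mulmxBr tM.
  by rewrite -!scalemxAr -scalemxAl !mulmxA.
rewrite mxE normrM gtr0_norm // -[leLHS]mulrA [leLHS](mulrCA n%:R) ler_pM2l // ler_pM2l //.
rewrite -sqrtr_sqr; apply: ler_wsqrtr; apply: (le_trans (dotv_sum_sqr _ _)).
apply: (le_trans (nsq_mulmx_le _ _)); rewrite ler_wpM2l ?nsq_smoother_le //.
by rewrite mxtrace_sqr sumr_ge0 // => ? _; rewrite sumr_ge0 // => ? _; rewrite sqr_ge0.
Qed.

Lemma ridge_pos_cvg (y : 'cV[R]_n) :
  ridge_pos t X y @[t --> 0^'+] --> ridge_mx 0 X *m y.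
Proof.
set K := n%:R * Num.sqrt (\tr ((X^T *m pinvmx (A *m A))^T *m (X^T *m pinvmx (A *m A)))
                          * nsq y).
have K0 : 0 <= K by rewrite mulr_ge0 // sqrtr_ge0.
apply/cvgrPdist_le => /= e e0; near=> t.
have t0 : 0 < t by near: t; exact: nbhs_right_gt.
rewrite /ridge_pos -[X in _ - X *m _](ridge_mx_gt0 t0) -mulmxBl.
rewrite /Num.norm /= mx_normrE; apply: bigmax_le => [|[i j] _]; first exact: ltW.
rewrite ord1 /=; apply: (le_trans (ridge_mx_dist _ _ t0)); rewrite -/K.
apply: (@le_trans _ _ (t * (K + 1))); first by rewrite ler_wpM2l ?lerDl // ltW.
rewrite -ler_pdivlMr ?ltr_wpDl //; near: t; apply: nbhs_right_le.
by rewrite divr_gt0 // ltr_wpDl.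
Unshelve. all: by end_near. Qed.

Lemma ridgeE tau (y : 'cV[R]_n) : ridge tau X y = ridge_mx tau X *m y.
Proof.
rewrite /ridge; case: ifPn => [/eqP ->|tau0]; last first.
  by rewrite /ridge_mx (negPf tau0).
by apply: cvg_lim => //; exact: ridge_pos_cvg.
Qed.

(** A sequence of positive penalties is used because inequalities and measurability both pass to its
    limit. *)
Lemma ridge_mx_cvg i j : ridge_mx (harmonic k) X i j @[k --> \oo] --> ridge_mx 0 X i j.
Proof.
set K := n%:R * Num.sqrt (\tr ((X^T *m pinvmx (A *m A))^T *m (X^T *m pinvmx (A *m A)))
                          * nsq (delta_mx j 0)).
have K0 : 0 <= K by rewrite mulr_ge0 // sqrtr_ge0.
apply/cvgrPdist_le => /= e e0.
have e1 : 0 < e / (K + 1) by rewrite divr_gt0 // ltr_wpDl.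
near=> k.
have h0 : 0 < harmonic k :> R by rewrite invr_gt0.
have := ridge_mx_dist (delta_mx j 0) i h0; rewrite -colE !mxE -/K => /le_trans; apply.
apply: (@le_trans _ _ (harmonic k * (K + 1))); first by rewrite ler_wpM2l ?lerDl // ltW.
rewrite -ler_pdivlMr ?ltr_wpDl //.
rewrite -[harmonic k]ger0_norm ?(ltW h0) // -[harmonic k]subr0 distrC.
near: k; move/cvgrPdist_le: (@cvg_harmonic R) => /(_ _ e1).
by apply: filterS => k /=.
Unshelve. all: by end_near. Qed.

Lemma smoother_cvg i j : smoother (harmonic k) X i j @[k --> \oo] --> smoother 0 X i j.
Proof.
rewrite /smoother mxE; under eq_fun do rewrite mxE.
by apply: cvg_sumr => l; apply: cvgMr; exact: ridge_mx_cvg.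
Qed.

Lemma smoother_nsq_cvg (u v : 'cV[R]_n) :
  nsq (smoother (harmonic k) X *m u - v) @[k --> \oo] --> nsq (smoother 0 X *m u - v).
Proof.
rewrite nsqE; under eq_fun do rewrite nsqE.
apply: cvg_sumr => i; rewrite !mxE; under eq_fun do rewrite !mxE.
by apply: cvg_sqrr; apply: cvgB; [apply: cvg_sumr => j; apply: cvgMl; exact: smoother_cvg
                             |exact: cvg_cst].
Qed.

Lemma smoother_trace_cvg :
  \tr ((smoother (harmonic k) X)^T *m smoother (harmonic k) X) @[k --> \oo] -->
  \tr ((smoother 0 X)^T *m smoother 0 X).
Proof.
rewrite mxtrace_sqr; under eq_fun do rewrite mxtrace_sqr.
by do 2!apply: cvg_sumr => ?; apply: cvg_sqrr; exact: smoother_cvg.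
Qed.

Lemma smoother_contraction tau (u : 'cV[R]_n) : 0 <= tau ->
  nsq (smoother tau X *m u) <= nsq u.
Proof.
have pos t : 0 < t -> nsq (smoother t X *m u) <= nsq u.
  by move=> t0; rewrite smoother_gt0 //; apply: nsq_smoother_le; rewrite mulr_gt0.
rewrite le_eqVlt => /predU1P[<-|/pos //].
have : nsq (smoother (harmonic k) X *m u - 0) @[k --> \oo]
    --> nsq (smoother 0 X *m u - 0) by exact: smoother_nsq_cvg.
rewrite subr0 => /cvgr_to_le; apply.
by apply: nearW => k; rewrite subr0; apply: pos; rewrite invr_gt0.
Qed.

(** Squared bias plus variance for the signal [u]; with [u = X theta] this is shown below to be a
    version of [MSE_in]. *)
Definition mse tau (u : 'cV[R]_n) (s2 : R) : R :=
  n%:R^-1 * (nsq (smoother tau X *m u - u)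
             + s2 * \tr ((smoother tau X)^T *m smoother tau X)).

Lemma mse_cvg u s2 : mse (harmonic k) u s2 @[k --> \oo] --> mse 0 u s2.
Proof.
apply: cvgMr; apply: cvgD; first exact: smoother_nsq_cvg.
by apply: cvgMr; exact: smoother_trace_cvg.
Qed.

Lemma mse_gt0 tau u s2 : 0 < tau -> mse tau u s2 =
  n%:R^-1 * (nsq ((n%:R * tau) *: (resolvent X (n%:R * tau) *m u)) +
    s2 * \tr ((A *m resolvent X (n%:R * tau))^T *m (A *m resolvent X (n%:R * tau)))).
Proof.
move=> tau0; have t0 : 0 < n%:R * tau by rewrite mulr_gt0.
rewrite /mse smoother_gt0 //; congr (_ * (_ + _)).
by rewrite gram_resolventE // mulmxBl mul1mx addrAC subrr add0r nsqN scalemxAl.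
Qed.

End Fixed.

Section Bounds.
Variables (n p d q : nat).
Variables (X : 'M[R]_(n, p)) (Xh : 'M[R]_(n, d)) (Xt : 'M[R]_(n, q)).
Hypothesis n_gt0 : (0 < n)%N.
Hypothesis gram_split : X *m X^T = Xh *m Xh^T + Xt *m Xt^T.
Variables (B s2 : R).
Hypotheses (B_ge0 : 0 <= B) (s2_ge0 : 0 <= s2).
Hypothesis Xt_le : forall u, nsq (Xt^T *m u) <= B * nsq u.

Let nR_gt0 : 0 < n%:R :> R. Proof. by rewrite ltr0n. Qed.
Let tr_sqr_ge0 m k (H : 'M[R]_(m, k)) : 0 <= \tr (H^T *m H).
Proof. by rewrite mxtrace_sqr sumr_ge0 // => ? _; rewrite sumr_ge0 // => ? _; rewrite sqr_ge0. Qed.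

Lemma mse_ge_variance tau u : 0 <= tau ->
  s2 * \tr (Xt *m Xt^T) ^+ 2 <= (n%:R * (B + n%:R * tau)) ^+ 2 * mse X tau u s2.
Proof.
have pos t : 0 < t ->
    s2 * \tr (Xt *m Xt^T) ^+ 2 <= (n%:R * (B + n%:R * t)) ^+ 2 * mse X t u s2.
  move=> t0; have nt0 : 0 < n%:R * t by rewrite mulr_gt0.
  apply: (le_trans (ler_wpM2l s2_ge0
    (smoother_trace_ge gram_split nt0 B_ge0 Xt_le))).
  rewrite mse_gt0 // exprMn; set T := \tr _; set N := nsq _.
  have -> : (n%:R ^+ 2 * (B + n%:R * t) ^+ 2) * (n%:R^-1 * (N + s2 * T)) =
    n%:R * (B + n%:R * t) ^+ 2 * N + s2 * (n%:R * (B + n%:R * t) ^+ 2 * T).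
    by field; rewrite gt_eqF.
  by rewrite lerDr mulr_ge0 ?nsq_ge0 // mulr_ge0 ?sqr_ge0 // ltW.
rewrite le_eqVlt => /predU1P[<-|/pos //].
have cv : (n%:R * (B + n%:R * harmonic k)) ^+ 2 * mse X (harmonic k) u s2
    @[k --> \oo] --> (n%:R * (B + n%:R * 0)) ^+ 2 * mse X 0 u s2.
  apply: cvgM; last exact: mse_cvg.
  apply: cvg_sqrr; apply: cvgMr; apply: cvgD; first exact: cvg_cst.
  by apply: cvgMr; exact: cvg_harmonic.
by apply: (cvgr_to_ge cv); apply: nearW => k; apply: pos; rewrite invr_gt0.
Qed.

Variables (lam : 'I_d -> R) (mu : R) (th : 'cV[R]_d) (tt : 'cV[R]_q) (k K : R).
Hypotheses (lam_gt0 : forall j, 0 < lam j) (k_gt0 : 0 < k).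
Hypothesis Xh_ge : forall u : 'cV[R]_d,
  k * \sum_j lam j * u j 0 ^+ 2 <= nsq (Xh *m u).
Local Notation hn := (\sum_j th j 0 ^+ 2 / lam j).
Local Notation u := (Xh *m th + Xt *m tt).

Lemma bias_le t : 0 < t ->
  nsq (t *: (resolvent X t *m u)) <= 2 * (t * (hn * (B + t) / k)) + 2 * nsq (Xt *m tt).
Proof.
move=> t0; rewrite mulmxDr scalerDr; apply: (le_trans (nsqD_le _ _)).
apply: lerD; rewrite ler_pM2l //; last exact: nsq_residual_le.
exact: (head_bias_le gram_split t0 B_ge0 Xt_le th lam_gt0 k_gt0 Xh_ge).
Qed.

(** The variance is bounded by the crude trace bound [n], which does not degenerate as [tau] tends
    to [0]. It serves the case where [d / n] is bounded below. *)
Lemma mse_le tau : 0 <= tau -> n%:R * mse X tau u s2 <=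
  2 * (n%:R * tau * (hn * (B + n%:R * tau) / k)) + 2 * nsq (Xt *m tt) + s2 * n%:R.
Proof.
have pos t : 0 < t -> n%:R * mse X t u s2 <=
    2 * (n%:R * t * (hn * (B + n%:R * t) / k)) + 2 * nsq (Xt *m tt) + s2 * n%:R.
  move=> t0; have nt0 : 0 < n%:R * t by rewrite mulr_gt0.
  rewrite mse_gt0 // mulVKf ?gt_eqF //; apply: lerD; first exact: bias_le.
  by rewrite ler_wpM2l //; exact: smoother_trace_le.
rewrite le_eqVlt => /predU1P[<-|/pos //].
have cv : n%:R * mse X (harmonic j) u s2 @[j --> \oo] --> n%:R * mse X 0 u s2.
  by apply: cvgMr; exact: mse_cvg.
apply: (ler_cvg_to cv); last first.
  by apply: nearW => j; apply: pos; rewrite invr_gt0.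
apply: cvgD; last exact: cvg_cst.
apply: cvgD; last exact: cvg_cst.
apply: cvgMr; apply: cvgM; first by apply: cvgMr; exact: cvg_harmonic.
apply: cvgMl; apply: cvgMr; apply: cvgD; first exact: cvg_cst.
by apply: cvgMr; exact: cvg_harmonic.
Qed.

Lemma mse_le_gt0 tau : 0 < tau -> n%:R * mse X tau u s2 <=
  2 * (n%:R * tau * (hn * (B + n%:R * tau) / k)) + 2 * nsq (Xt *m tt)
  + s2 * (d%:R + n%:R * (B / (n%:R * tau)) ^+ 2).
Proof.
move=> t0; have nt0 : 0 < n%:R * tau by rewrite mulr_gt0.
rewrite mse_gt0 // mulVKf ?gt_eqF //; apply: lerD; first exact: bias_le.
rewrite ler_wpM2l //; apply: (smoother_trace_le_split gram_split nt0 B_ge0 Xt_le).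
exact: head_gram_unit Xh_ge.
Qed.

Hypothesis Xh_le : forall u : 'cV[R]_d,
  nsq (Xh *m u) <= K * \sum_j lam j * u j 0 ^+ 2.
Hypothesis mu_gt0 : 0 < mu.
Hypothesis mu_le : forall j, mu <= lam j.
Hypothesis K_ge0 : 0 <= K.

Lemma mse_ge_bias tau : 0 < tau -> B <= n%:R * tau ->
  (n%:R * tau) ^+ 2 * hn <=
  8 * (K + (n%:R * tau) ^+ 2 / (mu ^+ 2 * k)) *
  (2 * (n%:R * mse X tau u s2) + 2 * nsq (Xt *m tt)).
Proof.
move=> tau0 Bt; have nt0 : 0 < n%:R * tau by rewrite mulr_gt0.
set t := n%:R * tau; set M := resolvent X t.
have c0 : 0 <= K + t ^+ 2 / (mu ^+ 2 * k).
  by rewrite addr_ge0 // divr_ge0 ?sqr_ge0 // mulr_ge0 ?sqr_ge0 // ltW.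
have := head_bias_ge gram_split nt0 B_ge0 Xt_le th lam_gt0 k_gt0 Xh_ge Xh_le mu_gt0 mu_le K_ge0 Bt.
rewrite -/t -/M => /(ler_wpM2l (sqr_ge0 t)) /le_trans; apply.
rewrite mulrCA ler_wpM2l ?mulr_ge0 // -nsqZ.
have := nsqD_ge (t *: (M *m (Xh *m th))) (t *: (M *m (Xt *m tt))).
rewrite -scalerDr -mulmxDr; have := nsq_residual_le X nt0 (Xt *m tt); rewrite -/t -/M.
have : nsq (t *: (M *m u)) <= n%:R * mse X tau u s2.
  by rewrite mse_gt0 // mulVKf ?gt_eqF // lerDl mulr_ge0.
lra.
Qed.

End Bounds.
End RidgeLimit.

(** * Expectations of products of independent variables *)

Section Independence.
Context {R : realType} {d : measure_display} {T : measurableType d}.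
Variable P : probability T R.
Local Open Scope ereal_scope.

Import HBNNSimple.

(** Extension from indicators to simple functions to monotone limits. The weight [F] and the
    identity on indicators stand in for independence, so that the same statement serves for a
    product of [n] factors and for two independent variables. *)
Lemma integral_mul_comp d' (U : measurableType d') (F : T -> R) (Z : T -> U)
    (c : R) (f : U -> R) :
  measurable_fun setT F -> (forall w, 0 <= F w)%R -> measurable_fun setT Z ->
  (0 <= c)%R ->
  (forall B, measurable B ->
    \int[P]_w (F w * \1_B (Z w))%:E = c%:E * P (Z @^-1` B)) ->
  measurable_fun setT f -> (forall u, 0 <= f u)%R ->
  \int[P]_w (F w * f (Z w))%:E = c%:E * \int[P]_w (f (Z w))%:E.
Proof.
move=> mF F0 mZ c0 FB mf f0.
have ef0 x : setT x -> 0 <= (EFin \o f) x by rewrite lee_fin f0.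
have mef : measurable_fun setT (EFin \o f : U -> \bar R) by exact/measurable_EFinP.
pose g := @nnsfun_approx _ U R setT measurableT _ mef.
have simple n : \int[P]_w (F w * g n (Z w))%:E = c%:E * \int[P]_w (g n (Z w))%:E.
  have gE w : (g n (Z w))%:E =
      \sum_(r \in range (g n)) (r * \1_(g n @^-1` [set r]) (Z w))%:E.
    by rewrite fsumEFin // -(fimfunE (g n)).
  have mI r : measurable_fun setT (fun w => \1_(g n @^-1` [set r]) (Z w) : R).
    by apply: measurableT_comp.
  have I0 r w : (0 <= r * \1_(g n @^-1` [set r]) (Z w))%R.
    by have := @nnfun_muleindic_ge0 _ _ R (g n) r (Z w); rewrite -EFinM lee_fin.
  under eq_integral => w _.
    rewrite EFinM gE ge0_mule_fsumr; last by move=> r; rewrite lee_fin.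
    over.
  rewrite ge0_integral_fsum //=; last 2 first.
  - move=> r; apply: emeasurable_funM; apply/measurable_EFinP => //.
    by apply: measurable_funM.
  - by move=> r w _; rewrite mule_ge0 ?lee_fin.
  under [in RHS]eq_integral => w _ do rewrite gE.
  rewrite ge0_integral_fsum //=; last 2 first.
  - by move=> r; apply/measurable_EFinP; apply: measurable_funM.
  - by move=> r w _; rewrite lee_fin.
  rewrite ge0_mule_fsumr; last by move=> r; apply: integral_ge0 => w _; rewrite lee_fin.
  apply: eq_fsbigr => r; rewrite inE => -[u _ <-{r}].
  set r := g n u; have r0 : (0 <= r)%R by [].
  have mB : measurable (g n @^-1` [set r]) by [].
  transitivity (\int[P]_w (r%:E * (F w * \1_(g n @^-1` [set r]) (Z w))%:E)).
    by apply: eq_integral => w _; rewrite -!EFinM; congr EFin; ring.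
  rewrite ge0_integralZl_EFin //; last 2 first.
  - by move=> w _; rewrite lee_fin mulr_ge0.
  - by apply/measurable_EFinP; apply: measurable_funM.
  rewrite FB // muleCA; congr (_ * _).
  under eq_integral do rewrite EFinM.
  rewrite ge0_integralZl_EFin //; last by apply/measurable_EFinP.
  congr (_ * _); have := @integral_indic _ _ _ P setT measurableT (Z @^-1` (g n @^-1` [set r])).
  rewrite setIT => <- //.
  by rewrite -[X in measurable X]setTI; exact: mZ.
have mg n : measurable_fun setT (fun w => g n (Z w)).
  by apply: measurableT_comp.
have nd : forall w : T, {homo (fun n => g n (Z w)) : n m / (n <= m)%N >-> (n <= m)%R}.
  move=> w n m nm; have := nd_nnsfun_approx measurableT mef nm.
  by move/lefP => /(_ (Z w)).
have lim w : EFin \o (fun n => g n (Z w)) @ \oo --> (f (Z w))%:E.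
  exact: (cvg_nnsfun_approx measurableT mef ef0 (x := Z w) I).
transitivity (limn (fun n => \int[P]_w (F w * g n (Z w))%:E)).
  rewrite -monotone_convergence //; last 3 first.
  - by move=> n; apply/measurable_EFinP; apply: measurable_funM.
  - by move=> n w _; rewrite lee_fin mulr_ge0.
  - by move=> w _ n m nm; rewrite lee_fin ler_wpM2l // nd.
  apply: eq_integral => w _; apply/esym/cvg_lim => //.
  rewrite EFinM; under eq_fun do rewrite EFinM.
  by apply: cvgeZl => //; exact: lim.
transitivity (limn (fun n => c%:E * \int[P]_w (g n (Z w))%:E)).
  by congr (limn _); apply/funext => n; exact: simple.
have cv : \int[P]_w (g n (Z w))%:E @[n --> \oo] --> \int[P]_w (f (Z w))%:E.
  have -> : \int[P]_w (f (Z w))%:E = \int[P]_w (limn (fun n => (g n (Z w))%:E)).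
    by apply: eq_integral => w _; apply/esym/cvg_lim => //; exact: lim.
  apply: cvg_monotone_convergence => //.
  - by move=> n; apply/measurable_EFinP.
  - by move=> n w _; rewrite lee_fin.
  - by move=> w _ n m nm; rewrite lee_fin nd.
by apply/cvg_lim => //; apply: cvgeZl.
Qed.

Lemma integral_indic_comp d' (U : measurableType d') (Z : T -> U) (B : set U) :
  measurable_fun setT Z -> measurable B ->
  \int[P]_w (\1_B (Z w))%:E = P (Z @^-1` B).
Proof.
move=> mZ mB; have := @integral_indic _ _ _ P setT measurableT (Z @^-1` B).
rewrite setIT => <- //.
by rewrite -[X in measurable X]setTI; exact: mZ.
Qed.

Lemma independent_integral_prod d' (U : measurableType d') n
    (Z : 'I_n -> T -> U) (g : 'I_n -> U -> R) (m : 'I_n -> R) :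
  (forall i, measurable_fun setT (Z i)) -> mutually_independent P Z ->
  (forall i, measurable_fun setT (g i)) -> (forall i u, 0 <= g i u)%R ->
  (forall i, \int[P]_w (g i (Z i w))%:E = (m i)%:E) ->
  \int[P]_w (\prod_i g i (Z i w))%:E = (\prod_i m i)%:E.
Proof.
move=> mZ iZ.
have mZB i B : measurable B -> measurable (Z i @^-1` B).
  by move=> mB; rewrite -[X in measurable X]setTI; exact: mZ.
(* The first [k] factors are arbitrary and the others are indicators. At [k = 0] this is mutual
   independence; the inductive step frees the factor of index [k] by [integral_mul_comp], whose
   hypothesis is the case where that factor is an indicator. *)
suff H k : (k <= n)%N -> forall (g : 'I_n -> U -> R) (m : 'I_n -> R),
    (forall i, measurable_fun setT (g i)) -> (forall i u, 0 <= g i u)%R ->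
    (forall i, \int[P]_w (g i (Z i w))%:E = (m i)%:E) ->
    (forall i : 'I_n, (k <= i)%N -> exists2 A, measurable A & g i = \1_A) ->
    \int[P]_w (\prod_i g i (Z i w))%:E = (\prod_i m i)%:E.
  move=> mg g0 gm; apply: (H n) => // i; rewrite leqNgt ltn_ord //.
elim: k => [_|k IHk kn] {}g {}m mg g0 gm gind.
  have /choice[A HA] : forall i, exists A, measurable A /\ g i = \1_A.
    by move=> i; have [A mA gA] := gind i (leq0n _); exists A.
  have mE i : (m i)%:E = P (Z i @^-1` A i).
    rewrite -gm (HA i).2 integral_indic_comp //; exact: (HA i).1.
  have /(_ (fun i => (HA i).1)) := iZ [set: 'I_n]%SET A.
  set D := \bigcap_(i in _) _ => PD.
  have mD : measurable D.
    by apply: fin_bigcap_measurable => // i _; apply: mZB; exact: (HA i).1.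
  transitivity (\int[P]_w (\1_D w)%:E).
    apply: eq_integral => w _; congr EFin; rewrite indicE.
    under eq_bigr do rewrite (HA _).2 indicE.
    case: (boolP (w \in D)) => [/set_mem wD|wD].
      rewrite big1 // => i _; rewrite mem_set //.
      by have := wD i; apply; rewrite /= inE.
    have [i wi] : exists i, w \notin (Z i @^-1` A i).
      apply: contrapT => /forallNP h; move/negP: wD; apply; apply: mem_set => i _.
      by have := h i; case: (boolP (w \in _)) => // /set_mem.
    rewrite (bigD1 i) //= (_ : (_ \in A i) = false) ?mul0r //.
    by apply/negbTE; apply: contra wi => /set_mem; exact: mem_set.
  rewrite integral_indic // setIT; apply: (etrans PD); rewrite -prodEFin.
  by apply: eq_big => [i|i _]; rewrite ?inE // mE.
pose i0 := Ordinal kn.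
pose F w := (\prod_(i | i != i0) g i (Z i w))%R.
pose c := (\prod_(i | i != i0) m i)%R.
have m0 i : (0 <= m i)%R.
  by rewrite -lee_fin -gm integral_ge0 // => w _; rewrite lee_fin.
have mF : measurable_fun setT F.
  rewrite /F; under eq_fun do rewrite big_mkcond.
  by apply: measurable_prod => i _; case: (i != i0) => //=; exact: measurableT_comp.
transitivity (\int[P]_w (F w * g i0 (Z i0 w))%:E).
  by apply: eq_integral => w _; rewrite (bigD1 i0) //= mulrC.
rewrite (@integral_mul_comp _ U F (Z i0) c) //.
- by rewrite gm -EFinM (bigD1 i0) //= mulrC.
- by move=> w; rewrite prodr_ge0.
- by rewrite prodr_ge0.
move=> B mB.
pose g' i := if i == i0 then \1_B else g i.
pose m' i := if i == i0 then fine (P (Z i0 @^-1` B)) else m i.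
have PB : P (Z i0 @^-1` B) \is a fin_num by apply: fin_num_measure; exact: mZB.
transitivity (\int[P]_w (\prod_i g' i (Z i w))%:E).
  apply: eq_integral => w _; rewrite [in RHS](bigD1 i0) //= mulrC /g' eqxx.
  by congr (_ * _)%:E; apply: eq_bigr => i /negPf ->.
rewrite (IHk (ltnW kn) g' m').
- rewrite (bigD1 i0) //= /m' eqxx muleC EFinM fineK //.
  by congr (_ * _%:E); apply: eq_bigr => i /negPf ->.
- by move=> i; rewrite /g'; case: ifP.
- by move=> i u; rewrite /g'; case: ifP => // _; rewrite indicE.
- move=> i; rewrite /g' /m'; case: ifP => [/eqP ->|_]; last exact: gm.
  by rewrite fineK // integral_indic_comp.
- move=> i ki; rewrite /g'; case: ifPn => [_|ii0]; first by exists B.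
  apply: gind; rewrite ltn_neqAle ki andbT.
  by apply: contra ii0 => /eqP ki'; apply/eqP/val_inj.
Qed.

End Independence.

(** * Independence of tuples from independence on boxes *)

Section TupleLaw.
Context {R : realType} {d : measure_display} {T : measurableType d}.
Context {d' : measure_display} {U : measurableType d'}.
Local Open Scope ereal_scope.

(** Boxes are stable under intersection and generate the sigma-algebra of tuples. *)
Lemma tuple_measure_unique n (m1 m2 : {measure set (n.-tuple U) -> \bar R}) :
  m1 setT < +oo ->
  (forall A : 'I_n -> set U, (forall i, measurable (A i)) ->
     m1 [set t | forall i, A i (tnth t i)] = m2 [set t | forall i, A i (tnth t i)]) ->
  forall B, measurable B -> m1 B = m2 B.
Proof.
move=> m1oo m12.
pose G := [set C : set (n.-tuple U) | exists2 A : 'I_n -> set U,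
  forall i, measurable (A i) & C = [set t | forall i, A i (tnth t i)]].
have mcyl A : (forall i, measurable (A i)) ->
    measurable [set t : n.-tuple U | forall i, A i (tnth t i)].
  move=> mA; rewrite (_ : mkset _ = \bigcap_(i in [set: 'I_n]) (@tnth n U ^~ i) @^-1` A i).
    apply: fin_bigcap_measurable => // i _.
    by rewrite -[X in measurable X]setTI; exact: measurable_tnth.
  by apply/seteqP; split => t /= tA i; [move=> _|]; exact: tA.
have GT : G setT by exists (fun=> setT) => //; apply/seteqP; split.
move=> B mB; apply: (g_sigma_algebra_measure_unique G _ (fun=> setT)) => //.
- by move=> _ [A mA ->]; exact: mcyl.
- by rewrite bigcup_const.
- move=> _ _ [A mA ->] [C mC ->]; exists (fun i => A i `&` C i).
    by move=> i; exact: measurableI.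
  by apply/seteqP; split => [t [tA tC] i|t tAB]; split=> // i; have [] := tAB i.
- by move=> _ [A mA ->]; exact: m12.
- apply: (smallest_sub _ _ mB); first exact: smallest_sigma_algebra.
  move=> C; rewrite -bigcup_seq /= => -[i _ [A mA <-]]; apply: sub_sigma_algebra.
  exists (fun j => if j == i then A else setT); first by move=> j; case: ifP.
  rewrite setTI; apply/seteqP; split => t /= tA.
    by move=> j; case: ifPn => // /eqP ->.
  by have := tA i; rewrite eqxx.
Qed.

Variable P : probability T R.

(** Both sides are finite measures in [B]: the law of the tuple restricted to [E], and its law
    scaled by [P E]. They agree on boxes. *)
Lemma tuple_event_indep n (X : 'I_n -> T -> U) (E : set T) :
  (forall i, measurable_fun setT (X i)) -> measurable E ->
  (forall A : 'I_n -> set U, (forall i, measurable (A i)) ->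
    P ([set w | forall i, A i (X i w)] `&` E) =
    P [set w | forall i, A i (X i w)] * P E) ->
  forall B : set (n.-tuple U), measurable B ->
  P ((fun w => [tuple X i w | i < n]) @^-1` B `&` E) =
  P ((fun w => [tuple X i w | i < n]) @^-1` B) * P E.
Proof.
move=> mX mE XE B mB; set Z := fun w => _.
have mZ : measurable_fun setT Z.
  apply/measurable_fun_tnthP => i; rewrite (_ : _ \o _ = X i) //.
  by apply/funext => w /=; rewrite tnth_mktuple.
pose Zm : {mfun T >-> n.-tuple U} := HB.pack Z (isMeasurableFun.Build _ _ _ _ Z mZ).
have PE0 : (0 <= fine (P E))%R by rewrite fine_ge0.
pose m1 : {measure set (n.-tuple U) -> \bar R} := pushforward (mrestr P mE) Zm.
pose m2 : {measure set (n.-tuple U) -> \bar R} :=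
  mscale (NngNum PE0) (distribution P Zm).
have cyl A : Z @^-1` [set t | forall i, A i (tnth t i)] = [set w | forall i, A i (X i w)].
  by apply/seteqP; split => w /= wA i; have := wA i; rewrite tnth_mktuple.
have := @tuple_measure_unique n (m1 mZ) m2 _ _ B mB.
rewrite /m1 /m2 /= /mscale /pushforward /= /mrestr /distribution /pushforward /=.
rewrite fineK ?fin_num_measure // muleC; apply.
  by rewrite preimage_setT setTI (le_lt_trans (probability_le1 P mE)) // ltry.
by move=> A mA; rewrite cyl XE // muleC.
Qed.

End TupleLaw.

(** [tuple_event_indep] is applied twice: boxes are replaced by arbitrary events for one tuple at a
    time, the event on the other being kept fixed. *)
Lemma independent2_tuples {R : realType} d (T : measurableType d)
    (P : probability T R) n d1 (U : measurableType d1) d2 (V : measurableType d2)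
    (X : 'I_n -> T -> U) (Y : 'I_n -> T -> V) :
  (forall i, measurable_fun setT (X i)) -> (forall i, measurable_fun setT (Y i)) ->
  (forall (A : 'I_n -> set U) (B : 'I_n -> set V),
    (forall i, measurable (A i)) -> (forall i, measurable (B i)) ->
    P ([set w | forall i, A i (X i w)] `&` [set w | forall i, B i (Y i w)]) =
    P [set w | forall i, A i (X i w)] * P [set w | forall i, B i (Y i w)])%E ->
  independent2 P (fun w => [tuple X i w | i < n]) (fun w => [tuple Y i w | i < n]).
Proof.
move=> mX mY XY A B mA mB.
have mcyl d3 (W : measurableType d3) (Z : 'I_n -> T -> W) (C : 'I_n -> set W) :
    (forall i, measurable_fun setT (Z i)) -> (forall i, measurable (C i)) ->
    measurable [set w | forall i, C i (Z i w)].
  move=> mZ mC; rewrite (_ : mkset _ = \bigcap_(i in [set: 'I_n]) Z i @^-1` C i).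
    apply: fin_bigcap_measurable => // i _.
    by rewrite -[X in measurable X]setTI; exact: mZ.
  by apply/seteqP; split => t /= tC i; [move=> _|]; exact: tC.
have mpre d3 (W : measurableType d3) (Z : 'I_n -> T -> W) (C : set (n.-tuple W)) :
    (forall i, measurable_fun setT (Z i)) -> measurable C ->
    measurable ((fun w => [tuple Z i w | i < n]) @^-1` C).
  move=> mZ mC; rewrite -[X in measurable X]setTI.
  suff : measurable_fun setT (fun w => [tuple Z i w | i < n]) by exact.
  apply/measurable_fun_tnthP => i; rewrite (_ : _ \o _ = Z i) //.
  by apply/funext => w /=; rewrite tnth_mktuple.
apply: tuple_event_indep => // [|C mC]; first exact: mpre.
rewrite setIC muleC; apply: tuple_event_indep => // [|D mD]; first exact: mcyl.
by rewrite setIC muleC; exact: XY.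
Qed.

(** * Integrable functions of two independent variables *)

Section IndependentProducts.
Context {R : realType} {d : measure_display} {T : measurableType d}.
Variable P : probability T R.
Context d1 (U1 : measurableType d1) d2 (U2 : measurableType d2).
Variables (Z1 : T -> U1) (Z2 : T -> U2).
Hypotheses (mZ1 : measurable_fun setT Z1) (mZ2 : measurable_fun setT Z2).
Hypothesis indep : independent2 P Z1 Z2.
Local Open Scope ereal_scope.

Lemma integral_indep_ge0 (f1 : U1 -> R) (f2 : U2 -> R) (a1 a2 : R) :
  measurable_fun setT f1 -> measurable_fun setT f2 ->
  (forall x, 0 <= f1 x)%R -> (forall x, 0 <= f2 x)%R ->
  \int[P]_w (f1 (Z1 w))%:E = a1%:E -> \int[P]_w (f2 (Z2 w))%:E = a2%:E ->
  \int[P]_w (f1 (Z1 w) * f2 (Z2 w))%:E = (a1 * a2)%:E.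
Proof.
move=> mf1 mf2 f10 f20 I1 I2.
have a10 : (0 <= a1)%R by rewrite -lee_fin -I1 integral_ge0 // => w _; rewrite lee_fin.
have mF : measurable_fun setT (f1 \o Z1) by exact: measurableT_comp.
rewrite (@integral_mul_comp _ _ _ _ _ U2 (f1 \o Z1) Z2 a1) //=.
  by rewrite I2 EFinM.
move=> B mB.
have PB : P (Z2 @^-1` B) \is a fin_num.
  by apply: fin_num_measure; rewrite -[X in measurable X]setTI; exact: mZ2.
transitivity (\int[P]_w (\1_B (Z2 w) * f1 (Z1 w))%:E).
  by apply: eq_integral => w _; rewrite mulrC.
rewrite (@integral_mul_comp _ _ _ _ _ U1 (fun w => \1_B (Z2 w)) Z1 (fine (P (Z2 @^-1` B)))) //=.
- by rewrite I1 fineK // muleC.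
- by apply: measurableT_comp.
- by rewrite fine_ge0.
move=> A mA; rewrite fineK // muleC -indep //.
have mAB : measurable (Z1 @^-1` A `&` Z2 @^-1` B).
  by apply: measurableI; rewrite -[X in measurable X]setTI; [exact: mZ1|exact: mZ2].
have := integral_indic P measurableT mAB; rewrite setIT => <-.
by apply: eq_integral => w _; congr EFin; rewrite !indicE in_setI mulrC -natrM mulnb.
Qed.

(** Splitting both factors into positive and negative parts gives four nonnegative products, to
    which [integral_indep_ge0] applies. *)
Lemma integral_indep (f1 : U1 -> R) (f2 : U2 -> R) (a1 a2 : R) :
  measurable_fun setT f1 -> measurable_fun setT f2 ->
  P.-integrable setT (EFin \o (f1 \o Z1)) -> P.-integrable setT (EFin \o (f2 \o Z2)) ->
  \int[P]_w (f1 (Z1 w))%:E = a1%:E -> \int[P]_w (f2 (Z2 w))%:E = a2%:E ->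
  P.-integrable setT (EFin \o (fun w => f1 (Z1 w) * f2 (Z2 w))%R) /\
  \int[P]_w (f1 (Z1 w) * f2 (Z2 w))%:E = (a1 * a2)%:E.
Proof.
move=> mf1 mf2 if1 if2 I1 I2.
have funrB (V : Type) (f : V -> R) u : (f u = (f^\+)%R u - (f^\-)%R u)%R.
  by rewrite -[in LHS](funrposBneg f).
have dec d3 (V : measurableType d3) (f : V -> R) (Z : T -> V) a :
    measurable_fun setT Z -> measurable_fun setT f ->
    P.-integrable setT (EFin \o (f \o Z)) -> \int[P]_w (f (Z w))%:E = a%:E ->
    exists p q, [/\ a = (p - q)%R, \int[P]_w ((f^\+)%R (Z w))%:E = p%:E &
                                   \int[P]_w ((f^\-)%R (Z w))%:E = q%:E].
  move=> mZ mf ifZ Ia.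
  have i1 := integrable_funrpos measurableT ifZ.
  have i2 := integrable_funrneg measurableT ifZ.
  have f1f := integrable_fin_num measurableT i1.
  have f2f := integrable_fin_num measurableT i2.
  exists (fine (\int[P]_w ((f^\+)%R (Z w))%:E)), (fine (\int[P]_w ((f^\-)%R (Z w))%:E)).
  split; rewrite ?fineK //; apply: EFin_inj; rewrite -Ia EFinB !fineK //.
  rewrite -integralB_EFin //; apply: eq_integral => w _; rewrite -EFinB; congr EFin.
  by rewrite [in LHS]funrB.
have [p1 [q1 [-> Ip1 Iq1]]] := dec _ _ _ _ _ mZ1 mf1 if1 I1.
have [p2 [q2 [-> Ip2 Iq2]]] := dec _ _ _ _ _ mZ2 mf2 if2 I2.
have mp1 := measurable_funrpos mf1; have mq1 := measurable_funrneg mf1.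
have mp2 := measurable_funrpos mf2; have mq2 := measurable_funrneg mf2.
have prod (g1 : U1 -> R) (g2 : U2 -> R) c1 c2 :
   measurable_fun setT g1 -> measurable_fun setT g2 ->
   (forall x, 0 <= g1 x)%R -> (forall x, 0 <= g2 x)%R ->
   \int[P]_w (g1 (Z1 w))%:E = c1%:E -> \int[P]_w (g2 (Z2 w))%:E = c2%:E ->
   P.-integrable setT (EFin \o (fun w => g1 (Z1 w) * g2 (Z2 w))%R) /\
   \int[P]_w (g1 (Z1 w) * g2 (Z2 w))%:E = (c1 * c2)%:E.
  move=> mg1 mg2 g10 g20 J1 J2.
  have J := integral_indep_ge0 mg1 mg2 g10 g20 J1 J2; split => //.
  apply/integrableP; split.
    by apply/measurable_EFinP; apply: measurable_funM; exact: measurableT_comp.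
  under eq_integral => w _ do rewrite /= ger0_norm ?mulr_ge0 //.
  by rewrite J ltry.
have [ipp Ipp] := prod _ _ _ _ mp1 mp2 (@funrpos_ge0 _ _ _) (@funrpos_ge0 _ _ _) Ip1 Ip2.
have [ipq Ipq] := prod _ _ _ _ mp1 mq2 (@funrpos_ge0 _ _ _) (@funrneg_ge0 _ _ _) Ip1 Iq2.
have [iqp Iqp] := prod _ _ _ _ mq1 mp2 (@funrneg_ge0 _ _ _) (@funrpos_ge0 _ _ _) Iq1 Ip2.
have [iqq Iqq] := prod _ _ _ _ mq1 mq2 (@funrneg_ge0 _ _ _) (@funrneg_ge0 _ _ _) Iq1 Iq2.
pose g w := ((f1^\+)%R (Z1 w) * (f2^\+)%R (Z2 w) + (f1^\-)%R (Z1 w) * (f2^\-)%R (Z2 w))%R.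
pose h w := ((f1^\+)%R (Z1 w) * (f2^\-)%R (Z2 w) + (f1^\-)%R (Z1 w) * (f2^\+)%R (Z2 w))%R.
have ig : P.-integrable setT (EFin \o g) by exact: (integrableD measurableT ipp iqq).
have ih : P.-integrable setT (EFin \o h) by exact: (integrableD measurableT ipq iqp).
have E : (fun w => f1 (Z1 w) * f2 (Z2 w))%R = (fun w => g w - h w)%R.
  apply/funext => w; rewrite [f1 _ in LHS]funrB [f2 _ in LHS]funrB /g /h.
  ring.
split; first by rewrite E; exact: (integrableB measurableT ig ih).
transitivity (\int[P]_w ((g w)%:E - (h w)%:E)).
  by apply: eq_integral => w _; rewrite -EFinB; congr EFin; exact: (congr1 (@^~ w) E).
rewrite integralB_EFin // /g /h.
have -> : \int[P]_w (g w)%:E = (p1 * p2 + q1 * q2)%:E.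
  by rewrite EFinD -Ipp -Iqq -(integralD_EFin measurableT ipp iqq).
have -> : \int[P]_w (h w)%:E = (p1 * q2 + q1 * p2)%:E.
  by rewrite EFinD -Ipq -Iqp -(integralD_EFin measurableT ipq iqp).
by rewrite -EFinB; congr EFin; ring.
Qed.

End IndependentProducts.

(** * Almost sure uniqueness of conditional expectations *)

Section ConditionalExpectation.
Context {R : realType} {d : measure_display} {T : measurableType d}.
Variable P : probability T R.
Context d' (U : measurableType d') (Z : T -> U).
Hypothesis mZ : measurable_fun setT Z.
Local Notation G := (g_sigma_algebra_preimage Z).
Local Open Scope ereal_scope.

Lemma preimage_algebra_sub A : G A -> measurable A.
Proof. by move=> [B mB <-]; exact: mZ. Qed.

(** The set where [g < h] belongs to [G], hence [g] and [h] have the same integral over it; yet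
    [h - g] is positive there. *)
Lemma is_cond_exp_lt_null f g h : is_cond_exp P G f g -> is_cond_exp P G f h ->
  P [set w | (g w < h w)%R] = 0.
Proof.
move=> [ig mg eg] [ih mh eh].
have mG (k : T -> R) : (forall B : set R, measurable B -> G (k @^-1` B)) ->
    measurable_fun (setT : set (g_sigma_algebra_preimageType Z)) (k : g_sigma_algebra_preimageType Z -> R).
  by move=> mk _ B mB; rewrite setTI; exact: mk.
set A := [set w | _].
have GA : G A.
  have := measurable_fun_ltr (mG _ mg) (mG _ mh) measurableT (Y := [set true]) I.
  by rewrite setTI.
have mA := preimage_algebra_sub GA.
have igA : P.-integrable A (EFin \o g) by exact: integrableS ig.
have ihA : P.-integrable A (EFin \o h) by exact: integrableS ih.
have e0 : \int[P]_(w in A) ((h w)%:E - (g w)%:E) = 0.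
  rewrite integralB_EFin // eg // eh // subee // -eh //.
  exact: integrable_fin_num ihA.
have iD : P.-integrable A (fun w => (h w)%:E - (g w)%:E) by exact: integrableB.
have {}e0 : \int[P]_(w in A) `|(h w)%:E - (g w)%:E| = 0.
  rewrite -[RHS]e0; apply: eq_integral => w; rewrite inE => gh.
  by rewrite gee0_abs // -EFinB lee_fin subr_ge0 ltW.
have := ae_eq_integral_abs P mA (measurable_int _ iD); move=> /iffLR/(_ e0) ae0.
have : P.-negligible A.
  case: ae0 => N [mN PN sub]; exists N; split => // w Aw; apply: sub => /= /(_ Aw).
  rewrite /= -EFinB => -[/eqP]; rewrite subr_eq0 => /eqP hg.
  by move: Aw; rewrite /A /= hg ltxx.
by move/(negligibleP _ mA).
Qed.

(** This transfers any explicit version [g] to the version picked by [cond_exp]. *)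
Lemma is_cond_exp_ae f g : is_cond_exp P G f g ->
  is_cond_exp P G f (cond_exp P G f) /\ {ae P, forall w, cond_exp P G f w = g w}.
Proof.
move=> Pg; have Ph : is_cond_exp P G f (cond_exp P G f).
  rewrite /cond_exp; exact: (@xgetPex _ (cst 0%R) [set g | is_cond_exp P G f g] (ex_intro _ g Pg)).
split=> //; have n1 := is_cond_exp_lt_null Pg Ph; have n2 := is_cond_exp_lt_null Ph Pg.
have mlt (a b : T -> R) : is_cond_exp P G f a -> is_cond_exp P G f b ->
    measurable [set w | (a w < b w)%R].
  move=> [ia _ _] [ib _ _].
  have ma : measurable_fun setT a by apply/measurable_EFinP; exact: measurable_int ia.
  have mb : measurable_fun setT b by apply/measurable_EFinP; exact: measurable_int ib.
  have := measurable_fun_ltr ma mb measurableT (Y := [set true]) I.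
  by rewrite setTI.
have N1 : P.-negligible [set w | (g w < cond_exp P G f w)%R].
  by apply/negligibleP => //; exact: mlt.
have N2 : P.-negligible [set w | (cond_exp P G f w < g w)%R].
  by apply/negligibleP => //; exact: mlt.
apply: (negligibleS _ (negligibleU N1 N2)) => w /= /eqP.
by rewrite neq_lt => /orP[]; [right|left].
Qed.

End ConditionalExpectation.

(** * Calculus of finite expectations *)

Section HasE.
Context {R : realType} {d : measure_display} {T : measurableType d}.
Variable P : probability T R.

(** Integrability and value are kept together, so that linear combinations and comparisons of
    expectations take place in the reals. *)
Definition hasE (f : T -> R) (r : R) : Prop :=
  P.-integrable setT (EFin \o f) /\ (\int[P]_w (f w)%:E)%E = r%:E.

Lemma integrable_hasE f : P.-integrable setT (EFin \o f) -> exists r, hasE f r.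
Proof.
move=> fi; exists (fine (\int[P]_w (f w)%:E)%E); split=> //.
by rewrite fineK //; exact: (integrable_fin_num measurableT fi).
Qed.

Lemma hasE_cst r : hasE (fun=> r) r.
Proof.
split; first exact: finite_measure_integrable_cst.
rewrite (integral_cst P measurableT r%:E).
by rewrite [X in (_ * X)%E](_ : _ = 1%E) ?mule1 //; exact: probability_setT.
Qed.

Lemma hasE_add f g r s : hasE f r -> hasE g s -> hasE (fun w => f w + g w) (r + s).
Proof.
move=> [fi fr] [gi gs]; split; first exact: (integrableD measurableT fi gi).
by rewrite (integralD_EFin measurableT fi gi) fr gs.
Qed.

Lemma hasE_scale c f r : hasE f r -> hasE (fun w => c * f w) (c * r).
Proof.
move=> [fi fr]; split; first exact: (integrableZl measurableT c fi).
by rewrite (integralZl measurableT fi) fr.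
Qed.

Lemma hasE_sum (I : Type) (s : seq I) (f : I -> T -> R) (r : I -> R) :
  (forall i, hasE (f i) (r i)) ->
  hasE (fun w => \sum_(i <- s) f i w) (\sum_(i <- s) r i).
Proof.
move=> fr; elim: s => [|i s IHs].
  by rewrite big_nil; under eq_fun do rewrite big_nil; exact: hasE_cst.
by rewrite big_cons; under eq_fun do rewrite big_cons; exact: hasE_add.
Qed.

Lemma hasE_eq f g r : f =1 g -> hasE f r -> hasE g r.
Proof. by move=> /funext ->. Qed.

Lemma hasE_dom (f g : T -> R) s : measurable_fun setT f -> hasE g s ->
  (forall w, `|f w| <= g w) -> exists r, hasE f r.
Proof.
move=> mf [gi _] fg; apply: integrable_hasE.
apply: (le_integrable measurableT _ _ gi); first exact/measurable_EFinP.
by move=> w _ /=; rewrite lee_fin (le_trans (fg w)) // ler_norm.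
Qed.

Lemma ge0_hasE (f : T -> R) r : measurable_fun setT f -> (forall w, 0 <= f w) ->
  (\int[P]_w (f w)%:E)%E = r%:E -> hasE f r.
Proof.
move=> mf f0 fr; split=> //; apply/integrableP; split; first exact/measurable_EFinP.
by under eq_integral => w _ do rewrite /= ger0_norm //; rewrite fr ltry.
Qed.

Lemma hasE_le f g r s : hasE f r -> hasE g s -> (forall w, f w <= g w) -> r <= s.
Proof.
move=> [fi fr] [gi gs] fg; rewrite -lee_fin -fr -gs.
by apply: le_integral => // w _; rewrite lee_fin.
Qed.

Lemma hasE_integralI f r (A : set T) : measurable A -> hasE (fun w => \1_A w * f w) r ->
  (\int[P]_(w in A) (f w)%:E)%E = r%:E.
Proof.
move=> mA [_ <-]; rewrite integral_mkcond; apply: eq_integral => w _.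
by rewrite /patch indicE; case: ifP; rewrite ?mul1r ?mul0r.
Qed.

Lemma hasE_indep d1 (U1 : measurableType d1) d2 (U2 : measurableType d2)
    (Z1 : T -> U1) (Z2 : T -> U2) (f1 : U1 -> R) (f2 : U2 -> R) r1 r2 :
  measurable_fun setT Z1 -> measurable_fun setT Z2 -> independent2 P Z1 Z2 ->
  measurable_fun setT f1 -> measurable_fun setT f2 ->
  hasE (fun w => f1 (Z1 w)) r1 -> hasE (fun w => f2 (Z2 w)) r2 ->
  hasE (fun w => f1 (Z1 w) * f2 (Z2 w)) (r1 * r2).
Proof.
move=> mZ1 mZ2 ind mf1 mf2 [i1 I1] [i2 I2].
by have := integral_indep mZ1 mZ2 ind mf1 mf2 i1 i2 I1 I2.
Qed.

Lemma hasE_sqr (f : T -> R) r : measurable_fun setT f ->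
  hasE (fun w => f w ^+ 2) r -> exists s, hasE f s.
Proof.
move=> mf fr; apply: (hasE_dom mf (hasE_add (hasE_cst 1) fr)) => w.
rewrite -real_normK ?num_real //; set a := `|f w|; have := normr_ge0 (f w); rewrite -/a.
by move=> a0; have := sqr_ge0 (a - 1); nra.
Qed.

Lemma hasE_prod_sqr (f g : T -> R) r s : measurable_fun setT f -> measurable_fun setT g ->
  hasE (fun w => f w ^+ 2) r -> hasE (fun w => g w ^+ 2) s ->
  exists t, hasE (fun w => f w * g w) t.
Proof.
move=> mf mg fr gs; apply: (hasE_dom (measurable_funM mf mg) (hasE_add fr gs)) => w.
rewrite normrM -(real_normK (num_real (f w))) -(real_normK (num_real (g w))).
set a := `|f w|; set b := `|g w|.
have := sqr_ge0 (a - b); have := sqr_ge0 (a + b); nra.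
Qed.

End HasE.

(** * Measurability of matrix-valued functions *)

Section MatrixMeasurability.
Context {R : realType} {d : measure_display} {T : measurableType d}.

Definition mmx m n (F : T -> 'M[R]_(m, n)) : Prop :=
  forall i j, measurable_fun setT (fun w => F w i j).

(** [powR] with exponent [-1] is the inverse on nonnegative reals, hence the detour through the
    square; where [f] vanishes both expressions are [0]. *)
Lemma measurable_inv (f : T -> R) :
  measurable_fun setT f -> measurable_fun setT (fun w => (f w)^-1).
Proof.
move=> mf; rewrite (_ : (fun _ => _) = fun w => f w * (f w ^+ 2) `^ (-1)).
  apply: measurable_funM => //.
  have m2 : measurable_fun setT (fun w => f w ^+ 2) by exact: measurable_funX.
  exact: (measurableT_comp (measurable_powR (-1)) m2).
apply/funext => w; rewrite powR_inv1 ?sqr_ge0 //.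
have [->|f0] := eqVneq (f w) 0; first by rewrite invr0 mul0r.
by field.
Qed.

Lemma mmx_mul m n p (F : T -> 'M[R]_(m, n)) (G : T -> 'M[R]_(n, p)) :
  mmx F -> mmx G -> mmx (fun w => F w *m G w).
Proof.
move=> mF mG i j; under eq_fun do rewrite mxE.
by apply: measurable_sum => k; apply: measurable_funM; [exact: mF|exact: mG].
Qed.

Lemma mmx_tr m n (F : T -> 'M[R]_(m, n)) : mmx F -> mmx (fun w => (F w)^T).
Proof. by move=> mF i j; under eq_fun do rewrite mxE; exact: mF. Qed.

Lemma mmx_add m n (F G : T -> 'M[R]_(m, n)) :
  mmx F -> mmx G -> mmx (fun w => F w + G w).
Proof.
move=> mF mG i j; under eq_fun do rewrite mxE.
by apply: measurable_funD; [exact: mF|exact: mG].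
Qed.

Lemma mmx_opp m n (F : T -> 'M[R]_(m, n)) : mmx F -> mmx (fun w => - F w).
Proof.
by move=> mF i j; under eq_fun do rewrite mxE; apply: measurableT_comp => //; exact: mF.
Qed.

Lemma mmx_cst m n (A : 'M[R]_(m, n)) : mmx (fun _ => A).
Proof. by move=> i j; exact: measurable_cst. Qed.

Lemma measurable_det n (F : T -> 'M[R]_n) : mmx F ->
  measurable_fun setT (fun w => \det (F w)).
Proof.
move=> mF; rewrite /determinant; apply: measurable_sum => s.
apply: measurable_funM; first exact: measurable_cst.
by apply: measurable_prod => i _; exact: mF.
Qed.

Lemma mmx_adj n (F : T -> 'M[R]_n) : mmx F -> mmx (fun w => \adj (F w)).
Proof.
move=> mF i j; under eq_fun do rewrite mxE.
rewrite /cofactor; apply: measurable_funM; first exact: measurable_cst.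
by apply: measurable_det => k l; under eq_fun do rewrite !mxE; exact: mF.
Qed.

(** By the cofactor formula: determinants and cofactors are polynomials in the entries. *)
Lemma mmx_inv n (F : T -> 'M[R]_n) : mmx F -> (forall w, F w \in unitmx) ->
  mmx (fun w => invmx (F w)).
Proof.
move=> mF Fu i j; rewrite (_ : (fun _ => _) = fun w => (\det (F w))^-1 * (\adj (F w)) i j).
  apply: measurable_funM; first by apply: measurable_inv; exact: measurable_det.
  exact: mmx_adj.
by apply/funext => w; rewrite /invmx Fu mxE.
Qed.

Lemma measurable_nsq n (F : T -> 'cV[R]_n) : mmx F -> measurable_fun setT (fun w => nsq (F w)).
Proof.
move=> mF; under eq_fun do rewrite nsqE.
by apply: measurable_sum => i; apply: measurable_funX; exact: mF.
Qed.

Lemma measurable_trace n (F : T -> 'M[R]_n) : mmx F -> measurable_fun setT (fun w => \tr (F w)).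
Proof. by move=> mF; apply: measurable_sum => i; exact: mF. Qed.

Lemma mmx_smoother n p (F : T -> 'M[R]_(n, p)) tau : (0 < n)%N -> 0 <= tau ->
  mmx F -> mmx (fun w => smoother tau (F w)).
Proof.
move=> n0 tau0 mF.
have pos t : 0 < t -> mmx (fun w => smoother t (F w)).
  move=> t0; have nt0 : 0 < n%:R * t by rewrite mulr_gt0 // ltr0n.
  have mA : mmx (fun w => F w *m (F w)^T) by apply: mmx_mul => //; exact: mmx_tr.
  move=> i j; under eq_fun do rewrite smoother_gt0 //; move: i j.
  apply: mmx_mul => //; apply: mmx_inv.
    by apply: mmx_add => //; exact: mmx_cst.
  by move=> w; exact: gram_shift_unit.
move: tau0; rewrite le_eqVlt => /predU1P[<-|/pos //] i j.
apply: (@measurable_fun_cvg _ _ _ _ (fun k w => smoother (harmonic k) (F w) i j)).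
  by move=> k; apply: pos; rewrite invr_gt0.
by move=> w _; exact: smoother_cvg.
Qed.

Lemma measurable_mse n p (F : T -> 'M[R]_(n, p)) (u : T -> 'cV[R]_n) tau s2 :
  (0 < n)%N -> 0 <= tau -> mmx F -> mmx u ->
  measurable_fun setT (fun w => mse (F w) tau (u w) s2).
Proof.
move=> n0 tau0 mF mu; have mS := mmx_smoother n0 tau0 mF.
apply: measurable_funM; first exact: measurable_cst.
apply: measurable_funD.
  apply: measurable_nsq; apply: mmx_add; [exact: mmx_mul|exact: mmx_opp].
apply: measurable_funM; first exact: measurable_cst.
by apply: measurable_trace; apply: mmx_mul => //; exact: mmx_tr.
Qed.

End MatrixMeasurability.

(** * Moments and independence in the model *)

Section ModelFacts.
Context {R : realType} {sigma_x : R} {n : nat}.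
Variable M : ridge_model sigma_x n.
Local Notation P := (Pr M).
Local Notation p := (dimp M).

Lemma measurable_xs i : measurable_fun setT (xs M i : Om M -> p.-tuple R).
Proof. exact: measurable_funPT. Qed.

Lemma measurable_x i j : measurable_fun setT (fun w => tnth (xs M i w) j).
Proof. exact: (measurableT_comp (measurable_tnth j) (measurable_xs i)). Qed.

Lemma measurable_eps i : measurable_fun setT (eps M i : Om M -> R).
Proof. exact: measurable_funPT. Qed.

Lemma measurable_ys i : measurable_fun setT (ys M i).
Proof.
apply: measurable_funD; last exact: measurable_eps.
by apply: measurable_sum => j; apply: measurable_funM => //; exact: measurable_x.
Qed.

Lemma measurable_data i :
  measurable_fun setT (fun w => (ys M i w, xs M i w) : R * p.-tuple R).
Proof. by apply/measurable_fun_pairP; split; [exact: measurable_ys|exact: measurable_xs]. Qed.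

Lemma hasE_eps_sqr i : hasE P (fun w => eps M i w ^+ 2) (sigma2 M).
Proof.
apply: ge0_hasE => [|w|]; first by apply: measurable_funX; exact: measurable_eps.
  exact: sqr_ge0.
have := eps_var M i; rewrite /variance unlock eps_mean /= unlock => <-.
by apply: eq_integral => w _; rewrite expr2 -[eps M i w]subr0.
Qed.

Lemma hasE_eps i : hasE P (eps M i : Om M -> R) 0.
Proof.
have [r hr] := hasE_sqr (measurable_eps i) (hasE_eps_sqr i).
suff -> : 0 = r by [].
by apply: EFin_inj; rewrite -hr.2; have := eps_mean M i; rewrite unlock.
Qed.

Lemma hasE_xx i j k :
  hasE P (fun w => tnth (xs M i w) j * tnth (xs M i w) k) (diag_mx (lambda M) j k).
Proof.
have E l m : (\int[P]_w (tnth (xs M i w) l * tnth (xs M i w) m)%:E)%E = (diag_mx (lambda M) l m)%:E.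
  have := @xs_var _ _ _ M i l m; rewrite unlock !xs_mean /= unlock => <-.
  apply: eq_integral => w _.
  by rewrite -[tnth _ l]subr0 -[X in (_ * X)%:E]subr0.
have sq l : hasE P (fun w => tnth (xs M i w) l ^+ 2) (diag_mx (lambda M) l l).
  apply: ge0_hasE => [|w|]; first by apply: measurable_funX; exact: measurable_x.
    exact: sqr_ge0.
  by rewrite -E; apply: eq_integral => w _; rewrite expr2.
have [r hr] := hasE_prod_sqr (measurable_x i j) (measurable_x i k) (sq j) (sq k).
suff <- : r = diag_mx (lambda M) j k by [].
by apply: EFin_inj; rewrite -hr.2 E.
Qed.

Lemma hasE_x i j : hasE P (fun w => tnth (xs M i w) j) 0.
Proof.
have sq : hasE P (fun w => tnth (xs M i w) j ^+ 2) (diag_mx (lambda M) j j).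
  by apply: hasE_eq (hasE_xx i j j) => w; rewrite expr2.
have [r hr] := hasE_sqr (measurable_x i j) sq.
suff -> : 0 = r by [].
by apply: EFin_inj; rewrite -hr.2; have := @xs_mean _ _ _ M i j; rewrite unlock.
Qed.

(** The noise is recovered as [y - x^T theta], so an event on [(x_i, eps_i)] is one on the data pair
    [(y_i, x_i)]. [data_indep] separates the observations and [eps_xs_indep] the two components of
    each. *)
Lemma xs_eps_joint (J : {set 'I_n}) (A : 'I_n -> set (p.-tuple R)) (B : 'I_n -> set R) :
  (forall i, measurable (A i)) -> (forall i, measurable (B i)) ->
  P (\bigcap_(i in [set` J]) ((xs M i @^-1` A i) `&` (eps M i @^-1` B i))) =
  (\prod_(i in J) (P (xs M i @^-1` A i) * P (eps M i @^-1` B i)))%E.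
Proof.
move=> mA mB; pose h (z : R * p.-tuple R) := z.1 - \sum_(j < p) tnth z.2 j * theta M j 0.
have mh : measurable_fun setT h.
  apply: measurable_funB => //; apply: measurable_sum => j; apply: measurable_funM => //.
  exact: (measurableT_comp (measurable_tnth j)).
pose D i := [set z : R * p.-tuple R | A i z.2 /\ B i (h z)].
have mD i : measurable (D i).
  rewrite (_ : D i = (setT `&` snd @^-1` A i) `&` (setT `&` h @^-1` B i)).
    by apply: measurableI; [exact: measurable_snd|exact: mh].
  by rewrite !setTI.
have DE i : (fun w => (ys M i w, xs M i w)) @^-1` D i =
    (xs M i @^-1` A i) `&` (eps M i @^-1` B i).
  apply/seteqP; split => w; rewrite /D /h /preimage /= /ys => -[Aw Bw];
  by split => //; move: Bw; rewrite addrAC subrr add0r.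
have := @data_indep _ _ _ M J D mD; under eq_bigcapr do rewrite DE; move=> ->.
by apply: eq_bigr => i _; rewrite DE setIC eps_xs_indep // muleC.
Qed.

Lemma eps_indep : mutually_independent P (fun i => eps M i : Om M -> R).
Proof.
move=> J B mB; have := @xs_eps_joint J (fun=> setT) B (fun=> measurableT) mB.
under eq_bigcapr do rewrite preimage_setT setTI.
move=> ->; apply: eq_bigr => i _; rewrite preimage_setT.
by rewrite [X in (X * _)%E](_ : _ = 1%E) ?mul1e //; exact: probability_setT.
Qed.

Lemma eps_pair_indep i j : i != j ->
  independent2 P (eps M i : Om M -> R) (eps M j : Om M -> R).
Proof.
move=> ij A B mA mB.
have := eps_indep [set i; j]%SET (A := fun k => if k == i then A else B).
have -> : \bigcap_(k in [set` [set i; j]%SET]) eps M k @^-1` (if k == i then A else B) =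
    eps M i @^-1` A `&` eps M j @^-1` B.
  apply/seteqP; split => [w wC|w [wA wB] k /=].
    split; first by have := wC i; rewrite /= !inE eqxx => /(_ isT).
    by have := wC j; rewrite /= !inE eqxx orbT eq_sym (negPf ij) => /(_ isT).
  by rewrite !inE => /orP[/eqP ->|/eqP ->]; rewrite /= ?eqxx // eq_sym (negPf ij).
move=> -> //; last by move=> k; case: ifP.
rewrite big_setU1 ?inE //= big_set1 eqxx.
by rewrite eq_sym (negPf ij).
Qed.

Definition design_tuple (w : Om M) : n.-tuple (p.-tuple R) := [tuple xs M i w | i < n].
Definition noise_tuple (w : Om M) : n.-tuple R := [tuple eps M i w | i < n].

Lemma measurable_design_tuple : measurable_fun setT design_tuple.
Proof.
apply/measurable_fun_tnthP => i; rewrite (_ : _ \o _ = xs M i); first exact: measurable_xs.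
by apply/funext => w /=; rewrite tnth_mktuple.
Qed.

Lemma measurable_noise_tuple : measurable_fun setT noise_tuple.
Proof.
apply/measurable_fun_tnthP => i; rewrite (_ : _ \o _ = eps M i); first exact: measurable_eps.
by apply/funext => w /=; rewrite tnth_mktuple.
Qed.

(** Independence of each noise from its own row would not suffice: in the loss, each noise is
    multiplied by functions of the whole design. *)
Lemma design_noise_indep : independent2 P design_tuple noise_tuple.
Proof.
apply: independent2_tuples => [i|i|A B mA mB].
- exact: measurable_xs.
- exact: measurable_eps.
have cap (V : Type) (Z : 'I_n -> Om M -> V) (C : 'I_n -> set V) :
    [set w | forall i, C i (Z i w)] = \bigcap_(i in [set` [set: 'I_n]%SET]) Z i @^-1` C i.
  apply/seteqP; split => w /= wC i; first by move=> _; exact: wC.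
  by apply: wC; rewrite /= inE.
have E := xs_eps_joint [set: 'I_n] mA mB.
have EA := @xs_eps_joint [set: 'I_n] A (fun=> setT) mA (fun=> measurableT).
have EB := @xs_eps_joint [set: 'I_n] (fun=> setT) B (fun=> measurableT) mB.
have PT : P setT = 1%E by exact: probability_setT.
rewrite !cap -bigcapI; apply: (etrans E); rewrite big_split /=; congr (_ * _)%E.
- apply/esym; move: EA; under eq_bigcapr do rewrite preimage_setT setIT.
  by move=> ->; apply: eq_bigr => i _; rewrite preimage_setT PT mule1.
- apply/esym; move: EB; under eq_bigcapr do rewrite preimage_setT setTI.
  by move=> ->; apply: eq_bigr => i _; rewrite preimage_setT PT mul1e.
Qed.

End ModelFacts.

(** * The conditional risk as squared bias plus variance *)

Section ConditionalMSE.
Context {R : realType} {sigma_x : R} {n : nat}.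
Variable M : ridge_model sigma_x n.
Hypothesis n_gt0 : (0 < n)%N.
Variable tau : R.
Hypothesis tau_ge0 : 0 <= tau.
Local Notation P := (Pr M).
Local Notation p := (dimp M).
Local Notation DT := (@design_tuple R sigma_x n M).
Local Notation V := (n.-tuple (p.-tuple R)).

Definition tuple_mx (t : V) : 'M[R]_(n, p) := \matrix_(i, j) tnth (tnth t i) j.
Definition signal (w : Om M) : 'cV[R]_n := design w *m theta M.

Lemma design_tupleE w : design w = tuple_mx (design_tuple w).
Proof. by apply/matrixP => i j; rewrite !mxE tnth_mktuple. Qed.

Lemma mmx_tuple_mx : mmx tuple_mx.
Proof.
move=> i j; under eq_fun do rewrite mxE.
exact: (measurableT_comp (measurable_tnth j) (measurable_tnth i)).
Qed.

Lemma responseE w : response w = signal w + \col_i eps M i w.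
Proof.
apply/matrixP => i j; rewrite ord1 !mxE; congr (_ + _).
by apply: eq_bigr => k _; rewrite !mxE.
Qed.

Let S (t : V) := smoother tau (tuple_mx t).
Let u (t : V) : 'cV[R]_n := tuple_mx t *m theta M.
Let a t := S t *m u t - u t.
Let Q t := (S t)^T *m S t.
Let b t := (S t)^T *m a t.

Let mS : mmx S. Proof. exact: mmx_smoother mmx_tuple_mx. Qed.
Let mu : mmx u. Proof. exact: mmx_mul mmx_tuple_mx (mmx_cst _). Qed.
Let ma : mmx a. Proof. exact: mmx_add (mmx_mul mS mu) (mmx_opp mu). Qed.
Let mQ : mmx Q. Proof. exact: mmx_mul (mmx_tr mS) mS. Qed.
Let mb : mmx b. Proof. exact: mmx_mul (mmx_tr mS) ma. Qed.

Let S_tr_le t v : nsq ((S t)^T *m v) <= nsq v.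
Proof.
rewrite -[leRHS]mul1r; apply: nsq_trmx_le => // v'; rewrite mul1r.
exact: smoother_contraction.
Qed.

(** A quadratic polynomial in the noise whose coefficients are functions of the design tuple, so
    that expectations can be taken term by term. *)
Lemma loss_expand (w : Om M) (t := design_tuple w) :
  wnorm (Sigma_hat w) (ridge tau (design w) (response w) - theta M) ^+ 2 =
  n%:R^-1 * (nsq (a t) + 2 * (\sum_i b t i 0 * eps M i w) +
    \sum_i \sum_j Q t i j * (eps M i w * eps M j w)).
Proof.
set v := ridge _ _ _ - _; set e : 'cV[R]_n := \col_i eps M i w.
have -> : wnorm (Sigma_hat w) v ^+ 2 = n%:R^-1 * nsq (design w *m v).
  have e0 : (v^T *m Sigma_hat w *m v) 0 0 = n%:R^-1 * nsq (design w *m v).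
    rewrite /Sigma_hat -scalemxAr -scalemxAl mxE; congr (_ * _).
    by rewrite -mulmxA -mulmxA dotvE dotvC dotv_mulmx trmxK.
  by rewrite /wnorm sqr_sqrtr e0 // mulr_ge0.
congr (_ * _).
have -> : design w *m v = a t + S t *m e.
  rewrite /v mulmxBr ridgeE // mulmxA responseE -/(signal w) -/e mulmxDr.
  by rewrite /a /S /u /smoother -/t -design_tupleE addrAC.
rewrite nsqD; congr (_ + _ * _ + _).
  by rewrite dotvC dotv_mulmx dotvC; apply: eq_bigr => i _; rewrite !mxE.
rewrite /nsq dotv_mulmx mulmxA; apply: eq_bigr => i _; rewrite -/(Q t).
rewrite [(_ *m e) i 0]mxE mulr_sumr; apply: eq_bigr => j _.
by rewrite [e i 0]mxE [e j 0]mxE; ring.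
Qed.

Lemma mse_expand (w : Om M) (t := design_tuple w) :
  mse (design w) tau (signal w) (sigma2 M) =
  n%:R^-1 * (nsq (a t) + \sum_i Q t i i * sigma2 M).
Proof.
rewrite /mse /signal design_tupleE -/t; congr (_ * (_ + _)).
by rewrite -mulr_suml mulrC.
Qed.

Let hasE_signal : exists r, hasE P (fun w => nsq (u (design_tuple w))) r.
Proof.
suff h i : hasE P (fun w => u (design_tuple w) i 0 ^+ 2)
    (\sum_j \sum_k theta M j 0 * theta M k 0 * diag_mx (lambda M) j k).
  have := hasE_sum (index_enum _) h => H; eexists; apply: hasE_eq H => w.
  by rewrite nsqE.
have := hasE_sum (index_enum _) (fun j => hasE_sum (index_enum _) (fun k =>
  hasE_scale (theta M j 0 * theta M k 0) (hasE_xx i j k))).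
apply: hasE_eq => w; rewrite /u -design_tupleE mxE expr2 mulr_suml.
apply: eq_bigr => j _; rewrite mulr_sumr; apply: eq_bigr => k _.
by rewrite !mxE; ring.
Qed.

Let mcomp (f : V -> R) : measurable_fun setT f ->
  measurable_fun setT (fun w : Om M => f (design_tuple w)).
Proof.
by move=> mf; apply: (measurableT_comp mf); exact: measurable_design_tuple.
Qed.

Let a_le t : nsq (a t) <= 4 * nsq (u t).
Proof.
have := nsqD_le (S t *m u t) (- u t); rewrite nsqN.
have := smoother_contraction (tuple_mx t) n_gt0 (u t) tau_ge0; rewrite -/(S t) -/(a t); lra.
Qed.

Let indic_norm_le (B : set V) t (x : R) : `|\1_B t * x| <= `|x|.
Proof. by rewrite normrM ler_piMl // ger0_norm ?indicE // lern1 leq_b1. Qed.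

(** Over an event of the design, the linear terms and the products of distinct noises have mean
    zero, and squared noises have mean [sigma2]. Integrability comes from the smoother being a
    contraction: every coefficient is dominated by a constant plus a multiple of the squared norm of
    the signal. *)
Lemma hasE_loss_mse (B : set V) : measurable B -> exists r,
  hasE P (fun w => \1_(DT @^-1` B) w *
    wnorm (Sigma_hat w) (ridge tau (design w) (response w) - theta M) ^+ 2) r /\
  hasE P (fun w => \1_(DT @^-1` B) w *
    mse (design w) tau (signal w) (sigma2 M)) r.
Proof.
move=> mB; have [r0 hu] := hasE_signal.
have mI : measurable_fun setT (\1_B : V -> R) by [].
have mfa : measurable_fun setT (fun t => \1_B t * nsq (a t)).
  by apply: measurable_funM => //; exact: measurable_nsq.
have mfb i : measurable_fun setT (fun t => \1_B t * b t i 0).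
  by apply: measurable_funM => //; exact: mb.
have mfQ i j : measurable_fun setT (fun t => \1_B t * Q t i j).
  by apply: measurable_funM => //; exact: mQ.
have [ra ha] : exists r, hasE P (fun w => \1_B (design_tuple w) * nsq (a (design_tuple w))) r.
  apply: (hasE_dom (mcomp mfa) (hasE_scale 4 hu)) => w.
  by rewrite (le_trans (indic_norm_le _ _ _)) // ger0_norm // a_le.
have hb i : hasE P (fun w => \1_B (design_tuple w) * b (design_tuple w) i 0 * eps M i w) 0.
  have [r hr] : exists r, hasE P (fun w => \1_B (design_tuple w) * b (design_tuple w) i 0) r.
    (* The dominating function comes from [|x| <= 1 + x ^+ 2] for [x = b t i 0], and
       [nsq (b t) <= nsq (a t) <= 4 * nsq (u t)]. *)
    apply: (hasE_dom (mcomp (mfb i)) (hasE_add (hasE_cst _ 1) (hasE_scale 4 hu))) => w.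
    set t := design_tuple w; rewrite (le_trans (indic_norm_le _ _ _)) //.
    have h1 := dotv_sum_sqr (b t) i; have h2 := S_tr_le t (a t); have h3 := a_le t.
    rewrite -/(b t) in h2; move: h1; rewrite -(real_normK (num_real (b t i 0))).
    have := sqr_ge0 (`|b t i 0| - 1); have := normr_ge0 (b t i 0); nra.
  rewrite -(mulr0 r).
  apply: (hasE_eq (f := fun w => \1_B (design_tuple w) * b (design_tuple w) i 0 *
     (@tnth n R ^~ i) (noise_tuple w))) => [w|]; first by rewrite tnth_mktuple.
  apply: (hasE_indep (@measurable_design_tuple _ _ _ M) (@measurable_noise_tuple _ _ _ M)
    (@design_noise_indep _ _ _ M) (mfb i) (measurable_tnth i) hr).
  by apply: hasE_eq (hasE_eps M i) => w; rewrite tnth_mktuple.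
have [c hc] : exists c : 'I_n -> 'I_n -> R, forall i j,
    hasE P (fun w => \1_B (design_tuple w) * Q (design_tuple w) i j) (c i j).
  suff /choice[c hc] : forall ij : 'I_n * 'I_n, exists r,
     hasE P (fun w => \1_B (design_tuple w) * Q (design_tuple w) ij.1 ij.2) r.
    by exists (fun i j => c (i, j)) => i j; exact: (hc (i, j)).
  move=> [i j] /=; apply: (hasE_dom (mcomp (mfQ i j)) (hasE_cst _ 2)) => w.
  set t := design_tuple w; rewrite (le_trans (indic_norm_le _ _ _)) //.
  have h1 := dotv_sum_sqr (Q t *m delta_mx j 0) i; rewrite -colE mxE in h1.
  have h2 : nsq (Q t *m delta_mx j 0) <= 1.
    rewrite /Q -mulmxA -(nsq_delta j); apply: (le_trans (S_tr_le _ _)).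
    exact: smoother_contraction.
  rewrite -colE in h2; move: h1; rewrite -(real_normK (num_real (Q t i j))).
  have := normr_ge0 (Q t i j); nra.
have hQ i j : hasE P (fun w => \1_B (design_tuple w) * Q (design_tuple w) i j *
    (eps M i w * eps M j w)) (c i j * (if i == j then sigma2 M else 0)).
  apply: (hasE_eq (f := fun w => \1_B (design_tuple w) * Q (design_tuple w) i j *
     (fun s : n.-tuple R => tnth s i * tnth s j) (noise_tuple w))) => [w|].
    by rewrite !tnth_mktuple.
  have mtt : measurable_fun setT (fun s : n.-tuple R => tnth s i * tnth s j).
    by apply: measurable_funM; exact: measurable_tnth.
  apply: (hasE_indep (@measurable_design_tuple _ _ _ M) (@measurable_noise_tuple _ _ _ M)
    (@design_noise_indep _ _ _ M) (mfQ i j) mtt (hc i j)).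
  apply: (hasE_eq (f := fun w => eps M i w * eps M j w)) => [w|].
    by rewrite !tnth_mktuple.
  case: eqVneq => [->|ij].
    by apply: hasE_eq (hasE_eps_sqr M j) => w; rewrite expr2.
  rewrite -(mulr0 0); apply: (hasE_indep (measurable_eps i) (measurable_eps j)
    (eps_pair_indep M ij) (@measurable_id _ _ setT) (@measurable_id _ _ setT)).
  - exact: hasE_eps.
  - exact: hasE_eps.
exists (n%:R^-1 * (ra + \sum_i c i i * sigma2 M)); split.
  have -> : n%:R^-1 * (ra + \sum_i c i i * sigma2 M) =
      n%:R^-1 * (ra + 2 * (\sum_(i < n) 0) +
      \sum_i \sum_j c i j * (if i == j then sigma2 M else 0)).
    rewrite sumr_const mul0rn mulr0 addr0; congr (_ * (_ + _)).
    apply: eq_bigr => i _; rewrite (bigD1 i) //= eqxx big1 ?addr0 // => j ji.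
    by rewrite eq_sym (negPf ji) mulr0.
  have := hasE_scale n%:R^-1 (hasE_add (hasE_add ha (hasE_scale 2
    (hasE_sum (index_enum 'I_n) hb))) (hasE_sum (index_enum 'I_n)
      (fun i => hasE_sum (index_enum 'I_n) (hQ i)))).
  apply: hasE_eq => w; rewrite loss_expand; set t := design_tuple w.
  rewrite (_ : \1_(DT @^-1` B) w = \1_B t) //.
  rewrite mulrCA; congr (_ * _); rewrite !mulrDr mulrCA !mulr_sumr; congr (_ + _ + _).
    by apply: eq_bigr => i _; rewrite !mulrA.
  apply: eq_bigr => i _; rewrite mulr_sumr; apply: eq_bigr => j _; by rewrite !mulrA.
have hS i : hasE P (fun w => sigma2 M * (\1_B (design_tuple w) * Q (design_tuple w) i i))
     (c i i * sigma2 M).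
  by rewrite mulrC; exact: hasE_scale.
have := hasE_scale n%:R^-1 (hasE_add ha (hasE_sum (index_enum 'I_n) hS)).
apply: hasE_eq => w; rewrite mse_expand; set t := design_tuple w.
rewrite (_ : \1_(DT @^-1` B) w = \1_B t) //.
rewrite mulrCA; congr (_ * _); rewrite !mulrDr; congr (_ + _).
by rewrite mulr_sumr; apply: eq_bigr => i _; ring.
Qed.

Lemma mse_is_cond_exp : is_cond_exp P (@sigma_design _ _ _ M)
  (fun w => wnorm (Sigma_hat w) (ridge tau (design w) (response w) - theta M) ^+ 2)
  (fun w => mse (design w) tau (signal w) (sigma2 M)).
Proof.
have mphi : measurable_fun setT (fun t : V => mse (tuple_mx t) tau (u t) (sigma2 M)).
  by apply: measurable_mse => //; exact: mmx_tuple_mx.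
split.
- have [r [_ [hr _]]] := hasE_loss_mse measurableT.
  apply: eq_integrable hr => // w _ /=.
  by rewrite preimage_setT indicT mul1r.
- move=> B mB; exists ((fun t : V => mse (tuple_mx t) tau (u t) (sigma2 M)) @^-1` B).
    by rewrite -[X in measurable X]setTI; exact: mphi.
  rewrite setTI; apply/seteqP; split => w /=;
  by rewrite /signal design_tupleE.
move=> A [B mB <-]; rewrite setTI; have [r [hl hm]] := hasE_loss_mse mB.
have mA : measurable (DT @^-1` B).
  by rewrite -[X in measurable X]setTI; exact: (@measurable_design_tuple _ _ _ M).
by rewrite (hasE_integralI mA hl) (hasE_integralI mA hm).
Qed.

Lemma MSE_in_ae : measurable_fun setT (MSE_in M tau) /\
  {ae P, forall w, MSE_in M tau w = mse (design w) tau (signal w) (sigma2 M)}.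
Proof.
have [[ig _ _] ae] := is_cond_exp_ae (@measurable_design_tuple _ _ _ M) mse_is_cond_exp.
by split=> //; apply/measurable_EFinP; exact: measurable_int ig.
Qed.

End ConditionalMSE.

(** * Elementary inequalities for the exponential *)

Section ExponentialBounds.
Context {R : realType}.

Lemma expR_le_quad (x : R) : expR x <= 1 + x + x ^+ 2 * expR `|x|.
Proof.
have h1 : expR x - 1 <= x * expR x.
  have := expR_ge1Dx (- x); rewrite -(ler_pM2r (expR_gt0 x)) -expRD addNr expR0; lra.
have h0 := expR_ge1Dx x.
have [x0|x0] := leP 0 x.
  rewrite (ger0_norm x0); have := ler_wpM2l x0 h1; nra.
have e1 : 1 <= expR `|x| by rewrite -[leLHS]expR0 ler_expR.
have := ler_wpM2l (sqr_ge0 x) e1; nra.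
Qed.

Lemma sqr_le_expR (u : R) : 0 <= u -> u ^+ 2 <= 16 * expR (u / 2).
Proof.
move=> u0; have -> : u / 2 = u / 4 + u / 4 by field.
have h : 1 + u / 4 <= expR (u / 4) by exact: expR_ge1Dx.
rewrite expRD; nra.
Qed.

Lemma expR1_le4 : expR 1 <= 4 :> R.
Proof.
have h := expR_ge1Dx (- (1 / 2) : R).
have e0 := expR_gt0 (1 / 2 : R).
have E : expR (1 / 2) * expR (- (1 / 2)) = 1 :> R by rewrite -expRD addrN expR0.
have -> : 1 = 1 / 2 + 1 / 2 :> R by field.
rewrite expRD; nra.
Qed.

(** Jensen's inequality, from the tangent line of the exponential at the mean [m]. *)
Lemma expR_convex_sum (I : finType) (a y : I -> R) :
  (forall i, 0 <= a i) -> \sum_i a i = 1 ->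
  expR (\sum_i a i * y i) <= \sum_i a i * expR (y i).
Proof.
move=> a0 a1; set m := \sum_i a i * y i.
have -> : expR m = \sum_i a i * (expR m * (1 + (y i - m))).
  transitivity (expR m * (\sum_i a i + \sum_i a i * y i - \sum_i a i * m)).
    by rewrite -mulr_suml a1 -/m; ring.
  rewrite -big_split -sumrB mulr_sumr; apply: eq_bigr => i _ /=; ring.
apply: ler_sum => i _; rewrite ler_wpM2l //.
have -> : expR (y i) = expR m * expR (y i - m) by rewrite -expRD; congr expR; ring.
by rewrite ler_pM2l ?expR_gt0 // expR_ge1Dx.
Qed.

Lemma expR_chord (x c : R) : 0 <= c <= 1 -> 0 <= x ->
  expR (c * x) <= 1 + c * (expR x - 1).
Proof.
move=> /andP[c0 c1] x0.
have := @expR_convex_sum bool (fun b => if b then c else 1 - c) (fun b => if b then x else 0).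
rewrite !big_bool /= !mulr0 !addr0 expR0 => /(_ _ _)/le_trans; apply.
- by case; lra.
- by lra.
- by lra.
Qed.

End ExponentialBounds.

(** * Bernstein's inequality for nonnegative subexponential variables *)

Section Concentration.
Context {R : realType} {d : measure_display} {T : measurableType d}.
Variable P : probability T R.

Lemma measurable_set_cmp (f : T -> R) (c : R) : measurable_fun setT f ->
  [/\ measurable [set w | c < f w], measurable [set w | f w < c],
      measurable [set w | c <= f w] & measurable [set w | f w <= c]].
Proof.
move=> mf; have mc := @measurable_cst _ _ T R setT c.
split; rewrite -[X in measurable X]setTI.
- exact: (measurable_fun_ltr mc mf measurableT (Y := [set true]) I).
- exact: (measurable_fun_ltr mf mc measurableT (Y := [set true]) I).
- exact: (measurable_fun_ler mc mf measurableT (Y := [set true]) I).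
- exact: (measurable_fun_ler mf mc measurableT (Y := [set true]) I).
Qed.

Lemma markov_hasE (A : set T) (f : T -> R) r : measurable A ->
  (forall w, 0 <= f w) -> (forall w, A w -> 1 <= f w) -> hasE P f r ->
  (P A <= r%:E)%E.
Proof.
move=> mA f0 f1 hf; have hA : hasE P \1_A (fine (P A)).
  apply: ge0_hasE => //.
  by rewrite integral_indic // setIT fineK // fin_num_measure.
rewrite -[P A]fineK ?fin_num_measure // lee_fin; apply: (hasE_le hA hf) => w.
by rewrite indicE; case: (boolP (w \in A)) => [/set_mem /f1 //|_].
Qed.

(** The expectation of [1 + Y / K <= expR (Y / K)] reads [1 + K^-1 <= 2]. Applied to squared linear
    forms of unit variance, it gives [1 <= sigma_x]. *)
Lemma subexp_ge1 (Y : T -> R) K r : 0 < K -> hasE P Y 1 ->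
  hasE P (fun w => expR (Y w / K)) r -> r <= 2 -> 1 <= K.
Proof.
move=> K0 hY he r2.
have := hasE_le (hasE_add (hasE_cst P 1) (hasE_scale K^-1 hY)) he.
have h w : 1 + K^-1 * Y w <= expR (Y w / K) by rewrite mulrC expR_ge1Dx.
move=> /(_ h); rewrite mulr1 => h1.
have Ki : 0 < K^-1 by rewrite invr_gt0.
by rewrite -(ler_pM2l Ki) mulr1 mulVf ?gt_eqF //; lra.
Qed.

(** Second-order expansion, the first-order term being centred. With [u = |Y - 1| / K] the remainder
    is at most [(t * K) ^+ 2 * u ^+ 2 * expR (u / 2)], then [16 * (t * K) ^+ 2 * expR u]. Since
    [1 <= K], [expR u <= 4 * expR (Y / K)], whose mean is at most 8; hence 128. *)
Lemma subexp_mgf (Y : T -> R) K r t : 0 < K -> measurable_fun setT Y ->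
  (forall w, 0 <= Y w) -> hasE P Y 1 ->
  hasE P (fun w => expR (Y w / K)) r -> r <= 2 -> `|t| * K <= 2^-1 ->
  exists2 m, hasE P (fun w => expR (t * (Y w - 1))) m & 
    m <= expR (128 * (t * K) ^+ 2).
Proof.
move=> K0 mY Y0 hY he r2 tK; have K1 := subexp_ge1 K0 hY he r2.
have dom w : expR (t * (Y w - 1)) <=
    1 + (t * (-1) + t * Y w) + 64 * (t * K) ^+ 2 * expR (Y w / K).
  apply: (le_trans (expR_le_quad _)); apply: lerD; first by lra.
  set u := `|Y w - 1| / K.
  have u0 : 0 <= u by rewrite divr_ge0 // ltW.
  have xE : `|t * (Y w - 1)| = `|t| * K * u.
    by rewrite normrM /u; field; rewrite gt_eqF.
  have uu : (Y w - 1) ^+ 2 = K ^+ 2 * u ^+ 2.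
    by rewrite /u exprMn real_normK ?num_real // exprVn mulrCA mulfV ?mulr1 // expf_neq0 ?gt_eqF.
  rewrite xE exprMn uu.
  have e1 : expR (`|t| * K * u) <= expR (u / 2) by rewrite ler_expR; nra.
  have e2 := sqr_le_expR u0.
  have e3 : expR u <= 4 * expR (Y w / K).
    apply: (@le_trans _ _ (expR (1 + Y w / K))).
      rewrite ler_expR /u ler_pdivrMr // mulrDl divfK ?gt_eqF // mul1r.
      have := Y0 w; case: (lerP 0 (Y w - 1)) => h; [rewrite ger0_norm //|rewrite ltr0_norm //]; lra.
    by rewrite expRD ler_pM2r ?expR_gt0 // expR1_le4.
  have eu : expR u = expR (u / 2) * expR (u / 2) by rewrite -expRD; congr expR; field.
  have tK2 : 0 <= t ^+ 2 * K ^+ 2 by rewrite mulr_ge0 // sqr_ge0.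
  have e4 : u ^+ 2 * expR (`|t| * K * u) <= 64 * expR (Y w / K).
    have h1 := expR_gt0 (u / 2); have h2 := expR_gt0 (`|t| * K * u).
    have h3 : u ^+ 2 * expR (`|t| * K * u) <= 16 * expR (u / 2) * expR (u / 2).
      by apply: ler_pM => //; rewrite ?sqr_ge0 ?ltW.
    nra.
  apply: le_trans (le_trans (ler_wpM2l tK2 e4) _); rewrite le_eqVlt;
    apply/orP; left; apply/eqP; ring.
have hdom := hasE_add (hasE_add (hasE_cst P 1) (hasE_add (hasE_cst P (t * (-1))) (hasE_scale t hY)))
   (hasE_scale (64 * (t * K) ^+ 2) he).
have mE : measurable_fun setT (fun w => expR (t * (Y w - 1))).
  apply: measurableT_comp => //; apply: measurable_funM => //.
  exact: measurable_funB.
have [m hm] : exists m, hasE P (fun w => expR (t * (Y w - 1))) m.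
  by apply: (hasE_dom mE hdom) => w; rewrite ger0_norm ?expR_ge0 //; exact: dom.
exists m => //; apply: (le_trans (hasE_le hm hdom dom)).
apply: le_trans (expR_ge1Dx _); have := sqr_ge0 (t * K); nra.
Qed.

(** Chernoff's method. The sign [s] treats both tails at once. *)
Lemma bernstein d' (U : measurableType d') n (Z : 'I_n -> T -> U) (f : U -> R)
    (K s eta : R) :
  (forall i, measurable_fun setT (Z i)) -> mutually_independent P Z ->
  measurable_fun setT f -> (forall u, 0 <= f u) -> 0 < K ->
  (forall i, hasE P (fun w => f (Z i w)) 1) ->
  (forall i, exists2 r, hasE P (fun w => expR (f (Z i w) / K)) r & r <= 2) ->
  `|s| = 1 -> 0 < eta <= 1 -> (0 < n)%N ->
  (P [set w | (n%:R * eta <= s * \sum_i (f (Z i w) - 1))%R] <=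
   (expR (- (n%:R * eta ^+ 2 / (512 * K ^+ 2))))%:E)%E.
Proof.
move=> mZ iZ mf f0 K0 hf1 hfe s1 /andP[eta0 eta1] n0.
have K1 : 1 <= K.
  by have [r hr r2] := hfe (Ordinal n0); exact: subexp_ge1 K0 (hf1 _) hr r2.
(* Up to the sign, this minimises [128 * (t * K) ^+ 2 - t * eta], with minimum
   [- eta ^+ 2 / (512 * K ^+ 2)]. It is admissible because [eta <= 1 <= K]. *)
pose t := s * (eta / (256 * K ^+ 2)).
have KK : 0 < 256 * K ^+ 2 by apply: mulr_gt0; rewrite ?ltr0n ?exprn_gt0.
have a0 : 0 < eta / (256 * K ^+ 2) by rewrite divr_gt0.
have tn : `|t| = eta / (256 * K ^+ 2) by rewrite normrM s1 mul1r gtr0_norm.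
have tK : `|t| * K <= 2^-1.
  rewrite tn mulrAC ler_pdivrMr //; nra.
have mfZ i : measurable_fun setT (fun w => f (Z i w)) by exact: measurableT_comp.
have /choice[m hm] : forall i, exists m, hasE P (fun w => expR (t * (f (Z i w) - 1))) m /\
    m <= expR (128 * (t * K) ^+ 2).
  move=> i; have [r hr r2] := hfe i.
  by have [m h1 h2] := subexp_mgf K0 (mfZ i) (fun w => f0 _) (hf1 i) hr r2 tK; exists m.
pose g (u : U) := expR (t * (f u - 1)).
have mg : measurable_fun setT g.
  apply: measurableT_comp => //; apply: measurable_funM => //.
  exact: measurable_funB.
have Eg := independent_integral_prod mZ iZ (fun _ : 'I_n => mg)
  (fun _ u => expR_ge0 (t * (f u - 1))) (fun i => (hm i).1.2).
have mprod : measurable_fun setT (fun w => \prod_i g (Z i w)).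
  by apply: measurable_prod => i _; exact: measurableT_comp.
have g0 w : 0 <= \prod_i g (Z i w) by rewrite prodr_ge0 // => i _; exact: expR_ge0.
have hE := ge0_hasE mprod g0 Eg.
have m0 i : 0 <= m i by apply: (hasE_le (hasE_cst P 0) (hm i).1) => w; exact: expR_ge0.
have prodE w : \prod_i g (Z i w) = expR (t * \sum_i (f (Z i w) - 1)).
  by rewrite mulr_sumr expR_sum.
set A := [set w | _].
have mA : measurable A.
  have msum : measurable_fun setT (fun w => s * \sum_i (f (Z i w) - 1)).
    apply: measurable_funM => //; apply: measurable_sum => i; exact: measurable_funB.
  by have [] := measurable_set_cmp (n%:R * eta) msum.
pose c := eta / (256 * K ^+ 2) * (n%:R * eta).
have := markov_hasE (f := fun w => expR (- c) * \prod_i g (Z i w)) mA _ _ (hasE_scale _ hE).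
move=> /(_ _ _)/le_trans; apply.
- by move=> w; rewrite mulr_ge0 ?expR_ge0.
- move=> w Aw; rewrite prodE -expRD -[leLHS]expR0 ler_expR addrC subr_ge0 /c.
  rewrite /t (mulrC s) -[leRHS]mulrA ler_wpM2l ?(ltW a0) //; exact: Aw.
rewrite lee_fin; apply: (@le_trans _ _ (expR (- c) * expR (128 * (t * K) ^+ 2) ^+ n)).
  rewrite ler_pM2l ?expR_gt0 //.
  rewrite -[X in _ ^+ X]card_ord -prodr_const; apply: ler_prod => i _.
  by rewrite m0 (hm i).2.
rewrite -expRM_natl -expRD ler_expR.
rewrite exprMn -(real_normK (num_real t)) tn /c.
rewrite le_eqVlt; apply/orP; left; apply/eqP.
field; rewrite gt_eqF //.
Qed.

End Concentration.

(** * Concentration of linear forms of the design *)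

Section SubGaussianModel.
Context {R : realType} {sigma_x : R} {n : nat}.
Variable M : ridge_model sigma_x n.
Local Notation P := (Pr M).
Local Notation p := (dimp M).

Definition lin (h : 'cV[R]_p) (t : p.-tuple R) : R := \sum_j h j 0 * tnth t j.
Definition qf (h : 'cV[R]_p) : R := \sum_j lambda M 0 j * h j 0 ^+ 2.

Lemma measurable_lin h : measurable_fun setT (lin h).
Proof.
by apply: measurable_sum => j; apply: measurable_funM => //; exact: measurable_tnth.
Qed.

Lemma measurable_lin_xs h i : measurable_fun setT (fun w => lin h (xs M i w)).
Proof. exact: (measurableT_comp (measurable_lin h) (measurable_xs i)). Qed.

Lemma linZ a h t : lin (a *: h) t = a * lin h t.
Proof. by rewrite mulr_sumr; apply: eq_bigr => j _; rewrite mxE mulrA. Qed.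

Lemma qfZ a h : qf (a *: h) = a ^+ 2 * qf h.
Proof. by rewrite mulr_sumr; apply: eq_bigr => j _; rewrite mxE; ring. Qed.

Lemma qf_ge0 h : 0 <= qf h.
Proof.
by apply: sumr_ge0 => j _; rewrite mulr_ge0 ?sqr_ge0 // ltW // lambda_gt0.
Qed.

Lemma qf_eq0 h : qf h = 0 -> h = 0.
Proof.
move=> /eqP; rewrite psumr_eq0 => [/allP h0|j _]; last first.
  by rewrite mulr_ge0 ?sqr_ge0 // ltW // lambda_gt0.
apply/matrixP => j k; rewrite ord1 mxE; apply/eqP.
have := h0 j; rewrite mem_index_enum mulf_eq0 gt_eqF ?lambda_gt0 //= sqrf_eq0.
by apply.
Qed.

Lemma hasE_lin h i : hasE P (fun w => lin h (xs M i w)) 0.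
Proof.
have := hasE_sum (index_enum _) (fun j => hasE_scale (h j 0) (hasE_x i j)).
by rewrite (eq_bigr (fun=> 0)) ?sumr_const ?mul0rn // => j _; rewrite mulr0.
Qed.

Lemma hasE_lin_sqr h i : hasE P (fun w => lin h (xs M i w) ^+ 2) (qf h).
Proof.
have := hasE_sum (index_enum _) (fun j => hasE_sum (index_enum _) (fun k =>
  hasE_scale (h j 0 * h k 0) (hasE_xx i j k))).
have -> : \sum_j \sum_k h j 0 * h k 0 * diag_mx (lambda M) j k = qf h.
  apply: eq_bigr => j _; rewrite (bigD1 j) //= big1 ?addr0.
    by rewrite mxE eqxx mulr1n; ring.
  by move=> k kj; rewrite mxE eq_sym (negPf kj) mulr0n mulr0.
apply: hasE_eq => w; rewrite expr2 mulr_suml; apply: eq_bigr => j _.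
by rewrite mulr_sumr; apply: eq_bigr => k _; ring.
Qed.

(** For the unit vector [s = Sigma^(1/2) h], the inner product of [s] with the whitened [x_i] is
    [lin h x_i]. *)
Lemma psi2_norm_lin_le h i : qf h = 1 ->
  (psi2_norm P (fun w => lin h (xs M i w)) <= sigma_x%:E)%E.
Proof.
move=> qh; pose s : 'cV[R]_p := \col_j (h j 0 * Num.sqrt (lambda M 0 j)).
have l0 j : 0 < Num.sqrt (lambda M 0 j) by rewrite sqrtr_gt0 lambda_gt0.
have s1 : nsq s = 1.
  rewrite nsqE -qh; apply: eq_bigr => j _.
  by rewrite mxE exprMn sqr_sqrtr ?ltW ?lambda_gt0 // mulrC.
rewrite -(xs_psi2 M i); apply: ereal_sup_ubound; exists s.
  by apply/eqP => s0; move: s1; rewrite s0 nsq0 => /eqP; rewrite eq_sym oner_eq0.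
congr psi2_norm; apply/funext => w.
rewrite /enorm /wnorm mulmx1 !dotvE -/(nsq s) s1 sqrtr1 divr1.
apply: eq_bigr => j _; rewrite mul_diag_mx !mxE.
by field; rewrite gt_eqF.
Qed.

Lemma psi2_adm h i t : qf h = 1 -> 0 < t ->
  ('E_P[fun w => expR (lin h (xs M i w) ^+ 2 / t ^+ 2)] <= 2%:E)%E ->
  exists2 r, hasE P (fun w => expR (lin h (xs M i w) ^+ 2 / t ^+ 2)) r & r <= 2.
Proof.
move=> qh t0; rewrite unlock => le2; pose f w := expR (lin h (xs M i w) ^+ 2 / t ^+ 2).
rewrite -/f.
have mf : measurable_fun setT f.
  apply: measurableT_comp => //; apply: measurable_funM => //.
  by apply: measurable_funX; exact: measurable_lin_xs.
have fin : (\int[P]_w (f w)%:E)%E \is a fin_num.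
  rewrite ge0_fin_numE ?(le_lt_trans le2) ?ltry //.
  by apply: integral_ge0 => w _; rewrite lee_fin expR_ge0.
exists (fine (\int[P]_w (f w)%:E)%E); last by rewrite -lee_fin fineK.
by apply: ge0_hasE; rewrite ?fineK // => w; exact: expR_ge0.
Qed.

Lemma exists_qf1 : exists h : 'cV[R]_p, qf h = 1.
Proof.
have p0 : (0 < p)%N by exact: leq_ltn_trans (dimd_ltp M).
pose j0 := Ordinal p0; have l0 : 0 < lambda M 0 j0 by exact: lambda_gt0.
exists ((Num.sqrt (lambda M 0 j0))^-1 *: delta_mx j0 0).
rewrite qfZ /qf (bigD1 j0) //= !mxE !eqxx big1 ?addr0 => [|j jj0].
  by rewrite exprVn sqr_sqrtr ?ltW // expr1n mulr1 mulVf // gt_eqF.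
by rewrite mxE (negPf jj0) expr0n mulr0.
Qed.

Hypothesis n_gt0 : (0 < n)%N.

Lemma sigma_x_ge1 : 1 <= sigma_x.
Proof.
have [h qh] := exists_qf1; pose i := Ordinal n_gt0.
rewrite -lee_fin; apply: le_trans (psi2_norm_lin_le i qh).
apply: le_ereal_inf_tmp => _ [t [t0 et] <-]; rewrite lee_fin.
have [r hr r2] := psi2_adm qh t0 et.
have := hasE_lin_sqr h i; rewrite qh => h1.
have := subexp_ge1 (exprn_gt0 2 t0) h1 hr r2.
by move=> t2; rewrite leNgt; apply/negP => t1; nra.
Qed.

Local Notation K := (2 * sigma_x ^+ 2).

Lemma Kpsi_gt0 : 0 < K.
Proof. by rewrite mulr_gt0 // exprn_gt0 // (lt_le_trans ltr01) // sigma_x_ge1. Qed.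

(** The psi2 norm is an infimum; the factor 2 in [K] leaves room for an admissible [t] with
    [t ^+ 2 <= K], whether or not the infimum is attained. *)
Lemma lin_subexp h i : qf h = 1 ->
  exists2 r, hasE P (fun w => expR (lin h (xs M i w) ^+ 2 / K)) r & r <= 2.
Proof.
move=> qh; have s1 := sigma_x_ge1; have K0 := Kpsi_gt0.
have lt : (psi2_norm P (fun w => lin h (xs M i w)) < (Num.sqrt K)%:E)%E.
  apply: (le_lt_trans (psi2_norm_lin_le i qh)); rewrite lte_fin.
  have s0 : 0 <= sigma_x by rewrite (le_trans ler01).
  rewrite -[ltLHS](ger0_norm s0) -sqrtr_sqr ltr_sqrt //.
  by rewrite mulrC ltr_pMr ?exprn_gt0 ?(lt_le_trans ltr01) // ltr1n.
have [_ [t [t0 et] <-]] := ereal_inf_lt lt; rewrite lte_fin => tK.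
have [r hr r2] := psi2_adm qh t0 et.
have t2 : t ^+ 2 <= K.
  by rewrite -(sqr_sqrtr (ltW K0)) ler_pXn2r ?nnegrE ?sqrtr_ge0 ?ltW.
have dom w : expR (lin h (xs M i w) ^+ 2 / K) <= expR (lin h (xs M i w) ^+ 2 / t ^+ 2).
  by rewrite ler_expR ler_wpM2l ?sqr_ge0 // lef_pV2 ?posrE // exprn_gt0.
have mE : measurable_fun setT (fun w => expR (lin h (xs M i w) ^+ 2 / K)).
  apply: measurableT_comp => //; apply: measurable_funM => //.
  by apply: measurable_funX; exact: measurable_lin_xs.
have [r' hr'] : exists r', hasE P (fun w => expR (lin h (xs M i w) ^+ 2 / K)) r'.
  by apply: (hasE_dom mE hr) => w; rewrite ger0_norm ?expR_ge0.
by exists r' => //; apply: le_trans r2; exact: (hasE_le hr' hr dom).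
Qed.

Lemma data_mutually_indep :
  mutually_independent P (fun i w => (ys M i w, xs M i w) : R * p.-tuple R).
Proof. exact: data_indep. Qed.

(** The exponent of [bernstein] for the relative deviation [eta = 1 / 4] and
    [K = 2 * sigma_x ^+ 2]. *)
Definition conc_exponent : R := n%:R / (512 * 64 * sigma_x ^+ 4).

Lemma bernstein_xs (f : p.-tuple R -> R) (s : R) :
  measurable_fun setT f -> (forall u, 0 <= f u) ->
  (forall i, hasE P (fun w => f (xs M i w)) 1) ->
  (forall i, exists2 r, hasE P (fun w => expR (f (xs M i w) / K)) r & r <= 2) ->
  `|s| = 1 ->
  (P [set w | (n%:R / 4 <= s * \sum_i (f (xs M i w) - 1))%R] <=
   (expR (- conc_exponent))%:E)%E.
Proof.
move=> mf f0 h1 he s1.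
have mf2 : measurable_fun setT (fun z : R * p.-tuple R => f z.2).
  exact: (measurableT_comp mf measurable_snd).
have eta : 0 < (1 / 4 : R) <= 1 by apply/andP; split; lra.
have := bernstein (@measurable_data _ _ _ M) data_mutually_indep mf2 (fun u => f0 u.2)
  Kpsi_gt0 h1 he s1 eta n_gt0.
have -> : n%:R * (1 / 4) = n%:R / 4 :> R by field.
suff -> : n%:R * (1 / 4) ^+ 2 / (512 * K ^+ 2) = conc_exponent by [].
by rewrite /conc_exponent; field; rewrite gt_eqF // (lt_le_trans ltr01) // sigma_x_ge1.
Qed.

Lemma lin_sqr_concentration h :
  (P [set w | (5 / 4 * (n%:R * qf h) < \sum_i lin h (xs M i w) ^+ 2)%R] <=
    (expR (- conc_exponent))%:E)%E /\
  (P [set w | (\sum_i lin h (xs M i w) ^+ 2 < 3 / 4 * (n%:R * qf h))%R] <=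
    (expR (- conc_exponent))%:E)%E.
Proof.
have := qf_ge0 h; rewrite le_eqVlt => /predU1P[/esym q0|q0].
  have h0 := qf_eq0 q0; have s0 w : \sum_i lin h (xs M i w) ^+ 2 = 0.
    rewrite big1 // => i _; rewrite h0 /lin big1 ?expr0n // => j _.
    by rewrite mxE mul0r.
  by split; rewrite (_ : [set w | _] = set0) ?measure0 ?lee_fin ?expR_ge0 //;
    apply/seteqP; split => w //=; rewrite s0 q0 !mulr0 ltxx.
pose a := (Num.sqrt (qf h))^-1; pose h' := a *: h.
have aq : a ^+ 2 * qf h = 1.
  by rewrite /a exprVn sqr_sqrtr ?ltW // mulVf // gt_eqF.
have qh' : qf h' = 1 by rewrite qfZ.
have mf : measurable_fun setT (fun t => lin h' t ^+ 2).
  by apply: measurable_funX; exact: measurable_lin.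
have h1 i : hasE P (fun w => lin h' (xs M i w) ^+ 2) 1.
  by rewrite -qh'; exact: hasE_lin_sqr.
have he i := lin_subexp i qh'.
have sE w : \sum_i (lin h' (xs M i w) ^+ 2 - 1) =
    a ^+ 2 * (\sum_i lin h (xs M i w) ^+ 2) - n%:R.
  rewrite sumrB sumr_const card_ord mulr_sumr; congr (_ - _).
  by apply: eq_bigr => i _; rewrite linZ exprMn.
have a20 : 0 < a ^+ 2 by rewrite exprn_gt0 // invr_gt0 sqrtr_gt0.
have B s := @bernstein_xs (fun t => lin h' t ^+ 2) s mf (fun u => sqr_ge0 _) h1 he.
have mset s : measurable [set w | (n%:R / 4 <= s * \sum_i (lin h' (xs M i w) ^+ 2 - 1))%R].
  have ms : measurable_fun setT (fun w => s * \sum_i (lin h' (xs M i w) ^+ 2 - 1)).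
    apply: measurable_funM => //; apply: measurable_sum => i; apply: measurable_funB => //.
    by apply: measurable_funX; exact: measurable_lin_xs.
  by have [] := measurable_set_cmp (n%:R / 4) ms.
have mL (c : R) : measurable [set w | (c < \sum_i lin h (xs M i w) ^+ 2)%R] /\
   measurable [set w | (\sum_i lin h (xs M i w) ^+ 2 < c)%R].
  have ms : measurable_fun setT (fun w => \sum_i lin h (xs M i w) ^+ 2).
    by apply: measurable_sum => i; apply: measurable_funX; exact: measurable_lin_xs.
  by have [] := measurable_set_cmp c ms.
split.
  apply: le_trans (B 1 (normr1 _)); apply: le_measure; rewrite ?inE //; first exact: (mL _).1.
  move=> w /= lt; rewrite mul1r sE.
  have := ltr_pM2l a20 => /(_ (5 / 4 * (n%:R * qf h)) (\sum_i lin h (xs M i w) ^+ 2)).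
  rewrite lt => lt'; move: (lt') => /= => {}lt'.
  have : a ^+ 2 * (5 / 4 * (n%:R * qf h)) < a ^+ 2 * \sum_i lin h (xs M i w) ^+ 2 by rewrite lt'.
  have -> : a ^+ 2 * (5 / 4 * (n%:R * qf h)) = 5 / 4 * n%:R * (a ^+ 2 * qf h) by ring.
  rewrite aq; lra.
apply: le_trans (B (-1) _); last by rewrite normrN normr1.
apply: le_measure; rewrite ?inE //; first exact: (mL _).2.
move=> w /= lt; rewrite mulN1r sE.
have : a ^+ 2 * \sum_i lin h (xs M i w) ^+ 2 < a ^+ 2 * (3 / 4 * (n%:R * qf h)) by rewrite ltr_pM2l.
have -> : a ^+ 2 * (3 / 4 * (n%:R * qf h)) = 3 / 4 * n%:R * (a ^+ 2 * qf h) by ring.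
rewrite aq; lra.
Qed.

(** The weighted square is a convex combination, with weights [a j * lambda_j], of the squares of
    standardised coordinates. By Jensen it inherits their exponential moment, however the
    coordinates depend on one another. *)
Lemma weighted_sqr_concentration (a : 'I_p -> R) :
  (forall j, 0 <= a j) -> \sum_j a j * lambda M 0 j = 1 ->
  (P [set w | (\sum_i \sum_j a j * tnth (xs M i w) j ^+ 2 < 3 / 4 * n%:R)%R] <=
    (expR (- conc_exponent))%:E)%E.
Proof.
move=> a0 a1; pose f (t : p.-tuple R) := \sum_j a j * tnth t j ^+ 2.
have mf : measurable_fun setT f.
  apply: measurable_sum => j; apply: measurable_funM => //.
  by apply: measurable_funX; exact: measurable_tnth.
have mfx i : measurable_fun setT (fun w => f (xs M i w)).
  exact: (measurableT_comp mf (measurable_xs i)).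
have f0 u : 0 <= f u by apply: sumr_ge0 => j _; rewrite mulr_ge0 ?sqr_ge0.
have h1 i : hasE P (fun w => f (xs M i w)) 1.
  rewrite -a1; apply: hasE_sum => j; apply: hasE_scale.
  have := hasE_xx i j j; rewrite mxE eqxx mulr1n.
  by apply: hasE_eq => w; rewrite expr2.
pose e j : 'cV[R]_p := (Num.sqrt (lambda M 0 j))^-1 *: delta_mx j 0.
have qe j : qf (e j) = 1.
  have l0 := lambda_gt0 j.
  rewrite qfZ /qf (bigD1 j) //= !mxE !eqxx big1 ?addr0 => [|k kj].
    by rewrite exprVn sqr_sqrtr ?ltW // expr1n mulr1 mulVf // gt_eqF.
  by rewrite mxE (negPf kj) expr0n mulr0.
have le j t : lin (e j) t ^+ 2 = tnth t j ^+ 2 / lambda M 0 j.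
  have l0 := lambda_gt0 j.
  rewrite linZ exprMn exprVn sqr_sqrtr ?ltW // mulrC; congr (_ ^+ 2 / _).
  rewrite /lin (bigD1 j) //= mxE !eqxx mul1r big1 ?addr0 // => k kj.
  by rewrite mxE (negPf kj) mul0r.
have he i : exists2 r, hasE P (fun w => expR (f (xs M i w) / K)) r & r <= 2.
  have /choice[r hr] : forall j, exists r, hasE P (fun w => expR (lin (e j) (xs M i w) ^+ 2 / K)) r /\ r <= 2.
    by move=> j; have [r h2 h3] := lin_subexp i (qe j); exists r.
  have hs := hasE_sum (index_enum _) (fun j => hasE_scale (a j * lambda M 0 j) (hr j).1).
  have w0 j : 0 <= a j * lambda M 0 j by rewrite mulr_ge0 // ltW // lambda_gt0.
  have dom w : expR (f (xs M i w) / K) <=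
      \sum_j (a j * lambda M 0 j) * expR (lin (e j) (xs M i w) ^+ 2 / K).
    apply: le_trans (expR_convex_sum _ w0 a1); rewrite ler_expR mulr_suml.
    rewrite le_eqVlt; apply/orP; left; apply/eqP; apply: eq_bigr => j _.
    have l0 : lambda M 0 j != 0 by rewrite gt_eqF // lambda_gt0.
    have s0 : sigma_x != 0 by rewrite gt_eqF // (lt_le_trans ltr01) // sigma_x_ge1.
    by rewrite le; field; rewrite l0 s0.
  have mE : measurable_fun setT (fun w => expR (f (xs M i w) / K)).
    by apply: measurableT_comp => //; apply: measurable_funM.
  have [r' hr'] : exists r', hasE P (fun w => expR (f (xs M i w) / K)) r'.
    by apply: (hasE_dom mE hs) => w; rewrite ger0_norm ?expR_ge0.
  exists r' => //; apply: (le_trans (hasE_le hr' hs dom)).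
  apply: (@le_trans _ _ (\sum_j (a j * lambda M 0 j) * 2)).
    by apply: ler_sum => j _; rewrite ler_wpM2l // (hr j).2.
  by rewrite -mulr_suml a1 mul1r.
have := @bernstein_xs f (-1) mf f0 h1 he; rewrite normrN normr1 => /(_ erefl).
apply: le_trans; apply: le_measure; rewrite ?inE.
- have ms : measurable_fun setT (fun w => \sum_i f (xs M i w)) by exact: measurable_sum.
  by have [] := measurable_set_cmp (3 / 4 * n%:R) ms.
- have ms : measurable_fun setT (fun w => -1 * \sum_i (f (xs M i w) - 1)).
    by apply: measurable_funM => //; apply: measurable_sum => i; exact: measurable_funB.
  by have [] := measurable_set_cmp (n%:R / 4) ms.
move=> w /= lt; rewrite mulN1r sumrB sumr_const card_ord.
by rewrite /f; lra.
Qed.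

(** From the exponential moment of the square to the Laplace transform. The bound has no constant in
    front of the exponential, which is essential because it is multiplied over the [n] rows; hence
    the use of the zero mean. *)
Lemma lin_laplace h i : exists2 m,
  hasE P (fun w => expR (lin h (xs M i w))) m & m <= expR (8 * K * qf h).
Proof.
have K0 := Kpsi_gt0; have := qf_ge0 h; rewrite le_eqVlt => /predU1P[/esym q0|q0].
  exists 1; last by rewrite q0 mulr0 expR0.
  apply: hasE_eq (hasE_cst P 1) => w; rewrite (qf_eq0 q0) /lin big1 ?expR0 // => j _.
  by rewrite mxE mul0r.
pose a := (Num.sqrt (qf h))^-1.
have aq : a ^+ 2 * qf h = 1.
  by rewrite /a exprVn sqr_sqrtr ?ltW // mulVf // gt_eqF.
have [r hr r2] := lin_subexp i (etrans (qfZ a h) aq).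
set q := qf h in q0 aq *; pose z w := lin h (xs M i w).
have zE w : lin (a *: h) (xs M i w) ^+ 2 / K = z w ^+ 2 / (K * q).
  have a2 : a ^+ 2 = q^-1 by rewrite /a exprVn sqr_sqrtr ?ltW.
  by rewrite linZ exprMn -/(z w) a2 (invfM K) [q^-1 * _]mulrC -mulrA [q^-1 * _]mulrC.
have {}hr : hasE P (fun w => expR (z w ^+ 2 / (K * q))) r.
  by apply: hasE_eq hr => w; rewrite zE.
set L := K * q in hr; have L0 : 0 < L by rewrite mulr_gt0.
have hz := hasE_lin h i.
have mE : measurable_fun setT (fun w => expR (z w)).
  by apply: measurableT_comp => //; exact: measurable_lin_xs.
have sh w : 0 <= z w ^+ 2 / L by rewrite divr_ge0 ?sqr_ge0 // ltW.
have zb w : `|z w| <= L / 2 + z w ^+ 2 / L / 2.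
  rewrite -(real_normK (num_real (z w))); set y := `|z w|.
  have h1 : 0 <= (y - L) ^+ 2 / L by rewrite divr_ge0 ?sqr_ge0 // ltW.
  have -> : L / 2 + y ^+ 2 / L / 2 = y + (y - L) ^+ 2 / L / 2 by field; rewrite gt_eqF.
  by rewrite lerDl; lra.
have mex (g : Om M -> R) (s : R) : hasE P g s -> (forall w, expR (z w) <= g w) ->
   s <= expR (8 * L) -> exists2 m, hasE P (fun w => expR (z w)) m & m <= expR (8 * L).
  move=> hg dom sL; have [m hm] : exists m, hasE P (fun w => expR (z w)) m.
    by apply: (hasE_dom mE hg) => w; rewrite ger0_norm ?expR_ge0.
  by exists m => //; apply: le_trans sL; exact: (hasE_le hm hg dom).
(* For small [L], the centred second-order expansion has mean at most [1 + 8 * L]. For [L > 1], the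
   inequality [|z| <= L / 2 + z ^+ 2 / (2 * L)] suffices, as the factor 2 it costs is at most
   [expR L]. *)
rewrite -mulrA -/L; have [L1|L1] := leP L 1.
  apply: (mex _ _ (hasE_add (hasE_add (hasE_cst P 1) hz) (hasE_scale (4 * L) hr))).
    move=> w; rewrite -/(z w); apply: (le_trans (expR_le_quad _)); rewrite lerD2l.
    set v := z w ^+ 2 / L; have zv : z w ^+ 2 = L * v by rewrite /v mulrC divfK ?gt_eqF.
    have v0 : 0 <= v by exact: sh.
    have e1 : expR `|z w| <= expR (1 / 2) * expR (v / 2).
      rewrite -expRD ler_expR; apply: (le_trans (zb w)); rewrite -/v; lra.
    have e2 : expR (1 / 2) <= 2 :> R.
      have : expR 1 = expR (1 / 2) * expR (1 / 2) :> R by rewrite -expRD; congr expR; field.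
      have := @expR1_le4 R; have := expR_gt0 (1 / 2 : R); nra.
    have e3 : v <= 2 * expR (v / 2) by have := expR_ge1Dx (v / 2); lra.
    have e4 : expR v = expR (v / 2) * expR (v / 2) by rewrite -expRD; congr expR; field.
    have e5 := expR_gt0 (v / 2).
    have e6 : expR `|z w| <= 2 * expR (v / 2) by apply: (le_trans e1); rewrite ler_pM2r.
    rewrite zv e4 -[L * v * _]mulrA [4 * L]mulrC -[L * 4 * _]mulrA ler_wpM2l ?(ltW L0) //.
    apply: (@le_trans _ _ (2 * expR (v / 2) * (2 * expR (v / 2)))); last first.
      by rewrite le_eqVlt; apply/orP; left; apply/eqP; ring.
    by apply: ler_pM => //; exact: expR_ge0.
  apply: le_trans (expR_ge1Dx _); nra.
apply: (mex _ _ (hasE_scale (expR (L / 2)) hr)) => [w|].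
  rewrite -expRD ler_expR (le_trans (ler_norm _)) // (le_trans (zb w)) //.
  by rewrite lerD2l; have := sh w; lra.
have e1 : 2 <= expR L by apply: le_trans (expR_ge1Dx _); lra.
apply: (@le_trans _ _ (expR (L / 2) * expR L)).
  by rewrite ler_pM2l ?expR_gt0 // (le_trans r2).
by rewrite -expRD ler_expR; lra.
Qed.

Lemma comb_laplace (u : 'cV[R]_n) h : exists2 m,
  hasE P (fun w => expR (\sum_i u i 0 * lin h (xs M i w))) m &
  m <= expR (8 * K * (nsq u * qf h)).
Proof.
have /choice[m hm] : forall i, exists m, hasE P (fun w => expR (lin (u i 0 *: h) (xs M i w))) m /\
    m <= expR (8 * K * (u i 0 ^+ 2 * qf h)).
  by move=> i; have [m h1 h2] := lin_laplace (u i 0 *: h) i; exists m; rewrite -qfZ.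
pose g i (z : R * p.-tuple R) := expR (lin (u i 0 *: h) z.2).
have mg i : measurable_fun setT (g i).
  apply: measurableT_comp => //.
  exact: (measurableT_comp (measurable_lin _) measurable_snd).
have E := independent_integral_prod (@measurable_data _ _ _ M) data_mutually_indep mg
  (fun i z => expR_ge0 _) (fun i => (hm i).1.2).
have m0 i : 0 <= m i by apply: (hasE_le (hasE_cst P 0) (hm i).1) => w; exact: expR_ge0.
exists (\prod_i m i); last first.
  rewrite nsqE mulr_suml mulr_sumr expR_sum; apply: ler_prod => i _.
  by rewrite m0 (hm i).2.
have prodE w : \prod_i g i (ys M i w, xs M i w) = expR (\sum_i u i 0 * lin h (xs M i w)).
  by rewrite expR_sum; apply: eq_bigr => i _; rewrite /g /= linZ.
apply: (hasE_eq prodE); apply: ge0_hasE => //.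
  apply: measurable_prod => i _; exact: (measurableT_comp (mg i) (measurable_data i)).
by move=> w; apply: prodr_ge0 => i _; exact: expR_ge0.
Qed.

End SubGaussianModel.

(** * A grid net of the unit ball and operator norms *)

Section BallNet.
Context {R : realType} (N : nat).
Hypothesis N_gt0 : (0 < N)%N.

Local Notation B := (4 * N).+1.
Local Notation net_index := {ffun 'I_N -> 'I_B * bool}.
Local Notation s := (Num.sqrt (N%:R : R)).

(** A grid of mesh [1 / (4 * s)], with signs stored apart from absolute values. On the unit ball the
    numerators are at most [4 * s <= 4 * N]. Their squares sum to at most [16 * N], hence so do the
    integers themselves, which is the constraint in [net_set] that allows the counting. *)
Definition net_pt (f : net_index) : 'cV[R]_N :=
  \col_j ((-1) ^+ (f j).2 * (f j).1%:R / (4 * s)).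

Definition net_set : {set net_index} :=
  [set f : net_index | (\sum_j (f j).1 <= 16 * N)%N && (nsq (net_pt f) <= 1)]%SET.

Let s_gt0 : 0 < s. Proof. by rewrite sqrtr_gt0 ltr0n. Qed.
Let s_sqr : s ^+ 2 = N%:R. Proof. by rewrite sqr_sqrtr. Qed.

Lemma half_pow_sum k : \sum_(a < k) (2^-1 : R) ^+ a <= 2.
Proof.
suff -> : \sum_(a < k) (2^-1 : R) ^+ a = 2 - 2 * 2^-1 ^+ k.
  by rewrite gerBl mulr_ge0 // exprn_ge0.
elim: k => [|k IHk]; first by rewrite big_ord0 expr0; ring.
by rewrite big_ord_recr /= IHk exprS; field.
Qed.

(* Each index of the net is counted with weight at least one by
   [2 ^ (16 N - sum of absolute values)], which factorises over coordinates. *)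
Lemma net_card : (#|net_set|)%:R <= expR (18 * N%:R) :> R.
Proof.
have e2 : 2 <= expR 1 :> R by have := expR_ge1Dx (1 : R); lra.
have le1 : (#|net_set|)%:R <= \sum_(f : net_index) 2 ^+ (16 * N) * \prod_j (2^-1 : R) ^+ (f j).1.
  rewrite -sumr_const [leRHS](bigID (mem net_set)) /= -[leLHS]addr0; apply: lerD; last first.
    by apply: sumr_ge0 => f _; rewrite mulr_ge0 ?exprn_ge0 // prodr_ge0 // => j _; rewrite exprn_ge0.
  apply: ler_sum => f; rewrite inE => /andP[fN _].
  rewrite prodrXr exprVn -(subnKC fN) exprD mulrAC divff ?mul1r ?expf_neq0 //.
  by rewrite exprn_ege1 // ler1n.
apply: (le_trans le1); rewrite -mulr_sumr.
rewrite -(bigA_distr_bigA (fun (j : 'I_N) (z : 'I_B * bool) => (2^-1 : R) ^+ z.1)) /=.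
(* Two signs times a geometric sum; together with the weight [2 ^+ (16 * N)] this makes
   [2 ^+ (18 * N)], the origin of the 18. *)
have le4 : \sum_(z : 'I_B * bool) (2^-1 : R) ^+ z.1 <= 2 ^+ 2.
  rewrite -(pair_bigA _ (fun (a : 'I_B) (b : bool) => (2^-1 : R) ^+ a)) /=.
  under eq_bigr do rewrite big_bool /=.
  by rewrite big_split /= expr2; have := half_pow_sum B; lra.
rewrite prodr_const card_ord.
apply: (@le_trans _ _ (2 ^+ (16 * N) * (2 ^+ 2) ^+ N)).
  rewrite ler_wpM2l ?exprn_ge0 // lerXn2r ?nnegrE ?exprn_ge0 //.
  by apply: sumr_ge0 => z _; rewrite exprn_ge0.
rewrite -exprM -exprD -mulnDl -natrM.
rewrite -[X in expR X]mulr1 expRM_natl.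
by rewrite lerXn2r ?nnegrE ?expR_ge0.
Qed.

(** Each coordinate is rounded towards zero, which keeps the point in the ball and costs at most
    [1 / (4 * s)], so [N / (16 * N)] in squared norm. *)
Lemma net_cover (v : 'cV[R]_N) : nsq v <= 1 ->
  exists2 f, f \in net_set & nsq (v - net_pt f) <= (1 / 4) ^+ 2.
Proof.
move=> v1.
have vj j : `|v j 0| <= 1.
  have := dotv_sum_sqr v j; rewrite -(real_normK (num_real (v j 0))) => h.
  by have := normr_ge0 (v j 0); nra.
pose k j : nat := Num.trunc (4 * s * `|v j 0|).
have c0 : 0 < 4 * s by rewrite mulr_gt0.
have k0 j : 0 <= 4 * s * `|v j 0| by rewrite mulr_ge0 // ltW.
have kle j : (k j)%:R <= 4 * s * `|v j 0| by have /andP[] := truncn_itv (k0 j).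
have kgt j : 4 * s * `|v j 0| < (k j)%:R + 1.
  by rewrite natr1; have /andP[_] := truncn_itv (k0 j).
have sN : s <= N%:R.
  have n1 : 1 <= N%:R :> R by rewrite ler1n.
  by have := s_sqr; have := s_gt0; nra.
have kB j : (k j < B)%N.
  rewrite ltnS -(ler_nat R) natrM (le_trans (kle j)) //.
  apply: (@le_trans _ _ (4 * s * 1)); first by rewrite ler_wpM2l // ltW.
  by rewrite mulr1 ler_wpM2l.
pose f : net_index := [ffun j => (Ordinal (kB j), v j 0 < 0)].
have fE j : net_pt f j 0 = (-1) ^+ (v j 0 < 0)%R * ((k j)%:R / (4 * s)).
  by rewrite mxE ffunE /= mulrA.
have vE j : v j 0 = (-1) ^+ (v j 0 < 0)%R * `|v j 0| by rewrite -numEsign.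
have sq (b : bool) (x : R) : ((-1) ^+ b * x) ^+ 2 = x ^+ 2.
  by rewrite exprMn -exprM mulnC exprM sqrrN !expr1n mul1r.
have kq j : (k j)%:R / (4 * s) <= `|v j 0| by rewrite ler_pdivrMr // mulrC.
have kq0 j : 0 <= (k j)%:R / (4 * s) by rewrite divr_ge0 // ltW.
exists f.
  rewrite inE; apply/andP; split.
    rewrite -(ler_nat R) natr_sum natrM.
    apply: (@le_trans _ _ (\sum_j (4 * s) ^+ 2 * v j 0 ^+ 2)).
      apply: ler_sum => j _; rewrite ffunE /=.
      have h : (k j)%:R <= (k j)%:R ^+ 2 :> R.
        by rewrite -natrX ler_nat; case: (k j) => // m; rewrite -{1}[m.+1]expn1 leq_pexp2l.
      apply: (le_trans h); rewrite -(real_normK (num_real (v j 0))) -exprMn.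
      by rewrite ler_pXn2r ?nnegrE.
    rewrite -mulr_sumr -nsqE exprMn s_sqr.
    have -> : 4 ^+ 2 = 16 :> R by rewrite -natrX.
    by rewrite ger_pMr // mulr_gt0 // ltr0n.
  rewrite (le_trans _ v1) // !nsqE; apply: ler_sum => j _; rewrite fE [in leRHS]vE !sq.
  by rewrite ler_pXn2r ?nnegrE.
rewrite nsqE; apply: (@le_trans _ _ (\sum_(j < N) (1 / (4 * s)) ^+ 2)).
  apply: ler_sum => j _; have -> : (v - net_pt f) j 0 = v j 0 - net_pt f j 0 by rewrite mxE [X in _ + X]mxE.
  rewrite fE {1}vE -mulrBr sq.
  rewrite ler_pXn2r ?nnegrE ?subr_ge0 ?divr_ge0 ?(ltW c0) //.
  by rewrite lerBlDr -mulrDl ler_pdivlMr // mulrC addrC ltW.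
rewrite sumr_const card_ord -mulr_natl expr_div_n expr1n exprMn s_sqr.
rewrite le_eqVlt; apply/orP; left; apply/eqP; field.
by rewrite pnatr_eq0 -lt0n.
Qed.

Lemma nsq_normalize m (Z : 'M[R]_(m, N)) (v : 'cV[R]_N) : v != 0 ->
  exists2 u, nsq u = 1 & nsq (Z *m v) = nsq v * nsq (Z *m u).
Proof.
move=> v0; have n0 : 0 < nsq v.
  by rewrite lt_neqAle nsq_ge0 andbT eq_sym; apply: contra v0 => /eqP/nsq_eq0 ->.
exists ((vnorm v)^-1 *: v).
  by rewrite nsqZ exprVn sqr_vnorm mulVf // gt_eqF.
by rewrite -scalemxAr nsqZ exprVn sqr_vnorm mulrA mulfV ?mul1r // gt_eqF.
Qed.

(** If [S] is the supremum of [vnorm (Z *m v)] over the unit ball, approximation by the net gives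
    [S <= Num.sqrt a + S / 4], whence [S ^+ 2 <= 16 / 9 * a]. That [S] is finite comes from the
    Frobenius norm. *)
Lemma net_operator_le m (Z : 'M[R]_(m, N)) (a : R) : 0 <= a ->
  (forall f, f \in net_set -> nsq (Z *m net_pt f) <= a) ->
  forall v, nsq (Z *m v) <= 16 / 9 * a * nsq v.
Proof.
move=> a0 Za.
pose E := [set vnorm (Z *m v) | v in [set v : 'cV[R]_N | nsq v <= 1]].
have E0 : E (vnorm (Z *m 0)) by exists 0 => //=; rewrite nsq0.
have Eub : ubound E (Num.sqrt (\tr (Z^T *m Z))).
  move=> _ [v /= v1 <-]; apply: ler_wsqrtr; apply: (le_trans (nsq_mulmx_le _ _)).
  by rewrite ler_piMr // mxtrace_sqr sumr_ge0 // => ? _; rewrite sumr_ge0 // => ? _; rewrite sqr_ge0.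
have Es : has_sup E by split; [exists (vnorm (Z *m 0))|exists (Num.sqrt (\tr (Z^T *m Z)))].
have key v : nsq v <= 1 -> vnorm (Z *m v) <= Num.sqrt a + 1 / 4 * sup E.
  move=> v1; have [f fJ fv] := net_cover v1.
  have -> : Z *m v = Z *m net_pt f + (1 / 4) *: (Z *m (4 *: (v - net_pt f))).
    rewrite -!scalemxAr scalerA (_ : 1 / 4 * 4 = 1) ?scale1r; last by field.
    by rewrite -mulmxDr addrC subrK.
  apply: (le_trans (vnormD _ _)); apply: lerD.
    by apply: ler_wsqrtr; exact: Za.
  have -> : vnorm ((1 / 4) *: (Z *m (4 *: (v - net_pt f)))) =
     1 / 4 * vnorm (Z *m (4 *: (v - net_pt f))).
    by rewrite /vnorm nsqZ sqrtrM ?sqr_ge0 // sqrtr_sqr ger0_norm // divr_ge0.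
  rewrite ler_wpM2l ?divr_ge0 //; apply: sup_ubound; first by case: Es.
  by exists (4 *: (v - net_pt f)) => //=; rewrite nsqZ; lra.
have Sle : sup E <= Num.sqrt a + 1 / 4 * sup E.
  by apply: ge_sup; [exists (vnorm (Z *m 0))|move=> _ [v v1 <-]; exact: key].
have unit v : nsq v = 1 -> nsq (Z *m v) <= 16 / 9 * a.
  move=> v1; have : nsq v <= 1 by rewrite v1.
  move=> /key h; rewrite -sqr_vnorm; have := vnorm_ge0 (Z *m v).
  by have := sqr_sqrtr a0; have := sqrtr_ge0 a; nra.
move=> v; have [->|v0] := eqVneq v 0; first by rewrite mulmx0 !nsq0 mulr0.
have [u u1 ->] := nsq_normalize Z v0.
by rewrite mulrC ler_wpM2r // unit.
Qed.

(** The upper constant is [16 / 9 * (5 / 4)]. For the lower one, a unit vector [u] has a net point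
    [w] of norm at least [3 / 4]. In units of [Num.sqrt c], [Z *m w] has norm at least 0.64 and
    [Z *m (u - w)] at most 0.38; the difference exceeds [1 / 4]. *)
Lemma net_operator_ge m (Z : 'M[R]_(m, N)) (c : R) : 0 <= c ->
  (forall f, f \in net_set -> nsq (Z *m net_pt f) <= 5 / 4 * (c * nsq (net_pt f))) ->
  (forall f, f \in net_set -> 3 / 4 * (c * nsq (net_pt f)) <= nsq (Z *m net_pt f)) ->
  (forall v, nsq (Z *m v) <= 20 / 9 * (c * nsq v)) /\
  (forall v, 1 / 16 * (c * nsq v) <= nsq (Z *m v)).
Proof.
move=> c0 Zle Zge.
have up v : nsq (Z *m v) <= 20 / 9 * (c * nsq v).
  have -> : 20 / 9 * (c * nsq v) = 16 / 9 * (5 / 4 * c) * nsq v by field.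
  apply: net_operator_le => [|f fJ]; first by rewrite mulr_ge0 // divr_ge0.
  apply: (le_trans (Zle f fJ)); move: fJ; rewrite inE => /andP[_ f1].
  by rewrite mulrA ler_piMr // mulr_ge0 // divr_ge0.
split => // v.
have [->|v0] := eqVneq v 0; first by rewrite mulmx0 !nsq0 !mulr0.
have [u u1 ->] := nsq_normalize Z v0.
suff low : 1 / 16 * c <= nsq (Z *m u) by rewrite mulrA mulrC ler_wpM2l.
have {}u1' : nsq u <= 1 by rewrite u1.
have [f fJ fu] := net_cover u1'.
set w := net_pt f in fu *; set r := Num.sqrt c; have rE := sqr_sqrtr c0.
have r0 : 0 <= r by exact: sqrtr_ge0.
have w_ge : 3 / 4 <= vnorm w.
  have h : vnorm u <= vnorm w + vnorm (u - w) by rewrite -{1}(subrK w u) addrC vnormD.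
  have : vnorm u = 1 by rewrite /vnorm u1 sqrtr1.
  have : vnorm (u - w) <= 1 / 4.
    have := sqr_vnorm (u - w); have := vnorm_ge0 (u - w); nra.
  by move: h; lra.
have Zw : 64 / 100 * r <= vnorm (Z *m w).
  have := Zge f fJ; rewrite -/w -!sqr_vnorm => h.
  have w2 : (3 / 4) ^+ 2 <= vnorm w ^+ 2 by rewrite ler_pXn2r ?nnegrE ?divr_ge0.
  have h2 : (64 / 100 * r) ^+ 2 <= vnorm (Z *m w) ^+ 2.
    apply: le_trans h; rewrite exprMn rE.
    have := ler_wpM2l c0 w2; lra.
  by move: h2; rewrite ler_pXn2r ?nnegrE ?mulr_ge0 ?divr_ge0.
have Ze : vnorm (Z *m (u - w)) <= 38 / 100 * r.
  have := up (u - w) => h.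
  have h2 : vnorm (Z *m (u - w)) ^+ 2 <= (38 / 100 * r) ^+ 2.
    rewrite sqr_vnorm exprMn rE; apply: (le_trans h).
    have := ler_wpM2l c0 fu; lra.
  by move: h2; rewrite ler_pXn2r ?nnegrE ?mulr_ge0 ?divr_ge0.
have Zu : 1 / 4 * r <= vnorm (Z *m u).
  have h : vnorm (Z *m w) <= vnorm (Z *m u) + vnorm (Z *m (u - w)).
    have -> : Z *m w = Z *m u + - (Z *m (u - w)) by rewrite mulmxBr opprB addrC subrK.
    by apply: (le_trans (vnormD _ _)); rewrite /vnorm nsqN.
  lra.
have h2 : (1 / 4 * r) ^+ 2 <= vnorm (Z *m u) ^+ 2 by rewrite ler_pXn2r ?nnegrE ?mulr_ge0 ?divr_ge0.
move: h2; rewrite exprMn rE sqr_vnorm; lra.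
Qed.

End BallNet.

(** * Exponential moments of a sum of squares by Gaussian averaging *)

Section GaussianDecoupling.
Context {R : realType}.
Local Notation mu := (@lebesgue_measure R).
Local Notation phi := (@normal_pdf R 0 1).

Lemma gauss_laplace (c : R) :
  (\int[mu]_x (phi x * expR (c * x))%:E = (expR (c ^+ 2 / 2))%:E)%E.
Proof.
transitivity (\int[mu]_x ((expR (c ^+ 2 / 2))%:E * (normal_pdf c 1 x)%:E))%E.
  apply: eq_integral => x _; rewrite -EFinM; congr EFin.
  rewrite !normal_pdfE ?oner_eq0 // [RHS]mulrCA -mulrA; congr (_ * _).
  by rewrite /normal_fun -!expRD; congr expR; field.
rewrite ge0_integralZl_EFin ?expR_ge0 //.
- by rewrite integral_normal_pdf mule1.
- by move=> x _; rewrite lee_fin normal_pdf_ge0.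
- by apply/measurable_EFinP; exact: measurable_normal_pdf.
Qed.

(** By convexity, [expR (b * x ^+ 2)] lies below the chord [1 + 4 * b * (expR (x ^+ 2 / 4) - 1)].
    The standard normal density times [expR (x ^+ 2 / 4)] is [Num.sqrt 2] times the normal density
    of variance 2; rounding that factor up to 2 gives the mean [1 + 4 * b]. *)
Lemma gauss_square (b : R) : 0 <= b <= 1 / 4 ->
  (\int[mu]_x (phi x * expR (b * x ^+ 2))%:E <= (expR (4 * b))%:E)%E.
Proof.
move=> /andP[b0 b4]; pose psi := @normal_pdf R 0 (Num.sqrt 2).
have s20 : Num.sqrt 2 != 0 :> R by rewrite gt_eqF // sqrtr_gt0.
have dom x : phi x * expR (b * x ^+ 2) <= (1 - 4 * b) * phi x + 4 * b * 2 * psi x.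
  have phi0 : 0 <= phi x by exact: normal_pdf_ge0.
  have c : 0 <= 4 * b <= 1 by apply/andP; split; lra.
  have x40 : 0 <= x ^+ 2 / 4 by rewrite divr_ge0 // sqr_ge0.
  have := expR_chord c x40.
  have -> : 4 * b * (x ^+ 2 / 4) = b * x ^+ 2 by field.
  move=> ch; have e : phi x * expR (x ^+ 2 / 4) <= 2 * psi x.
    rewrite /psi !normal_pdfE ?oner_eq0 // -mulrA.
    have -> : normal_fun 0 1 x * expR (x ^+ 2 / 4) = normal_fun 0 (Num.sqrt 2) x.
      rewrite /normal_fun -expRD; congr expR; rewrite sqr_sqrtr //; by field.
    rewrite mulrA ler_pM2r ?expR_gt0 // /normal_peak sqr_sqrtr //.
    have pi0 := pi_gt0 R.
    rewrite ler_pdivlMr ?sqrtr_gt0 ?mulrn_wgt0 ?mulr_gt0 //.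
    rewrite ler_pdivrMl ?sqrtr_gt0 ?mulrn_wgt0 ?mulr_gt0 ?expr1n //.
    rewrite [X in _ <= _ * X](_ : 2 = Num.sqrt 4); last first.
      by rewrite (_ : 4 = 2 ^+ 2) ?sqrtr_sqr ?ger0_norm // -natrX.
    rewrite -sqrtrM ?mulrn_wge0 ?mulr_ge0 ?(ltW pi0) //; apply: ler_wsqrtr.
    by rewrite mul1r !mulr2n; lra.
  have := ler_wpM2l phi0 ch; have := ler_wpM2l b0 e; lra.
have mphi := @measurable_normal_pdf R 0 1.
have mpsi := @measurable_normal_pdf R 0 (Num.sqrt 2).
apply: (@le_trans _ _ (\int[mu]_x (((1 - 4 * b) * phi x)%:E + (4 * b * 2 * psi x)%:E))%E).
  apply: ge0_le_integral => //.
  - by move=> x _; rewrite lee_fin mulr_ge0 ?expR_ge0 ?normal_pdf_ge0.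
  - apply/measurable_EFinP; apply: measurable_funM => //.
    by apply: measurableT_comp => //; apply: measurable_funM => //; exact: measurable_funX.
  - by apply: emeasurable_funD; apply/measurable_EFinP; apply: measurable_funM.
  - by move=> x _; rewrite -EFinD lee_fin.
rewrite ge0_integralD //; last 4 first.
- by move=> x _; rewrite lee_fin mulr_ge0 ?normal_pdf_ge0 //; lra.
- by apply/measurable_EFinP; apply: measurable_funM.
- by move=> x _; rewrite lee_fin !mulr_ge0 ?normal_pdf_ge0.
- by apply/measurable_EFinP; apply: measurable_funM.
have I (k s : R) : 0 <= k -> (\int[mu]_x (k * normal_pdf 0 s x)%:E = k%:E)%E.
  move=> k0; under eq_integral => x _ do rewrite EFinM.
  rewrite ge0_integralZl_EFin //.
  - by rewrite integral_normal_pdf mule1.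
  - by move=> x _; rewrite lee_fin normal_pdf_ge0.
  - by apply/measurable_EFinP; exact: measurable_normal_pdf.
rewrite !I; [|by rewrite !mulr_ge0|by lra].
rewrite -EFinD lee_fin; apply: le_trans (expR_ge1Dx _); lra.
Qed.

Variables (d : measure_display) (T : measurableType d) (P : probability T R).
Variables (q : nat) (V : 'I_q -> T -> R) (lam : 'I_q -> R) (L a : R).
Hypothesis mV : forall j, measurable_fun setT (V j).
Hypothesis L_ge0 : 0 <= L.
Hypothesis lam_ge0 : forall j, 0 <= lam j.
Hypothesis a_ge0 : 0 <= a.
Hypothesis laplace : forall h : 'I_q -> R,
  (\int[P]_w (expR (\sum_j h j * V j w))%:E <= (expR (L * \sum_j lam j * h j ^+ 2))%:E)%E.
Hypothesis a_small : forall j, 2 * a * L * lam j <= 1 / 4.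

Let mlin (h : 'I_q -> R) : measurable_fun setT (fun w => \sum_j h j * V j w).
Proof. by apply: measurable_sum => j; apply: measurable_funM. Qed.

Let msq k : measurable_fun setT (fun w => \sum_(j < q | (j < k)%N) V j w ^+ 2).
Proof.
under eq_fun do rewrite big_mkcond; apply: measurable_sum => j.
by case: (j < k)%N => //; exact: measurable_funX.
Qed.

(* Squares are linearised one coordinate at a time: [expR (a * V ^ 2)] is the
   Gaussian average of [expR (sqrt (2 a) * g * V)], which only shifts [h j]. *)
Lemma gaussian_decoupling_step k (h : 'I_q -> R) : (k <= q)%N ->
  (forall j : 'I_q, (j < k)%N -> h j = 0) ->
  (\int[P]_w (expR (a * \sum_(j < q | (j < k)%N) V j w ^+ 2 + \sum_j h j * V j w))%:E <=
   (expR (8 * a * L * \sum_(j < q | (j < k)%N) lam j + L * \sum_j lam j * h j ^+ 2))%:E)%E.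
Proof.
elim: k h => [|k IHk] h kq h0.
  rewrite big_pred0 // mulr0 add0r; apply: le_trans (laplace h).
  by under eq_integral => w _ do rewrite big_pred0 // mulr0 add0r.
pose j0 : 'I_q := Ordinal kq; pose c := Num.sqrt (2 * a).
have c2 : c ^+ 2 = 2 * a by rewrite sqr_sqrtr // mulr_ge0.
have split (f : 'I_q -> R) : \sum_(j < q | (j < k.+1)%N) f j =
    f j0 + \sum_(j < q | (j < k)%N) f j.
  rewrite (bigD1 j0) //=; congr (_ + _); apply: eq_bigl => j.
  by rewrite ltnS ltn_neqAle andbC.
pose S w := \sum_(j < q | (j < k)%N) V j w ^+ 2.
pose hg (g : R) (j : 'I_q) := h j + (if j == j0 then c * g else 0).
have hgV g w : \sum_j hg g j * V j w = \sum_j h j * V j w + c * g * V j0 w.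
  under eq_bigr do rewrite mulrDl; rewrite big_split /=; congr (_ + _).
  by rewrite (bigD1 j0) //= eqxx big1 ?addr0 // => j /negPf ->; rewrite mul0r.
(* No cross term appears because [h] vanishes at [j0]. The new term is later averaged by
   [gauss_square] with [b = 2 * a * L * lam j0], at the cost [expR (4 * b)]: this is the
   [8 * a * L * lam j0] of the bound. *)
have hgq g : \sum_j lam j * hg g j ^+ 2 =
    \sum_j lam j * h j ^+ 2 + lam j0 * (2 * a * g ^+ 2).
  rewrite (bigD1 j0) //= [in RHS](bigD1 j0) //= /hg eqxx h0 ?ltnSn // add0r.
  rewrite expr0n mulr0 add0r exprMn c2 addrC; congr (_ + _).
  by apply: eq_bigr => j /negPf ->; rewrite addr0.
pose F (z : T * R) := phi z.2 * expR (a * S z.1 + \sum_j hg z.2 j * V j z.1).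
have F0 z : 0 <= F z by rewrite mulr_ge0 ?expR_ge0 ?normal_pdf_ge0.
have mF : measurable_fun setT F.
  apply: measurable_funM.
    exact: (measurableT_comp (@measurable_normal_pdf R 0 1) measurable_snd).
  apply: measurableT_comp => //; apply: measurable_funD.
    apply: measurable_funM => //; exact: (measurableT_comp (msq k) measurable_fst).
  apply: measurable_sum => j; apply: measurable_funM.
    apply: measurable_funD => //; case: (j == j0) => //.
    by apply: measurable_funM.
  exact: (measurableT_comp (mV j) measurable_fst).
have lhsE w : (expR (a * \sum_(j < q | (j < k.+1)%N) V j w ^+ 2 + \sum_j h j * V j w))%:E =
    (\int[mu]_g (F (w, g))%:E)%E.
  transitivity ((expR (a * S w + \sum_j h j * V j w))%:E *
      \int[mu]_g (phi g * expR (c * V j0 w * g))%:E)%E.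
    rewrite gauss_laplace -EFinM -expRD; congr (expR _)%:E.
    by rewrite split -/(S w) exprMn c2; field.
  rewrite -ge0_integralZl_EFin ?expR_ge0 //; last 2 first.
  - by move=> g _; rewrite lee_fin mulr_ge0 ?expR_ge0 ?normal_pdf_ge0.
  - apply/measurable_EFinP; apply: measurable_funM; first exact: measurable_normal_pdf.
    by apply: measurableT_comp => //; apply: measurable_funM.
  apply: eq_integral => g _; rewrite -EFinM /F /= hgV; congr EFin.
  by rewrite mulrCA -expRD; congr (_ * expR _); ring.
under eq_integral => w _ do rewrite lhsE.
rewrite (fubini_tonelli (m1 := P) (m2 := mu) (fun z => (F z)%:E)); last 2 first.
- exact/measurable_EFinP.
- by move=> z; rewrite lee_fin.
set A := \sum_(j < q | (j < k.+1)%N) lam j; set Ak := \sum_(j < q | (j < k)%N) lam j.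
set Q := \sum_j lam j * h j ^+ 2; set b := 2 * a * L * lam j0.
have b0 : 0 <= b by rewrite !mulr_ge0.
apply: (@le_trans _ _ (\int[mu]_g ((expR (8 * a * L * Ak + L * Q))%:E *
    (phi g * expR (b * g ^+ 2))%:E))%E).
  apply: ge0_le_integral => //.
  - by move=> g _; apply: integral_ge0 => w _; rewrite lee_fin.
  - have mEF : measurable_fun setT (EFin \o F) by exact/measurable_EFinP.
    apply: (measurable_fun_fubini_tonelli_G (m1 := P) (EFin \o F)) => //.
  - apply: emeasurable_funM => //; apply/measurable_EFinP.
    apply: measurable_funM; first exact: measurable_normal_pdf.
    by apply: measurableT_comp => //; apply: measurable_funM => //; exact: measurable_funX.
  move=> g _; under eq_integral => w _ do rewrite /F /= EFinM.
  rewrite ge0_integralZl_EFin ?normal_pdf_ge0 //; last first.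
    apply/measurable_EFinP; apply: measurableT_comp => //; apply: measurable_funD => //.
    by apply: measurable_funM => //; exact: msq.
  rewrite EFinM muleCA; apply: lee_wpmul2l; first by rewrite lee_fin normal_pdf_ge0.
  apply: le_trans (IHk (hg g) (ltnW kq) _) _.
    move=> j jk; rewrite /hg h0 ?(ltn_trans jk) ?ltnSn // add0r.
    by case: eqP jk => // ->; rewrite ltnn.
  rewrite hgq -EFinM -expRD lee_fin ler_expR -/Ak -/Q /b.
  rewrite le_eqVlt; apply/orP; left; apply/eqP; ring.
rewrite ge0_integralZl_EFin ?expR_ge0 //; last 2 first.
- by move=> g _; rewrite lee_fin mulr_ge0 ?expR_ge0 ?normal_pdf_ge0.
- apply/measurable_EFinP; apply: measurable_funM; first exact: measurable_normal_pdf.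
  by apply: measurableT_comp => //; apply: measurable_funM => //; exact: measurable_funX.
apply: (@le_trans _ _ ((expR (8 * a * L * Ak + L * Q))%:E * (expR (4 * b))%:E)%E).
  apply: lee_wpmul2l; first by rewrite lee_fin expR_ge0.
  by apply: gauss_square; rewrite b0 /b a_small.
rewrite -EFinM -expRD lee_fin ler_expR /A split -/Ak /b.
by rewrite le_eqVlt; apply/orP; left; apply/eqP; ring.
Qed.

Lemma gaussian_decoupling :
  (\int[P]_w (expR (a * \sum_j V j w ^+ 2))%:E <= (expR (8 * a * L * \sum_j lam j))%:E)%E.
Proof.
have all (f : 'I_q -> R) : \sum_(j < q | (j < q)%N) f j = \sum_j f j.
  by apply: eq_bigl => j; rewrite ltn_ord.
have -> : (\int[P]_w (expR (a * \sum_j V j w ^+ 2))%:E =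
    \int[P]_w (expR (a * \sum_(j < q | (j < q)%N) V j w ^+ 2
                    + \sum_j (fun=> 0) j * V j w))%:E)%E.
  apply: eq_integral => w _; rewrite all [X in _ + X]big1 ?addr0 // => j _.
  by rewrite mul0r.
apply: (le_trans (gaussian_decoupling_step (leqnn q) (fun _ _ => erefl))).
rewrite all [X in L * X]big1 ?mulr0 ?addr0 // => j _.
by rewrite expr0n mulr0.
Qed.

End GaussianDecoupling.

(** * Union bounds *)

Section UnionBound.
Context {R : realType} {d : measure_display} {T : measurableType d}.
Variable P : probability T R.

Lemma hasE_indic (A : set T) : measurable A -> hasE P \1_A (fine (P A)).
Proof.
move=> mA; apply: ge0_hasE => //.
by rewrite integral_indic // setIT fineK // fin_num_measure.
Qed.

Lemma union2_bound (A B : set T) (a b : R) : measurable A -> measurable B ->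
  (P A <= a%:E)%E -> (P B <= b%:E)%E -> (P (A `|` B) <= (a + b)%:E)%E.
Proof.
move=> mA mB Aa Bb; apply: (@le_trans _ _ (fine (P A) + fine (P B))%:E).
  apply: (markov_hasE _ _ _ (hasE_add (hasE_indic mA) (hasE_indic mB))).
  - exact: measurableU.
  - by move=> w; rewrite addr_ge0 // indicE.
  by move=> w [Aw|Bw]; rewrite !indicE;
    [rewrite (mem_set Aw) lerDl|rewrite (mem_set Bw) lerDr].
by rewrite lee_fin lerD // -lee_fin fineK ?fin_num_measure.
Qed.

Lemma finite_union_bound (I : finType) (J : {set I}) (F : I -> set T) (e : R) :
  (forall i, measurable (F i)) -> (forall i, i \in J -> (P (F i) <= e%:E)%E) ->
  measurable [set w | exists2 i, i \in J & F i w] /\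
  (P [set w | exists2 i, i \in J & F i w] <= (#|J|%:R * e)%:E)%E.
Proof.
move=> mF Fe.
have mU : measurable [set w | exists2 i, i \in J & F i w].
  rewrite (_ : mkset _ = \bigcup_(i in [set` J]) F i) //.
  exact: fin_bigcup_measurable.
split=> //; apply: (@le_trans _ _ (\sum_(i in J) fine (P (F i)))%:E).
  have h : hasE P (fun w => \sum_(i in J) \1_(F i) w) (\sum_(i in J) fine (P (F i))).
    rewrite -big_enum; apply: hasE_eq (hasE_sum (enum J) (fun i => hasE_indic (mF i))) => w.
    by rewrite big_enum.
  apply: (markov_hasE mU _ _ h) => [w|w [i iJ Fw]]; first by rewrite sumr_ge0 // => i _; rewrite indicE.
  by rewrite (bigD1 i) //= indicE (mem_set Fw) lerDl sumr_ge0 // => j _; rewrite indicE.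
rewrite lee_fin mulr_natl -sumr_const; apply: ler_sum => i iJ.
by rewrite -lee_fin fineK ?fin_num_measure // Fe.
Qed.

End UnionBound.

Lemma conc_denominator_gt0 (R : realType) (x : R) : 1 <= x -> 0 < 512 * 64 * x ^+ 4.
Proof.
move=> x1; have x4 : 1 <= x ^+ 4 by exact: exprn_ege1.
apply: mulr_gt0; last exact: lt_le_trans ltr01 x4.
by apply: mulr_gt0; rewrite ltr0n.
Qed.

(** * The event on which head and tail of the design are well behaved *)

Section GoodEvent.
Context {R : realType} {sigma_x : R} {n : nat}.
Variable M : ridge_model sigma_x n.
Local Notation P := (Pr M).
Local Notation p := (dimp M).
Local Notation d := (dimd M).
Local Notation q := (p - d)%N.
Local Notation hd := (@head_idx R sigma_x n M).
Local Notation tl := (@tail_idx R sigma_x n M).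

Definition design_head (w : Om M) : 'M[R]_(n, d) := \matrix_(i, j) tnth (xs M i w) (hd j).
Definition design_tail (w : Om M) : 'M[R]_(n, q) := \matrix_(i, j) tnth (xs M i w) (tl j).

Lemma sum_head_tail (F : 'I_p -> R) : \sum_j F j = \sum_j F (hd j) + \sum_j F (tl j).
Proof.
have e := subnKC (ltnW (dimd_ltp M)).
rewrite (reindex (cast_ord e)) /=; last first.
  by exists (cast_ord (esym e)) => j _; apply: val_inj.
rewrite big_split_ord /=; congr (_ + _); apply: eq_bigr => j _; congr F.
  exact: val_inj.
exact: val_inj.
Qed.

(** Padding by [0] on one side turns the concentration of linear forms of the whole [x_i] into
    statements on the head or on the tail alone. *)
Definition ext (vh : 'cV[R]_d) (vt : 'cV[R]_q) : 'cV[R]_p :=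
  \col_j match fintype.split (cast_ord (esym (subnKC (ltnW (dimd_ltp M)))) j) with
         | inl i => vh i 0 | inr i => vt i 0 end.

Lemma ext_head vh vt j : ext vh vt (hd j) 0 = vh j 0.
Proof.
rewrite mxE (_ : cast_ord _ _ = lshift _ j); last exact: val_inj.
by rewrite -[lshift _ j]/(unsplit (inl j)) unsplitK.
Qed.

Lemma ext_tail vh vt j : ext vh vt (tl j) 0 = vt j 0.
Proof.
rewrite mxE (_ : cast_ord _ _ = rshift _ j); last exact: val_inj.
by rewrite -[rshift _ j]/(unsplit (inr j)) unsplitK.
Qed.

Lemma lin_ext vh vt i w :
  lin (ext vh vt) (xs M i w) = (design_head w *m vh) i 0 + (design_tail w *m vt) i 0.
Proof.
rewrite [LHS]sum_head_tail; congr (_ + _); rewrite mxE; apply: eq_bigr => j _;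
by rewrite (ext_head, ext_tail) mulrC; congr (_ * _); rewrite mxE.
Qed.

Lemma qf_ext vh vt : qf (ext vh vt) =
  \sum_j lambda M 0 (hd j) * vh j 0 ^+ 2 + \sum_j lambda M 0 (tl j) * vt j 0 ^+ 2.
Proof.
by rewrite /qf sum_head_tail; congr (_ + _); apply: eq_bigr => j _;
  rewrite ?ext_head ?ext_tail.
Qed.

Lemma design_gram_split w : design w *m (design w)^T =
  design_head w *m (design_head w)^T + design_tail w *m (design_tail w)^T.
Proof.
apply/matrixP => i k; rewrite [LHS]mxE sum_head_tail [RHS]mxE.
by congr (_ + _); rewrite mxE; apply: eq_bigr => j _; rewrite !mxE.
Qed.

Lemma signal_split w :
  signal w = design_head w *m theta_head M + design_tail w *m theta_tail M.
Proof.
apply/matrixP => i k; rewrite ord1 [LHS]mxE sum_head_tail [RHS]mxE.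
by congr (_ + _); rewrite mxE; apply: eq_bigr => j _; rewrite !mxE.
Qed.

Lemma lambda_d1_gt0 : 0 < lambda_d1 M. Proof. exact: lambda_gt0. Qed.

Lemma lambda_tl_le j : lambda M 0 (tl j) <= lambda_d1 M.
Proof. by apply: lambda_noninc; rewrite /= leq_addr. Qed.

Lemma tail_sum_gt0 : 0 < tail_sum M.
Proof.
have q0 : (0 < q)%N by rewrite subn_gt0 dimd_ltp.
rewrite /tail_sum (bigD1 (Ordinal q0)) //= ltr_pwDl ?lambda_gt0 //.
by apply: sumr_ge0 => j _; rewrite ltW // lambda_gt0.
Qed.

Lemma mmx_design_head : mmx design_head.
Proof. by move=> i j; under eq_fun do rewrite mxE; exact: measurable_x. Qed.

Lemma mmx_design_tail : mmx design_tail.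
Proof. by move=> i j; under eq_fun do rewrite mxE; exact: measurable_x. Qed.

Hypothesis n_gt0 : (0 < n)%N.
Local Notation ce := (@conc_exponent R sigma_x n).

Lemma conc_exponent_bounds : 0 <= ce /\ ce <= n%:R.
Proof.
have s1 := sigma_x_ge1 M n_gt0.
have s4 : 1 <= sigma_x ^+ 4 by exact: exprn_ege1.
have s40 := conc_denominator_gt0 s1.
rewrite /conc_exponent; split; first by rewrite divr_ge0 ?(ltW s40).
rewrite (ler_pdivrMr _ _ s40).
have n0 : 0 <= n%:R :> R by [].
have : n%:R * 1 <= n%:R * sigma_x ^+ 4 by rewrite ler_wpM2l.
lra.
Qed.

Lemma nsq_lin_ext vh vt w : \sum_i lin (ext vh vt) (xs M i w) ^+ 2 =
  nsq (design_head w *m vh + design_tail w *m vt).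
Proof. by rewrite nsqE; apply: eq_bigr => i _; rewrite lin_ext; congr (_ ^+ 2); rewrite [RHS]mxE. Qed.

Lemma ext0r_qf vh : qf (ext vh 0) = \sum_j lambda M 0 (hd j) * vh j 0 ^+ 2.
Proof. by rewrite qf_ext [X in _ + X]big1 ?addr0 // => j _; rewrite mxE expr0n mulr0. Qed.

Lemma ext0l_qf vt : qf (ext 0 vt) = \sum_j lambda M 0 (tl j) * vt j 0 ^+ 2.
Proof. by rewrite qf_ext big1 ?add0r // => j _; rewrite mxE expr0n mulr0. Qed.

Definition head_scale (v : 'cV[R]_d) : 'cV[R]_d :=
  \col_j (v j 0 / Num.sqrt (lambda M 0 (hd j))).

Lemma head_scale_qf v : \sum_j lambda M 0 (hd j) * head_scale v j 0 ^+ 2 = nsq v.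
Proof.
rewrite nsqE; apply: eq_bigr => j _; have l0 := lambda_gt0 (hd j).
by rewrite mxE expr_div_n sqr_sqrtr ?ltW // mulrCA mulfV ?mulr1 // gt_eqF.
Qed.

(** The whitened head, so that the net of the Euclidean ball can be used whatever the leading
    eigenvalues are. *)
Definition design_head_std w : 'M[R]_(n, d) :=
  design_head w *m diag_mx (\row_j (Num.sqrt (lambda M 0 (hd j)))^-1).

Lemma design_head_stdE w v : design_head_std w *m v = design_head w *m head_scale v.
Proof.
rewrite -mulmxA; congr (_ *m _); apply/matrixP => j k.
by rewrite ord1 mul_diag_mx !mxE mulrC.
Qed.

Let mnsqh v : measurable_fun setT (fun w => nsq (design_head w *m v)).
Proof. by apply: measurable_nsq; apply: mmx_mul; [exact: mmx_design_head|exact: mmx_cst]. Qed.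
Let mnsqt v : measurable_fun setT (fun w => nsq (design_tail w *m v)).
Proof. by apply: measurable_nsq; apply: mmx_mul; [exact: mmx_design_tail|exact: mmx_cst]. Qed.
Let mnsqtt v : measurable_fun setT (fun w => nsq ((design_tail w)^T *m v)).
Proof.
apply: measurable_nsq; apply: mmx_mul; last exact: mmx_cst.
exact/mmx_tr/mmx_design_tail.
Qed.

Definition head_bad : set (Om M) :=
  [set w | exists2 f, f \in @net_set R d &
    5 / 4 * (n%:R * nsq (net_pt f)) < nsq (design_head_std w *m net_pt f)] `|`
  [set w | exists2 f, f \in @net_set R d &
    nsq (design_head_std w *m net_pt f) < 3 / 4 * (n%:R * nsq (net_pt f))].

Lemma head_bad_bound : measurable head_bad /\
  (P head_bad <= (2 * expR (18 * d%:R - ce))%:E)%E.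
Proof.
have d0 := dimd_gt0 M.
have E w f : nsq (design_head_std w *m net_pt f) =
    \sum_i lin (ext (head_scale (net_pt f)) 0) (xs M i w) ^+ 2.
  by rewrite nsq_lin_ext mulmx0 addr0 design_head_stdE.
have qE (f : {ffun 'I_d -> 'I_(4 * d).+1 * bool}) :
    qf (ext (head_scale (net_pt f)) 0) = nsq (net_pt f : 'cV[R]_d).
  by rewrite ext0r_qf head_scale_qf.
have mE f : measurable_fun setT (fun w => nsq (design_head_std w *m net_pt f)).
  under eq_fun do rewrite design_head_stdE; exact: mnsqh.
have mF1 f : measurable [set w | 5 / 4 * (n%:R * nsq (net_pt f)) < nsq (design_head_std w *m net_pt f)].
  by have [] := measurable_set_cmp (5 / 4 * (n%:R * nsq (net_pt f))) (mE f).
have mF2 f : measurable [set w | nsq (design_head_std w *m net_pt f) < 3 / 4 * (n%:R * nsq (net_pt f))].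
  by have [] := measurable_set_cmp (3 / 4 * (n%:R * nsq (net_pt f))) (mE f).
have pF (f : {ffun 'I_d -> 'I_(4 * d).+1 * bool}) :
    (P [set w | (5 / 4 * (n%:R * nsq (net_pt f)) < nsq (design_head_std w *m net_pt f))%R]
      <= (expR (- ce))%:E)%E /\
    (P [set w | (nsq (design_head_std w *m net_pt f) < 3 / 4 * (n%:R * nsq (net_pt f)))%R]
      <= (expR (- ce))%:E)%E.
  have [h1 h2] := lin_sqr_concentration n_gt0 (ext (head_scale (net_pt f)) 0).
  move: h1 h2; rewrite qE => h1 h2.
  split; [move: h1|move: h2]; congr (P _ <= _)%E; apply/seteqP; split => w /=; by rewrite E.
have [m1 p1] := finite_union_bound mF1 (fun f (_ : f \in @net_set R d) => (pF f).1).
have [m2 p2] := finite_union_bound mF2 (fun f (_ : f \in @net_set R d) => (pF f).2).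
split; first exact: measurableU.
have := union2_bound m1 m2 p1 p2; move=> /le_trans; apply; rewrite lee_fin.
have c := @net_card R d; rewrite -mulr2n -[leLHS]mulr_natl.
by rewrite ler_wpM2l // expRD ler_wpM2r // expR_ge0.
Qed.

(** The exponential moment is taken at [a = 1 / (128 * sigma_x ^+ 2 * lambda_d1)], where this
    threshold contributes [21 * eff_rank] to the exponent. The moment itself uses up one [eff_rank],
    and the remaining 20 outweigh the 18 of the net. *)
Definition tail_const : R := 128 * 21 * sigma_x ^+ 2.

Definition tail_bad : set (Om M) :=
  [set w | exists2 f, f \in @net_set R n &
    tail_const * tail_sum M <= nsq ((design_tail w)^T *m net_pt f)].

Lemma tail_norm_bound (u : 'cV[R]_n) : nsq u <= 1 ->
  (P [set w | (tail_const * tail_sum M <= nsq ((design_tail w)^T *m u))%R] <=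
   (expR (- (20 * eff_rank M)))%:E)%E.
Proof.
move=> u1; have s1 := sigma_x_ge1 M n_gt0; have l0 := lambda_d1_gt0.
have s20 : 0 < sigma_x ^+ 2 by rewrite exprn_gt0 // (lt_le_trans ltr01).
pose L := 8 * (2 * sigma_x ^+ 2); have L0 : 0 < L by rewrite /L; lra.
(* The largest value allowed by [small], with equality for the top tail eigenvalue. *)
pose a := (8 * L * lambda_d1 M)^-1.
have a0 : 0 < a by rewrite invr_gt0 mulr_gt0 // mulr_gt0.
pose V (j : 'I_q) w := ((design_tail w)^T *m u) j 0.
have mV j : measurable_fun setT (V j).
  by apply: mmx_mul; [exact/mmx_tr/mmx_design_tail|exact: mmx_cst].
have lapl (h : 'I_q -> R) : (\int[P]_w (expR (\sum_j h j * V j w))%:E <=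
    (expR (L * \sum_j lambda M 0 (tl j) * h j ^+ 2))%:E)%E.
  pose hv : 'cV[R]_q := \col_j h j.
  have [m [_ hm] mle] := comb_laplace n_gt0 u (ext 0 hv).
  have e w : \sum_j h j * V j w = \sum_i u i 0 * lin (ext 0 hv) (xs M i w).
    transitivity (dotv hv ((design_tail w)^T *m u)).
      by apply: eq_bigr => j _; rewrite mxE.
    rewrite dotvC dotv_mulmx trmxK; apply: eq_bigr => i _.
    by rewrite lin_ext mulmx0 [X in X + _]mxE add0r.
  under eq_integral => w _ do rewrite e.
  rewrite hm lee_fin (le_trans mle) // ler_expR ext0l_qf /L.
  have -> : \sum_j lambda M 0 (tl j) * hv j 0 ^+ 2 = \sum_j lambda M 0 (tl j) * h j ^+ 2.
    by apply: eq_bigr => j _; rewrite mxE.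
  apply: ler_wpM2l; first exact: ltW.
  apply: ler_piMl => //.
  by apply: sumr_ge0 => j _; rewrite mulr_ge0 ?sqr_ge0 // ltW // lambda_gt0.
have small j : 2 * a * L * lambda M 0 (tl j) <= 1 / 4.
  have lj := lambda_tl_le j.
  have -> : 1 / 4 = 2 * a * L * lambda_d1 M.
    by rewrite /a; field; rewrite !gt_eqF.
  by apply: ler_wpM2l => //; rewrite !(pmulr_lge0 _ L0, pmulr_lge0 _ a0).
have G := gaussian_decoupling mV (ltW L0) (fun j => ltW (lambda_gt0 (tl j))) (ltW a0) lapl small.
have VE w : \sum_j V j w ^+ 2 = nsq ((design_tail w)^T *m u) by rewrite nsqE.
have mexp : measurable_fun setT (fun w => expR (a * \sum_j V j w ^+ 2)).
  apply: measurableT_comp => //; apply: measurable_funM => //.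
  by under eq_fun do rewrite VE; exact: mnsqtt.
have fin : (\int[P]_w (expR (a * \sum_j V j w ^+ 2))%:E)%E \is a fin_num.
  rewrite ge0_fin_numE ?(le_lt_trans G) ?ltry //.
  by apply: integral_ge0 => w _; rewrite lee_fin expR_ge0.
have hE : hasE P (fun w => expR (a * \sum_j V j w ^+ 2))
    (fine (\int[P]_w (expR (a * \sum_j V j w ^+ 2))%:E)%E).
  by apply: ge0_hasE; rewrite ?fineK // => w; exact: expR_ge0.
set c := a * (tail_const * tail_sum M).
have := markov_hasE (f := fun w => expR (- c) * expR (a * \sum_j V j w ^+ 2)) _ _ _
  (hasE_scale (expR (- c)) hE).
move=> /(_ [set w | (tail_const * tail_sum M <= nsq ((design_tail w)^T *m u))%R] _ _ _)/le_trans; apply.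
- by have [] := measurable_set_cmp (tail_const * tail_sum M) (mnsqtt u).
- by move=> w; rewrite mulr_ge0 ?expR_ge0.
- move=> w /= ge; rewrite -expRD -[leLHS]expR0 ler_expR addrC subr_ge0 VE.
  by rewrite ler_wpM2l // ltW.
rewrite lee_fin.
apply: (@le_trans _ _ (expR (- c) * expR (8 * a * L * tail_sum M))).
  by rewrite ler_pM2l ?expR_gt0 // -lee_fin fineK.
rewrite -expRD ler_expR /c /a /L /tail_const /eff_rank le_eqVlt; apply/orP; left; apply/eqP.
by field; rewrite gt_eqF //= gt_eqF // (lt_le_trans ltr01).
Qed.

Lemma tail_bad_bound : measurable tail_bad /\
  (P tail_bad <= (expR (18 * n%:R - 20 * eff_rank M))%:E)%E.
Proof.
have mF (f : {ffun 'I_n -> 'I_(4 * n).+1 * bool}) : measurable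
  [set w | tail_const * tail_sum M <= nsq ((design_tail w)^T *m (net_pt f : 'cV[R]_n))].
  by have [] := measurable_set_cmp (tail_const * tail_sum M) (mnsqtt (net_pt f)).
have pF (f : {ffun 'I_n -> 'I_(4 * n).+1 * bool}) : f \in @net_set R n -> (P
  [set w | (tail_const * tail_sum M <= nsq ((design_tail w)^T *m (net_pt f : 'cV[R]_n)))%R]
    <= (expR (- (20 * eff_rank M)))%:E)%E.
  by rewrite inE => /andP[_ f1]; exact: tail_norm_bound.
have [m1 p1] := finite_union_bound mF pF.
split=> //; apply: (le_trans p1); rewrite lee_fin expRD ler_wpM2r ?expR_ge0 //.
exact: net_card.
Qed.

Definition trace_bad : set (Om M) :=
  [set w | \tr (design_tail w *m (design_tail w)^T) < 3 / 4 * (n%:R * tail_sum M)].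

Lemma trace_bad_bound : measurable trace_bad /\ (P trace_bad <= (expR (- ce))%:E)%E.
Proof.
have s0 := tail_sum_gt0.
(* With equal weights on the tail, the weighted sum of squares is the trace divided by
   [tail_sum]. *)
pose a j : R := ext 0 (const_mx (tail_sum M)^-1) j 0.
have a0 j : 0 <= a j.
  rewrite /a mxE; case: fintype.split => i; rewrite mxE //.
  by rewrite invr_ge0 ltW.
have a1 : \sum_j a j * lambda M 0 j = 1.
  rewrite sum_head_tail big1 ?add0r => [|j _]; last by rewrite /a ext_head mxE mul0r.
  under eq_bigr do rewrite /a ext_tail mxE.
  by rewrite -mulr_sumr mulVf // gt_eqF.
have E w : \sum_i \sum_j a j * tnth (xs M i w) j ^+ 2 =
    (tail_sum M)^-1 * \tr (design_tail w *m (design_tail w)^T).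
  rewrite mulr_sumr; apply: eq_bigr => i _.
  rewrite sum_head_tail big1 ?add0r => [|j _]; last by rewrite /a ext_head mxE mul0r.
  rewrite mxE mulr_sumr; apply: eq_bigr => j _.
  by rewrite /a ext_tail !mxE expr2.
have setE : trace_bad = [set w | \sum_i \sum_j a j * tnth (xs M i w) j ^+ 2 < 3 / 4 * n%:R].
  apply/seteqP; split => w; by rewrite /trace_bad /= E [_^-1 * _]mulrC ltr_pdivrMr // mulrA.
split; last by rewrite setE; exact: weighted_sqr_concentration.
rewrite /trace_bad; have mt : measurable_fun setT (fun w => \tr (design_tail w *m (design_tail w)^T)).
  apply: measurable_trace; apply: mmx_mul; first exact: mmx_design_tail.
  exact/mmx_tr/mmx_design_tail.
by have [] := measurable_set_cmp (3 / 4 * (n%:R * tail_sum M)) mt.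
Qed.

Definition signal_bad : set (Om M) :=
  [set w | 5 / 4 * (n%:R * \sum_j lambda M 0 (tl j) * theta_tail M j 0 ^+ 2) <
           nsq (design_tail w *m theta_tail M)].

Lemma signal_bad_bound : measurable signal_bad /\ (P signal_bad <= (expR (- ce))%:E)%E.
Proof.
split.
  by have [] := measurable_set_cmp
    (5 / 4 * (n%:R * \sum_j lambda M 0 (tl j) * theta_tail M j 0 ^+ 2)) (mnsqt (theta_tail M)).
have [h _] := lin_sqr_concentration n_gt0 (ext 0 (theta_tail M)).
move: h; rewrite ext0l_qf; congr (P _ <= _)%E; apply/seteqP; split => w /=;
by rewrite nsq_lin_ext mulmx0 add0r.
Qed.

Definition good_event : set (Om M) :=
  ~` (head_bad `|` (tail_bad `|` (trace_bad `|` signal_bad))).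

Lemma measurable_good_event : measurable good_event.
Proof.
have [[h _] [t _]] := (head_bad_bound, tail_bad_bound).
have [[r _] [s _]] := (trace_bad_bound, signal_bad_bound).
by apply: measurableC; do 3!(apply: measurableU => //).
Qed.

(** The second hypothesis spends half of [ce] on the head net. The first makes the tail exponent at
    most [- 2 * n], which is below [- ce / 2] since [ce <= n]. The head counts twice, for its two
    deviations, hence the factor 5. *)
Lemma good_event_bound : n%:R <= eff_rank M -> 36 * d%:R <= ce ->
  (P (~` good_event) <= (5 * expR (- (ce / 2)))%:E)%E.
Proof.
move=> nr dc; have [c0 cn] := conc_exponent_bounds.
have [[mh ph] [mt pt]] := (head_bad_bound, tail_bad_bound).
have [[mr pr] [ms ps]] := (trace_bad_bound, signal_bad_bound).
rewrite /good_event setCK.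
have mrs := measurableU _ _ mr ms; have mtrs := measurableU _ _ mt mrs.
have := union2_bound mh mtrs ph (union2_bound mt mrs pt (union2_bound mr ms pr ps)).
move=> /le_trans; apply; rewrite lee_fin.
have e1 : expR (18 * d%:R - ce) <= expR (- (ce / 2)) by rewrite ler_expR; lra.
have e2 : expR (18 * n%:R - 20 * eff_rank M) <= expR (- (ce / 2)) by rewrite ler_expR; lra.
have e3 : expR (- ce) <= expR (- (ce / 2)) by rewrite ler_expR; lra.
lra.
Qed.

Lemma good_eventP w : good_event w ->
  [/\ forall u, nsq ((design_tail w)^T *m u) <= 16 / 9 * (tail_const * tail_sum M) * nsq u,
      forall u : 'cV[R]_d, n%:R / 16 * \sum_j lambda M 0 (hd j) * u j 0 ^+ 2 <=
        nsq (design_head w *m u),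
      forall u : 'cV[R]_d, nsq (design_head w *m u) <=
        20 / 9 * n%:R * \sum_j lambda M 0 (hd j) * u j 0 ^+ 2,
      3 / 4 * (n%:R * tail_sum M) <= \tr (design_tail w *m (design_tail w)^T)
    & nsq (design_tail w *m theta_tail M) <=
      5 / 4 * (n%:R * \sum_j lambda M 0 (tl j) * theta_tail M j 0 ^+ 2)].
Proof.
rewrite /good_event => /not_orP[nh /not_orP[nt /not_orP[nr ns]]].
have d0 := dimd_gt0 M; have n0 : 0 <= n%:R :> R by [].
have [up low] : (forall v, nsq (design_head_std w *m v) <= 20 / 9 * (n%:R * nsq v)) /\
    (forall v, 1 / 16 * (n%:R * nsq v) <= nsq (design_head_std w *m v)).
  apply: net_operator_ge => // f fJ; rewrite leNgt; apply/negP => h; apply: nh.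
    by left; exists f.
  by right; exists f.
have tc0 : 0 <= tail_const * tail_sum M.
  by rewrite mulr_ge0 ?(ltW tail_sum_gt0) // mulr_ge0 ?sqr_ge0 // mulr_ge0.
pose un (u : 'cV[R]_d) : 'cV[R]_d := \col_j (Num.sqrt (lambda M 0 (hd j)) * u j 0).
have unK u : head_scale (un u) = u.
  apply/matrixP => j k; rewrite ord1 !mxE mulrC mulKf // gt_eqF // sqrtr_gt0.
  exact: lambda_gt0.
have unq u : nsq (un u) = \sum_j lambda M 0 (hd j) * u j 0 ^+ 2.
  by rewrite -head_scale_qf unK.
split.
- apply: net_operator_le => // f fJ; rewrite leNgt; apply/negP => h; apply: nt.
  by exists f => //; exact: ltW.
- move=> u; rewrite -{2}(unK u) -design_head_stdE -unq; apply: le_trans (low _); lra.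
- move=> u; rewrite -{1}(unK u) -design_head_stdE -unq; apply: (le_trans (up _)); lra.
- by rewrite leNgt; apply/negP => h; apply: nr.
- by rewrite leNgt; apply/negP => h; apply: ns.
Qed.

End GoodEvent.

(** * Risk bounds on the good event *)

Section ModelBounds.
Context {R : realType} {sigma_x : R} {n : nat}.
Variable M : ridge_model sigma_x n.
Local Notation P := (Pr M).
Local Notation d := (dimd M).
Hypothesis n_gt0 : (0 < n)%N.

(** This is [tail_sum / n], the implicit penalty exerted by the tail, on the scale of [tau]; the
    operator bound [B] is [n] times [tail_factor * tail_level]. *)
Definition tail_level : R := lambda_d1 M * (eff_rank M / n%:R).
Definition tail_factor : R := 16 / 9 * @tail_const R sigma_x.

Let nR_gt0 : 0 < n%:R :> R. Proof. by rewrite ltr0n. Qed.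

Lemma tail_factor_ge1 : 1 <= tail_factor.
Proof.
have s1 := sigma_x_ge1 M n_gt0; have s2 : 1 <= sigma_x ^+ 2 by exact: exprn_ege1.
rewrite /tail_factor /tail_const; lra.
Qed.

Lemma tail_levelE : tail_sum M = n%:R * tail_level.
Proof.
have l0 := lambda_d1_gt0 M; rewrite /tail_level /eff_rank.
by field; rewrite !gt_eqF.
Qed.

Lemma tail_level_gt0 : 0 < tail_level.
Proof. by have := tail_sum_gt0 M; rewrite tail_levelE pmulr_rgt0. Qed.

Lemma lambda_d_gt0 : 0 < lambda_d M. Proof. exact: lambda_gt0. Qed.

Lemma lambda_d_le j : lambda_d M <= lambda M 0 (head_idx j).
Proof. by apply: lambda_noninc => /=; rewrite -ltnS prednK ?dimd_gt0. Qed.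

Lemma wnorm_diag m (D : 'rV[R]_m) (b : 'cV[R]_m) : (forall j, 0 <= D 0 j) ->
  wnorm (diag_mx D) b ^+ 2 = \sum_j D 0 j * b j 0 ^+ 2.
Proof.
move=> D0; have E : (b^T *m diag_mx D *m b) 0 0 = \sum_j D 0 j * b j 0 ^+ 2.
  rewrite mxE; apply: eq_bigr => j _; rewrite mul_mx_diag !mxE; ring.
rewrite /wnorm E sqr_sqrtr // sumr_ge0 // => j _.
by rewrite mulr_ge0 ?sqr_ge0.
Qed.

Lemma invmx_diag m (D : 'rV[R]_m) : (forall j, 0 < D 0 j) ->
  invmx (diag_mx D) = diag_mx (\row_j (D 0 j)^-1).
Proof.
move=> D0; have E : diag_mx D *m diag_mx (\row_j (D 0 j)^-1) = 1%:M.
  rewrite mulmx_diag -[RHS]diag_const_mx; congr diag_mx.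
  by apply/rowP => j; rewrite !mxE mulfV // gt_eqF.
have [uD _] := mulmx1_unit E.
by rewrite -[LHS]mulmx1 -E mulKmx.
Qed.

Lemma head_norm2E :
  head_norm2 M = \sum_j theta_head M j 0 ^+ 2 / lambda M 0 (head_idx j).
Proof.
rewrite /head_norm2 invmx_diag => [|j]; last by rewrite mxE lambda_gt0.
rewrite wnorm_diag => [|j]; last by rewrite !mxE invr_ge0 ltW ?lambda_gt0.
by apply: eq_bigr => j _; rewrite !mxE mulrC.
Qed.

Lemma tail_norm2E :
  tail_norm2 M = \sum_j lambda M 0 (tail_idx j) * theta_tail M j 0 ^+ 2.
Proof.
rewrite /tail_norm2 wnorm_diag => [|j]; last by rewrite mxE ltW ?lambda_gt0.
by apply: eq_bigr => j _; rewrite mxE.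
Qed.

Local Notation MSE tau w := (mse (design w) tau (signal w) (sigma2 M)).

Section OnGoodEvent.
Variables (tau : R) (w : Om M).
Hypotheses (tau_ge0 : 0 <= tau) (s2_ge0 : 0 <= sigma2 M) (gw : good_event w).
Local Notation t0 := tail_level.
Local Notation k := tail_factor.

Let B_ge0 : 0 <= 16 / 9 * (@tail_const R sigma_x * tail_sum M).
Proof.
rewrite mulrA mulr_ge0 ?(ltW (tail_sum_gt0 M)) //.
exact: le_trans ler01 tail_factor_ge1.
Qed.

Let BE : 16 / 9 * (@tail_const R sigma_x * tail_sum M) = n%:R * (k * t0).
Proof. by rewrite tail_levelE /tail_factor; ring. Qed.

Let bias_le : 32 * (head_norm2 M * (tau * (k * t0 + tau))) <=
  32 * (k * (head_norm2 M * (tau + t0) ^+ 2)).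
Proof.
have k1 := tail_factor_ge1; have t00 := tail_level_gt0.
have h0 : 0 <= head_norm2 M by exact: sqr_ge0.
rewrite ler_pM2l // [leRHS]mulrCA; apply: ler_wpM2l => //.
have k0 : 0 <= k by exact: le_trans ler01 k1.
have kt : 0 <= (k - 1) * tau ^+ 2 by rewrite mulr_ge0 ?subr_ge0 // sqr_ge0.
have : 0 <= k * (t0 * tau) by apply: mulr_ge0 => //; apply: mulr_ge0 => //; exact: ltW.
have : 0 <= k * t0 ^+ 2 by apply: mulr_ge0 => //; exact: sqr_ge0.
nra.
Qed.

Lemma mse_good_le : MSE tau w <=
  32 * (k * (head_norm2 M * (tau + t0) ^+ 2)) + 5 / 2 * tail_norm2 M + sigma2 M.
Proof.
have [tail_le head_ge _ _ sig] := good_eventP n_gt0 gw.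
have n16 : 0 < n%:R / 16 :> R by rewrite divr_gt0.
have := mse_le n_gt0 (design_gram_split w) B_ge0 s2_ge0 tail_le (theta_head M)
  (theta_tail M) (fun j => lambda_gt0 (head_idx j)) n16 head_ge tau_ge0.
rewrite -signal_split -head_norm2E BE; move: sig; rewrite -tail_norm2E => sig h.
rewrite -(ler_pM2l nR_gt0); apply: (le_trans h).
have -> : n%:R * tau * (head_norm2 M * (n%:R * (k * t0) + n%:R * tau) / (n%:R / 16)) =
    16 * (n%:R * (head_norm2 M * (tau * (k * t0 + tau)))).
  by field; rewrite gt_eqF.
have := ler_wpM2l (ltW nR_gt0) bias_le; move: sig; nra.
Qed.

Lemma mse_good_le_gt0 : 0 < tau -> MSE tau w <=
  32 * (k * (head_norm2 M * (tau + t0) ^+ 2)) + 5 / 2 * tail_norm2 M +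
  sigma2 M * (d_over_n M + (k * (t0 / tau)) ^+ 2).
Proof.
move=> tau0; have [tail_le head_ge _ _ sig] := good_eventP n_gt0 gw.
have n16 : 0 < n%:R / 16 :> R by rewrite divr_gt0.
have := mse_le_gt0 n_gt0 (design_gram_split w) B_ge0 s2_ge0 tail_le (theta_head M)
  (theta_tail M) (fun j => lambda_gt0 (head_idx j)) n16 head_ge tau0.
rewrite -signal_split -head_norm2E BE; move: sig; rewrite -tail_norm2E => sig h.
rewrite -(ler_pM2l nR_gt0); apply: (le_trans h).
have -> : n%:R * tau * (head_norm2 M * (n%:R * (k * t0) + n%:R * tau) / (n%:R / 16)) =
    16 * (n%:R * (head_norm2 M * (tau * (k * t0 + tau)))).
  by field; rewrite gt_eqF.
have -> : n%:R * (k * t0) / (n%:R * tau) = k * (t0 / tau).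
  by field; rewrite !gt_eqF.
have -> : d%:R = n%:R * d_over_n M by rewrite /d_over_n mulrC divfK // gt_eqF.
have := ler_wpM2l (ltW nR_gt0) bias_le; move: sig; nra.
Qed.

Lemma mse_good_ge_variance :
  sigma2 M * (3 / 4 * t0) ^+ 2 <= (k * (tau + t0)) ^+ 2 * MSE tau w.
Proof.
have [tail_le _ _ tr_ge _] := good_eventP n_gt0 gw.
have k1 := tail_factor_ge1; have t00 := tail_level_gt0.
have k0 : 0 < k by exact: lt_le_trans ltr01 k1.
have s2 := ler_wpM2l s2_ge0.
have X0 : 0 < (n%:R * (n%:R * (k * t0) + n%:R * tau)) ^+ 2.
  by rewrite exprn_gt0 // -mulrDr !(pmulr_rgt0 _ nR_gt0) ltr_pwDl // mulr_gt0.
have h := mse_ge_variance n_gt0 (design_gram_split w) B_ge0 s2_ge0 tail_le (signal w) tau_ge0.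
rewrite BE in h.
have m0 : 0 <= MSE tau w.
  by rewrite -(pmulr_rge0 _ X0) (le_trans _ h) // mulr_ge0 ?sqr_ge0.
have tr2 : (n%:R * (n%:R * (3 / 4 * t0))) ^+ 2 <=
    \tr (design_tail w *m (design_tail w)^T) ^+ 2.
  rewrite ler_pXn2r // ?nnegrE.
  - by move: tr_ge; rewrite tail_levelE; apply: le_trans; rewrite le_eqVlt; apply/orP; left; apply/eqP; ring.
  - by rewrite !(pmulr_rge0 _ nR_gt0) mulr_ge0 // ltW.
  - by apply: le_trans tr_ge; rewrite mulr_ge0 // mulr_ge0 // ltW // tail_sum_gt0.
have := le_trans (s2 _ _ tr2) h.
have n4 : 0 < (n%:R * n%:R) ^+ 2 :> R by rewrite exprn_gt0 // mulr_gt0.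
have -> : sigma2 M * (n%:R * (n%:R * (3 / 4 * t0))) ^+ 2 =
  (n%:R * n%:R) ^+ 2 * (sigma2 M * (3 / 4 * t0) ^+ 2) by ring.
have -> : (n%:R * (n%:R * (k * t0) + n%:R * tau)) ^+ 2 * MSE tau w =
  (n%:R * n%:R) ^+ 2 * ((k * t0 + tau) ^+ 2 * MSE tau w) by ring.
rewrite ler_pM2l // => /le_trans; apply; apply: ler_wpM2r => //.
rewrite ler_pXn2r ?nnegrE //; last 2 first.
- by rewrite addr_ge0 // ltW // mulr_gt0.
- by rewrite (pmulr_rge0 _ k0) addr_ge0 // ltW.
by rewrite mulrDr addrC lerD2r ler_peMl.
Qed.

Lemma mse_good_ge_bias : 0 < tau -> k * t0 <= tau ->
  tau ^+ 2 * head_norm2 M <= 16 * (20 / 9 + 16 * (tau / lambda_d M) ^+ 2) *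
    (MSE tau w + 5 / 4 * tail_norm2 M).
Proof.
move=> tau0 kt; have [tail_le head_ge head_le _ sig] := good_eventP n_gt0 gw.
have n16 : 0 < n%:R / 16 :> R by rewrite divr_gt0.
have n20 : 0 <= 20 / 9 * n%:R :> R by rewrite mulr_ge0.
have Bt : 16 / 9 * (@tail_const R sigma_x * tail_sum M) <= n%:R * tau.
  by rewrite BE ler_pM2l.
have := mse_ge_bias n_gt0 (design_gram_split w) B_ge0 s2_ge0 tail_le (theta_head M)
  (theta_tail M) (fun j => lambda_gt0 (head_idx j)) n16 head_ge head_le lambda_d_gt0
  lambda_d_le n20 tau0 Bt.
rewrite -signal_split -head_norm2E; move: sig; rewrite -tail_norm2E => sig h.
have l0 := lambda_d_gt0.
have E : 8 * (20 / 9 * n%:R + (n%:R * tau) ^+ 2 / (lambda_d M ^+ 2 * (n%:R / 16))) =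
    n%:R * (8 * (20 / 9 + 16 * (tau / lambda_d M) ^+ 2)).
  by field; rewrite !gt_eqF.
rewrite E in h.
have a0 : 0 <= 8 * (20 / 9 + 16 * (tau / lambda_d M) ^+ 2).
  by rewrite mulr_ge0 // addr_ge0 // mulr_ge0 ?sqr_ge0.
have n2 : 0 < n%:R ^+ 2 :> R by rewrite exprn_gt0.
rewrite -(ler_pM2l n2).
have -> : n%:R ^+ 2 * (tau ^+ 2 * head_norm2 M) = (n%:R * tau) ^+ 2 * head_norm2 M by ring.
apply: (le_trans h).
have -> : n%:R ^+ 2 * (16 * (20 / 9 + 16 * (tau / lambda_d M) ^+ 2) *
    (MSE tau w + 5 / 4 * tail_norm2 M)) =
  n%:R * (8 * (20 / 9 + 16 * (tau / lambda_d M) ^+ 2)) *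
  (2 * (n%:R * MSE tau w) + 2 * (5 / 4 * (n%:R * tail_norm2 M))) by ring.
by apply: ler_wpM2l; [rewrite mulr_ge0|rewrite lerD2l ler_pM2l].
Qed.

End OnGoodEvent.
End ModelBounds.

(** * Scalar inequalities between risk and penalty *)

Section ScalarBounds.
Context {R : realType}.
Implicit Types r t l h k x : R.

Lemma bias_level_le r t0 t l h c2 c3 : 0 < r -> 0 <= t0 + t -> 0 < l -> 0 <= h -> 0 < c2 ->
  t + t0 <= c2 * (l * r) -> h * l ^+ 2 <= c3 ->
  h * (t + t0) ^+ 2 <= c3 * c2 ^+ 2 * r ^+ 2.
Proof.
move=> r0 t00 l0 h0 c20 up hl.
have : (t + t0) ^+ 2 <= (c2 * (l * r)) ^+ 2.
  by rewrite ler_pXn2r // nnegrE; [rewrite addrC|rewrite !mulr_ge0 // ltW].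
move=> /(ler_wpM2l h0)/le_trans; apply.
have -> : h * (c2 * (l * r)) ^+ 2 = h * l ^+ 2 * (c2 ^+ 2 * r ^+ 2) by ring.
by rewrite -[leRHS]mulrA; apply: ler_wpM2r => //; apply: mulr_ge0; exact: sqr_ge0.
Qed.

(** Here [r] stands for the square root of [d / n]. Either it is bounded below, or [c1 * r < 1 / 2]
    and the term [c1 * r * t0] is absorbed on the left of [t0 <= c1 * r * (t + t0)], which also
    forces [t] to be positive. *)
Lemma small_ridge_dichotomy r t0 t c1 : 0 < r -> 0 < t0 -> 0 <= t -> 0 < c1 ->
  t0 / r <= c1 * (t + t0) ->
  1 <= 4 * c1 ^+ 2 * r ^+ 2 \/ (0 < t /\ (t0 / t) ^+ 2 <= 4 * c1 ^+ 2 * r ^+ 2).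
Proof.
move=> r0 t00 tge c10; rewrite ler_pdivrMr // => h.
have [cr|cr] := leP 1 (2 * c1 * r).
  by left; have : 1 ^+ 2 <= (2 * c1 * r) ^+ 2 by [rewrite ler_pXn2r ?nnegrE // !mulr_ge0 // ltW|]; rewrite expr1n !exprMn; lra.
right; have hh : t0 <= 2 * c1 * r * t.
  have : 0 <= t0 * (1 - 2 * c1 * r) by rewrite mulr_ge0 ?subr_ge0 // ltW.
  move: h; rewrite mulrDr; nra.
have t0' : 0 < t.
  rewrite lt_neqAle tge andbT; apply/negP => /eqP e.
  by move: hh; rewrite -e mulr0 leNgt t00.
split=> //; have -> : 4 * c1 ^+ 2 * r ^+ 2 = (2 * c1 * r) ^+ 2 by ring.
have c0 : 0 <= 2 * c1 * r by rewrite !mulr_ge0 // ltW.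
by rewrite ler_pXn2r ?nnegrE ?divr_ge0 ?ler_pdivrMr // ltW.
Qed.

(** Squares are compared, and [1 + c1 * C] bounds the square root of [c1 * C] that would come
    out. *)
Lemma variance_level_ge r t0 t k s c1 C m : 0 < r -> 0 < t0 -> 0 <= t -> 0 < k -> 0 < C -> 0 < c1 ->
  1 <= c1 * s -> s * (3 / 4 * t0) ^+ 2 <= (k * (t + t0)) ^+ 2 * m -> m <= C * r ^+ 2 ->
  t0 / r <= 4 / 3 * k * (1 + c1 * C) * (t + t0).
Proof.
move=> r0 t00 tge k0 C0 c10 s1 h mC.
have tt : 0 <= t + t0 by rewrite addr_ge0 // ltW.
have a0 : 0 < 1 + c1 * C by rewrite ltr_wpDr // mulr_ge0 // ltW.
rewrite ler_pdivrMr //.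
have X0 : 0 <= k * (t + t0) * (1 + c1 * C) * r by rewrite !mulr_ge0 // ltW.
suff : 3 / 4 * t0 <= k * (t + t0) * (1 + c1 * C) * r by lra.
have Y0 : 0 <= 3 / 4 * t0 by rewrite mulr_ge0 // ltW.
rewrite -(@ler_pXn2r _ 2) ?nnegrE //.
apply: (@le_trans _ _ (c1 * (s * (3 / 4 * t0) ^+ 2))).
  by rewrite mulrA ler_peMl // sqr_ge0.
apply: (@le_trans _ _ (c1 * ((k * (t + t0)) ^+ 2 * (C * r ^+ 2)))).
  by rewrite ler_pM2l // (le_trans h) // ler_wpM2l ?sqr_ge0.
have -> : c1 * ((k * (t + t0)) ^+ 2 * (C * r ^+ 2)) = c1 * C * (k * (t + t0) * r) ^+ 2 by ring.
have -> : (k * (t + t0) * (1 + c1 * C) * r) ^+ 2 =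
  (1 + c1 * C) ^+ 2 * (k * (t + t0) * r) ^+ 2 by ring.
rewrite ler_wpM2r ?sqr_ge0 //.
have : 0 <= c1 * C by rewrite mulr_ge0 // ltW.
have := sqr_ge0 (c1 * C); rewrite sqrrD; lra.
Qed.

(** In terms of [x = t / l], the bias bound reads [x ^+ 2 <= 512 * c2 * C * r ^+ 2 * (1 + x ^+ 2)].
    The smallness of [r] absorbs the [x ^+ 2] on the right: this rules out a penalty above
    [lambda_d], at which the bias saturates. *)
Lemma bias_level_ge r t l h c2 C m b : 0 < r -> 0 < t -> 0 < l -> 0 <= h -> 0 < c2 -> 0 < C ->
  1 <= c2 * (h * l ^+ 2) ->
  t ^+ 2 * h <= 16 * (20 / 9 + 16 * (t / l) ^+ 2) * (m + 5 / 4 * b) ->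
  b <= (1 / (4 * 160)) * (t ^+ 2 / (1 + t / l) ^+ 2) * h ->
  m <= C * r ^+ 2 -> 1024 * c2 * C * r ^+ 2 <= 1 ->
  t <= (1 + 1024 * c2 * C) * (l * r).
Proof.
move=> r0 t0 l0 h0 c20 C0 hl bias bb mC small.
pose x := t / l; have x0 : 0 < x by rewrite divr_gt0.
have tE : t = x * l by rewrite /x divfK // gt_eqF.
have h20 : 20 / 9 + 16 * x ^+ 2 <= 16 * (1 + x) ^+ 2 by rewrite sqrrD; have := sqr_ge0 x; nra.
have y0 : 0 < (1 + x) ^+ 2 by rewrite exprn_gt0 // addr_gt0.
have q0 : 0 < 20 / 9 + 16 * x ^+ 2 by rewrite ltr_pwDl // mulr_ge0 ?sqr_ge0.
(* The constant 160 is chosen here: [20 / 9 + 16 * x ^+ 2] is at most [16 * (1 + x) ^+ 2], and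
   [16 * 16 * (5 / 4) / (4 * 160) = 1 / 2]. *)
have tail : 16 * (20 / 9 + 16 * x ^+ 2) * (5 / 4 * b) <= 1 / 2 * (t ^+ 2 * h).
  apply: (@le_trans _ _ (16 * (20 / 9 + 16 * x ^+ 2) *
      (5 / 4 * ((1 / (4 * 160)) * (t ^+ 2 / (1 + x) ^+ 2) * h)))).
    by rewrite ler_pM2l ?mulr_gt0 // ler_pM2l.
  have -> : 16 * (20 / 9 + 16 * x ^+ 2) * (5 / 4 * ((1 / (4 * 160)) * (t ^+ 2 / (1 + x) ^+ 2) * h)) =
     (20 / 9 + 16 * x ^+ 2) / (1 + x) ^+ 2 * (1 / 32 * (t ^+ 2 * h)).
    by field; rewrite gt_eqF // addr_gt0.
  have -> : 1 / 2 * (t ^+ 2 * h) = 16 * (1 / 32 * (t ^+ 2 * h)) by field.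
  apply: ler_wpM2r; last by rewrite ler_pdivrMr.
  by apply: mulr_ge0 => //; apply: mulr_ge0 => //; exact: sqr_ge0.
have main : t ^+ 2 * h <= 512 * (1 + x ^+ 2) * (C * r ^+ 2).
  have : 16 * (20 / 9 + 16 * x ^+ 2) * m <= 256 * (1 + x ^+ 2) * (C * r ^+ 2).
    apply: (@le_trans _ _ (16 * (20 / 9 + 16 * x ^+ 2) * (C * r ^+ 2))).
      by rewrite ler_pM2l // mulr_gt0.
    by rewrite ler_wpM2r ?mulr_ge0 ?sqr_ge0 ?(ltW C0) //; lra.
  by move: bias tail; rewrite -/x mulrDr; lra.
have x2 : x ^+ 2 <= 1024 * c2 * C * r ^+ 2.
  have : x ^+ 2 <= c2 * (512 * (1 + x ^+ 2) * (C * r ^+ 2)).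
    apply: (@le_trans _ _ (c2 * (t ^+ 2 * h))); last by rewrite ler_pM2l.
    have -> : c2 * (t ^+ 2 * h) = c2 * (h * l ^+ 2) * x ^+ 2 by rewrite tE; ring.
    by rewrite ler_peMl ?sqr_ge0.
  have : 0 <= x ^+ 2 * (1 - 1024 * c2 * C * r ^+ 2) by rewrite mulr_ge0 ?sqr_ge0 ?subr_ge0.
  rewrite mulrBr mulr1; set y := x ^+ 2; nra.
have c0 : 0 <= 1024 * c2 * C.
  by rewrite -mulrA; apply: mulr_ge0; [exact: ler0n|exact/ltW/mulr_gt0].
set K := 1024 * c2 * C in x2 c0 *.
have xr : x <= (1 + K) * r.
  have Kr : 0 <= (1 + K) * r by rewrite mulr_ge0 ?addr_ge0 // ltW.
  rewrite -(@ler_pXn2r _ 2) ?nnegrE ?(ltW x0) //.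
  apply: (le_trans x2); rewrite exprMn ler_wpM2r ?sqr_ge0 // sqrrD.
  by have := sqr_ge0 K; lra.
have hK : (1 + K) * (l * r) = (1 + K) * r * l by ring.
by rewrite [leLHS]tE [leRHS]hK ler_pM2r.
Qed.

End ScalarBounds.

(** * The two directions at fixed sample size *)

Section GoodProbability.
Context {R : realType} {sigma_x : R} {n : nat}.
Variable M : ridge_model sigma_x n.
Local Notation P := (Pr M).
Local Notation d := (dimd M).

(** If [eff_rank < n], the square root in [eta2] is at least 1 and [eta2 >= 1000]. Squaring
    [eta1 < 1 / 2] gives [4 * 10^6 * sigma_x ^+ 4 * d < n], and [36 * 512 * 64] is about
    [1.2 * 10^6]. *)
Lemma cond_dims : cond_a M 1000 -> cond_b M 1000 ->
  [/\ (0 < n)%N, n%:R <= eff_rank M & 36 * d%:R <= @conc_exponent R sigma_x n].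
Proof.
move=> [dn e1] e2; have d0 := dimd_gt0 M; have n0 : (0 < n)%N := leq_trans d0 dn.
have nR : 0 < n%:R :> R by rewrite ltr0n.
have s1 := sigma_x_ge1 M n0; have s2 : 1 <= sigma_x ^+ 2 by exact: exprn_ege1.
have s4 : sigma_x ^+ 4 = sigma_x ^+ 2 ^+ 2 by rewrite -exprM.
have r0 : 0 < eff_rank M by rewrite divr_gt0 ?tail_sum_gt0 ?lambda_d1_gt0.
split=> //.
  rewrite leNgt; apply/negP => rn.
  have x1 : 1 <= 4 * n%:R ^+ 2 / eff_rank M ^+ 2 + 2 * n%:R / eff_rank M.
    have : 1 <= n%:R / eff_rank M by rewrite ler_pdivlMr // mul1r ltW.
    have : 0 <= 4 * n%:R ^+ 2 / eff_rank M ^+ 2.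
      by rewrite divr_ge0 ?sqr_ge0 // mulr_ge0 ?sqr_ge0.
    rewrite -(mulrA 2); lra.
  have y1 : 1 <= Num.sqrt (4 * n%:R ^+ 2 / eff_rank M ^+ 2 + 2 * n%:R / eff_rank M).
    by rewrite -[leLHS]sqrtr1 ler_wsqrtr.
  move: e2; rewrite /cond_b /eta2 => e2.
  have : 1 * 1 <= sigma_x ^+ 2 *
      Num.sqrt (4 * n%:R ^+ 2 / eff_rank M ^+ 2 + 2 * n%:R / eff_rank M).
    by rewrite ler_pM.
  by move: e2; rewrite -mulrA; lra.
have dn0 : 0 <= d_over_n M by rewrite divr_ge0.
have s40 := conc_denominator_gt0 s1.
have sd : 0 <= sigma_x ^+ 4 * d%:R by rewrite mulr_ge0 // s4 sqr_ge0.
move: e1; rewrite /eta1; set y := _ * Num.sqrt _ => e1.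
have y0 : 0 <= y.
  by apply: mulr_ge0; [apply: mulr_ge0; [exact: ler0n|exact: sqr_ge0]|exact: sqrtr_ge0].
have y2 : y ^+ 2 < (1 / 2) ^+ 2 by rewrite ltr_pXn2r ?nnegrE.
move: y2; rewrite /y exprMn sqr_sqrtr // exprMn -s4 /d_over_n mulrA ltr_pdivrMr // => h.
rewrite /conc_exponent (ler_pdivlMr _ _ s40).
have -> : 36 * d%:R * (512 * 64 * sigma_x ^+ 4) = 36 * 512 * 64 * (sigma_x ^+ 4 * d%:R) by ring.
move: h sd; rewrite -mulrA expr2; lra.
Qed.

(* Only almost sure, since [MSE_in] is an arbitrary version of the conditional
   expectation. *)
Lemma prob_ae_event (A : set (Om M)) : (0 < n)%N -> measurable A ->
  {ae P, forall w, good_event w -> A w} -> (P (~` A) <= P (~` good_event (M:=M)))%E.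
Proof.
move=> n0 mA [N [mN N0 AN]]; have mg := measurable_good_event M n0.
have sub : ~` A `<=` ~` good_event (M:=M) `|` N.
  move=> w nA; have [gw|ngw] := pselect (good_event w); last by left.
  by right; apply: AN => /= h; exact: nA (h gw).
apply: (@le_trans _ _ (P (~` good_event (M:=M) `|` N))).
  by apply: le_measure => //; rewrite inE //; [exact: measurableC|apply: measurableU => //; exact: measurableC].
by rewrite measureU0 //; exact: measurableC.
Qed.

Lemma d_over_n_gt0 : (0 < n)%N -> 0 < d_over_n M.
Proof. by move=> n0; rewrite divr_gt0 // ltr0n ?dimd_gt0. Qed.

Lemma sqrt_n_over_d : Num.sqrt (n_over_d M) = (Num.sqrt (d_over_n M))^-1.
Proof. by rewrite -sqrtrV ?divr_ge0 // invf_div. Qed.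

Lemma tail_norm2_le delta2 : (0 < n)%N -> 0 <= delta2 -> 0 < head_norm2 M ->
  cond_c M delta2 -> tail_norm2 M <=
  delta2 / 4 * ((lambda_d M)^-1 + 4 / tail_level M) ^- 2 * head_norm2 M.
Proof.
move=> n0 d0 h0; rewrite /cond_c ler_pdivrMr // => /le_trans; apply.
have nR : 0 < n%:R :> R by rewrite ltr0n.
have t0 := tail_level_gt0 M n0; have l0 := lambda_d_gt0 M.
have -> : 4 * n%:R / tail_sum M = 4 / tail_level M.
  by rewrite tail_levelE //; field; rewrite !gt_eqF.
rewrite ler_pM2r //; apply: ler_wpM2r; first by rewrite invr_ge0 sqr_ge0.
rewrite invfM mulrA ler_piMr ?divr_ge0 // invf_le1 ?lerDl ?sqr_ge0 //.
by rewrite ltr_pwDl ?sqr_ge0.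
Qed.

(** [c1] and [c2] are the constants of the two ends of the range of [tau]; [c3] bounds
    [head_norm2 * lambda_d ^+ 2] and [c4] bounds [sigma2]. *)
Definition risk_const (c1 c2 c3 c4 : R) : R :=
  (32 * @tail_factor R sigma_x + 5 / 2) * (c3 * c2 ^+ 2) +
  c4 * (4 * c1 ^+ 2 + 1 + @tail_factor R sigma_x ^+ 2 * (4 * c1 ^+ 2)).

(** Condition (c) bounds the tail signal by [tail_level ^+ 2 * head_norm2], hence by the same
    quantity [b] as the bias of the head. For the variance, the cases of [small_ridge_dichotomy]
    call for the crude and the refined trace bound respectively. *)
Lemma mse_good_upper delta2 c1 c2 c3 c4 tau (w : Om M) : (0 < n)%N -> 0 <= delta2 <= 1 ->
  0 < c1 -> 0 < c2 -> good_event w -> cond_c M delta2 ->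
  0 <= sigma2 M <= c4 -> 0 < head_norm2 M ->
  head_norm2 M * lambda_d M ^+ 2 <= c3 -> 0 <= tau ->
  tail_level M * Num.sqrt (n_over_d M) <= c1 * (tau + tail_level M) ->
  tau + tail_level M <= c2 * (lambda_d M * Num.sqrt (d_over_n M)) ->
  mse (design w) tau (signal w) (sigma2 M) <= risk_const c1 c2 c3 c4 * d_over_n M.
Proof.
move=> n0 /andP[d0 d1] c10 c20 gw cc /andP[s0 s4] h0 hl tau0.
have D0 := d_over_n_gt0 n0; have t0 := tail_level_gt0 M n0; have l0 := lambda_d_gt0 M.
have k1 := tail_factor_ge1 M n0; set k := @tail_factor R sigma_x in k1 *.
rewrite sqrt_n_over_d; set r := Num.sqrt _ => lo up.
have r0 : 0 < r by rewrite sqrtr_gt0.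
have -> : d_over_n M = r ^+ 2 by rewrite sqr_sqrtr // ltW.
have tt : 0 <= tail_level M + tau by rewrite addr_ge0 // ltW.
have bias := bias_level_le r0 tt l0 (ltW h0) c20 up hl.
set b := head_norm2 M * _ in bias; set E := c3 * c2 ^+ 2 in bias.
have tail : tail_norm2 M <= b.
  apply: (le_trans (tail_norm2_le n0 d0 h0 cc)); rewrite /b mulrC ler_pM2l //.
  have q0 : 0 < (lambda_d M)^-1 + 4 / tail_level M by rewrite addr_gt0 ?invr_gt0 ?divr_gt0.
  apply: (@le_trans _ _ (1 * tail_level M ^+ 2)); last first.
    by rewrite mul1r ler_pXn2r ?nnegrE ?(ltW t0) ?lerDr // addrC.
  apply: ler_pM; [by rewrite divr_ge0|by rewrite invr_ge0 sqr_ge0|lra|].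
  rewrite -exprVn ler_pXn2r ?nnegrE ?invr_ge0 ?(ltW q0) ?(ltW t0) //.
  rewrite -[leRHS]invrK lef_pV2 ?posrE ?invr_gt0 //.
  have : 0 < (tail_level M)^-1 by rewrite invr_gt0.
  have : 0 < (lambda_d M)^-1 by rewrite invr_gt0.
  lra.
have bias' : 32 * (k * b) + 5 / 2 * tail_norm2 M <= (32 * k + 5 / 2) * E * r ^+ 2.
  have : k * b <= k * (E * r ^+ 2) by rewrite ler_wpM2l // (le_trans ler01).
  lra.
have r2 : 0 <= r ^+ 2 by exact: sqr_ge0.
have k2 : 0 <= k ^+ 2 by exact: sqr_ge0.
have q1 : 0 <= c1 ^+ 2 * r ^+ 2 by rewrite mulr_ge0 ?sqr_ge0.
have q2 : 0 <= k ^+ 2 * (4 * c1 ^+ 2 * r ^+ 2) by rewrite mulr_ge0 // -mulrA mulr_ge0.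
rewrite /risk_const -/k -/E.
have [big|[tau_gt0 ratio]] := small_ridge_dichotomy r0 t0 tau0 c10 lo.
  apply: le_trans (mse_good_le n0 tau0 s0 gw) _; rewrite -/k -/b.
  have : sigma2 M * 1 <= c4 * (4 * c1 ^+ 2 * r ^+ 2 + r ^+ 2 + k ^+ 2 * (4 * c1 ^+ 2 * r ^+ 2)).
    by apply: ler_pM => //; lra.
  by move: bias'; lra.
apply: le_trans (mse_good_le_gt0 n0 tau0 s0 gw tau_gt0) _; rewrite -/k -/b.
have : sigma2 M * (d_over_n M + (k * (tail_level M / tau)) ^+ 2) <=
   c4 * (4 * c1 ^+ 2 * r ^+ 2 + r ^+ 2 + k ^+ 2 * (4 * c1 ^+ 2 * r ^+ 2)).
  apply: ler_pM => //; first by rewrite addr_ge0 ?sqr_ge0 ?(ltW D0).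
  have -> : d_over_n M = r ^+ 2 by rewrite sqr_sqrtr // ltW.
  have := ler_wpM2l k2 ratio; rewrite -[in X in X <= _ -> _]exprMn; lra.
by move: bias'; lra.
Qed.

(** The order matters: the variance yields the lower end of the range; with [r] small, this places
    [tau] above the tail level, and only then is the bias bound available. It also allows
    [tail_level] to be replaced by [tau] in condition (c). *)
Lemma mse_good_lower delta2 c1 c2 C tau (w : Om M) : (0 < n)%N -> 0 <= delta2 <= 1 / 160 ->
  0 < c1 -> 0 < c2 -> 0 < C -> good_event w -> cond_c M delta2 ->
  1 <= c1 * sigma2 M -> 0 < head_norm2 M ->
  1 <= c2 * (head_norm2 M * lambda_d M ^+ 2) -> 0 <= tau ->
  mse (design w) tau (signal w) (sigma2 M) <= C * d_over_n M ->
  let c := 4 / 3 * @tail_factor R sigma_x * (1 + c1 * C) in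
  c * (@tail_factor R sigma_x + 1) * Num.sqrt (d_over_n M) <= 1 ->
  1024 * c2 * C * d_over_n M <= 1 ->
  tail_level M * Num.sqrt (n_over_d M) <= c * (tau + tail_level M) /\
  tau + tail_level M <=
    2 * (1 + 1024 * c2 * C) * (lambda_d M * Num.sqrt (d_over_n M)).
Proof.
move=> n0 /andP[d0 d1] c10 c20 C0 gw cc s1 h0 hl tau0 mC c small1 small2.
have D0 := d_over_n_gt0 n0; have t0 := tail_level_gt0 M n0; have l0 := lambda_d_gt0 M.
have k1 := tail_factor_ge1 M n0; set k := @tail_factor R sigma_x in k1 c small1 *.
have k0 : 0 < k by exact: lt_le_trans ltr01 k1.
have s0 : 0 <= sigma2 M by rewrite -(pmulr_rge0 _ c10) (le_trans ler01).
move: small1; rewrite sqrt_n_over_d; set r := Num.sqrt _ => small1.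
have r0 : 0 < r by rewrite sqrtr_gt0.
have DE : d_over_n M = r ^+ 2 by rewrite sqr_sqrtr // ltW.
rewrite DE in mC small2.
have lo := variance_level_ge r0 t0 tau0 k0 C0 c10 s1
  (mse_good_ge_variance n0 tau0 s0 gw) mC.
have a0 : 0 < 1 + c1 * C by rewrite ltr_pwDl // mulr_ge0 // ltW.
have cp : 0 < c by apply: mulr_gt0 => //; apply: mulr_gt0.
split=> //.
(* With [c * (k + 1) * r <= 1], the lower end becomes [(k + 1) * tail_level <= tau + tail_level]. *)
have kt : k * tail_level M <= tau.
  move: lo; rewrite ler_pdivrMr // -/c => lo.
  have h1 : c * ((k + 1) * r * tail_level M) <= tail_level M.
    by have := ler_wpM2r (ltW t0) small1; rewrite mul1r !mulrA.
  have h2 : c * ((k + 1) * r * tail_level M) <= c * ((tau + tail_level M) * r).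
    by apply: (le_trans h1); rewrite mulrA.
  move: h2; rewrite ler_pM2l // mulrAC ler_pM2r // mulrDl mul1r lerD2r //.
have tt : tail_level M <= tau by apply: le_trans kt; rewrite ler_peMl // ltW.
have tau_gt0 : 0 < tau by exact: lt_le_trans tt.
have tail : tail_norm2 M <=
    1 / (4 * 160) * (tau ^+ 2 / (1 + tau / lambda_d M) ^+ 2) * head_norm2 M.
  apply: (le_trans (tail_norm2_le n0 d0 h0 cc)); rewrite ler_pM2r //.
  have q0 : 0 < (lambda_d M)^-1 + 4 / tail_level M by rewrite addr_gt0 ?invr_gt0 ?divr_gt0.
  have p0 : 0 < (lambda_d M)^-1 + tau^-1 by rewrite addr_gt0 ?invr_gt0.
  have -> : tau ^+ 2 / (1 + tau / lambda_d M) ^+ 2 = ((lambda_d M)^-1 + tau^-1) ^- 2.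
    by field; rewrite !gt_eqF // ?addr_gt0.
  apply: ler_pM; [by rewrite divr_ge0|by rewrite invr_ge0 sqr_ge0|lra|].
  rewrite lef_pV2 ?posrE ?exprn_gt0 // ler_pXn2r ?nnegrE ?(ltW q0) ?(ltW p0) //.
  have : tau^-1 <= (tail_level M)^-1 by rewrite lef_pV2 ?posrE.
  have : 0 < (tail_level M)^-1 by rewrite invr_gt0.
  lra.
have := bias_level_ge r0 tau_gt0 l0 (ltW h0) c20 C0 hl
  (mse_good_ge_bias n0 s0 gw tau_gt0 kt) tail mC small2.
by rewrite -mulrA; move: tt; lra.
Qed.

End GoodProbability.

(** * Asymptotic statements *)

Section Asymptotic.
Context {R : realType} {sigma_x delta2 : R}.
Variable M : forall n, ridge_model sigma_x n.
Hypotheses (delta2_ge0 : 0 <= delta2) (delta2_le1 : delta2 <= 1).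
Hypothesis conds : \forall n \near \oo,
  [/\ cond_a (M n) 1000, cond_b (M n) 1000 & cond_c (M n) delta2].
Hypothesis noise : asymp (fun n => sigma2 (M n)) (fun=> 1).
Hypothesis signal_size :
  asymp (fun n => head_norm2 (M n) * lambda_d (M n) ^+ 2) (fun=> 1).

Lemma bad_event_vanishes (e : R) : 0 < e ->
  \forall n \near \oo, (Pr (M n) (~` good_event (M:=M n)) < e%:E)%E.
Proof.
(* The bound concerns [sigma_x], common to all models, so any one with a positive sample size
   provides it. *)
move=> e0; have s1 := sigma_x_ge1 (M 1) isT.
pose K : R := 512 * 64 * sigma_x ^+ 4.
have K0 : 0 < K := conc_denominator_gt0 s1.
have := nbhs_infty_gtr (10 * K / e) => big; near=> n.
have [ca cb _] : [/\ cond_a (M n) 1000, cond_b (M n) 1000 & cond_c (M n) delta2].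
  by near: n; exact: conds.
have [n0 nr dc] := cond_dims ca cb.
apply: (le_lt_trans (good_event_bound n0 nr dc)); rewrite lte_fin.
have nK : 10 * K / e < n%:R by near: n; exact: big.
have x0 : 0 < @conc_exponent R sigma_x n / 2.
  by rewrite divr_gt0 // divr_gt0 // ltr0n.
have xE : @conc_exponent R sigma_x n = n%:R / K by [].
rewrite xE; rewrite xE in x0; clear xE; clearbody K; set x := _ / 2 in x0 *.
rewrite expRN ltr_pdivrMr ?expR_gt0 //.
have xe : 5 < e * x.
  rewrite /x; have -> : e * (n%:R / K / 2) = n%:R * e / (2 * K) by field; rewrite gt_eqF.
  by move: nK; rewrite ltr_pdivrMr // ltr_pdivlMr ?mulr_gt0 //; have -> : 5 * (2 * K) = 10 * K by ring.
apply: (lt_le_trans xe); rewrite ler_pM2l //.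
by have := expR_ge1Dx x; lra.
Unshelve. all: by end_near. Qed.

Lemma MSE_event_measurable tau (C : R) n : (0 < n)%N -> 0 <= tau n ->
  measurable (MSE_event (M := M) tau C (n := n)).
Proof.
move=> n0 t0; have [mM _] := MSE_in_ae (M n) n0 t0.
by have [] := measurable_set_cmp (C * d_over_n (M n)) mM.
Qed.

Lemma MSE_event_prob_ge tau (C : R) n : (0 < n)%N -> 0 <= tau n ->
  (forall w : Om (M n), good_event w ->
    mse (design w) (tau n) (signal w) (sigma2 (M n)) <= C * d_over_n (M n)) ->
  (Pr (M n) (~` MSE_event (M := M) tau C (n := n)) <= Pr (M n) (~` good_event (M:=M n)))%E.
Proof.
move=> n0 t0 H; apply: prob_ae_event => //; first exact: MSE_event_measurable.
have [_] := MSE_in_ae (M n) n0 t0; apply: filterS => w e gw.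
by rewrite /MSE_event /= e H.
Qed.

(** The range of [tau] is deterministic, so a single good sample with small risk is enough to derive
    it; a probability bounded away from [0] eventually exceeds that of the bad event. *)
Lemma MSE_event_witness tau (C : R) n : (0 < n)%N -> 0 <= tau n ->
  (Pr (M n) (~` good_event (M:=M n)) < Pr (M n) (MSE_event (M := M) tau C (n := n)))%E ->
  exists2 w : Om (M n), good_event w &
    mse (design w) (tau n) (signal w) (sigma2 (M n)) <= C * d_over_n (M n).
Proof.
move=> n0 t0 lt; apply: contrapT => H; move: lt; apply/negP; rewrite -leNgt.
have mE := measurableC (MSE_event_measurable C n0 t0).
have := prob_ae_event n0 mE; rewrite setCK; apply.
have [_] := MSE_in_ae (M n) n0 t0; apply: filterS => w e gw.
by rewrite /MSE_event /= e => h; apply: H; exists w.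
Qed.

Lemma ridge_sufficient tau : (forall n, 0 <= tau n) -> tau_range M tau ->
  MSE_O_prob_to1 M tau.
Proof.
move=> tau0 [[c1 c10 lo] [c2 c20 up]].
have [[c4 c40 s4] [c5 c50 s5]] := noise.
have [[c3 c30 h3] [c6 c60 h6]] := signal_size.
pose C := @risk_const R sigma_x c1 c2 c3 c4; exists C.
have good : \forall n \near \oo, (0 < n)%N /\
    (Pr (M n) (~` MSE_event (M := M) tau C (n := n)) <= Pr (M n) (~` good_event (M:=M n)))%E.
  near=> n.
  have [ca cb cc] : [/\ cond_a (M n) 1000, cond_b (M n) 1000 & cond_c (M n) delta2].
    by near: n; exact: conds.
  have [n0 _ _] := cond_dims ca cb; split=> //; apply: MSE_event_prob_ge => // w gw.
  have l0 := lambda_d_gt0 (M n).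
  have : 1 <= c6 * (head_norm2 (M n) * lambda_d (M n) ^+ 2) by near: n; exact: h6.
  move=> /(lt_le_trans ltr01); rewrite (pmulr_rgt0 _ c60) (pmulr_lgt0 _ (exprn_gt0 2 l0)) => h0.
  apply: (mse_good_upper (delta2 := delta2)) => //.
  - by rewrite delta2_ge0.
  - have -> : sigma2 (M n) <= c4 by rewrite -[leRHS]mulr1; near: n; exact: s4.
    rewrite andbT -(pmulr_rge0 _ c50) (le_trans ler01) //.
    by near: n; exact: s5.
  - by rewrite -[leRHS]mulr1; near: n; exact: h3.
  - by near: n; exact: lo.
  - by near: n; exact: up.
apply/fine_cvgP; split.
  by near=> n; rewrite fin_num_measure //; apply: MSE_event_measurable => //; near: n; apply: filterS good => n [].
apply/cvgrPdist_le => e e0; near=> n.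
have [n0 le] : (0 < n)%N /\
    (Pr (M n) (~` MSE_event (M := M) tau C (n := n)) <= Pr (M n) (~` good_event (M:=M n)))%E.
  by near: n; exact: good.
have lt : (Pr (M n) (~` good_event (M:=M n)) < e%:E)%E.
  by near: n; exact: bad_event_vanishes.
have mE := MSE_event_measurable C n0 (tau0 n).
have fE : Pr (M n) (MSE_event (M := M) tau C (n := n)) \is a fin_num by rewrite fin_num_measure.
have := le_lt_trans le lt; rewrite (probability_setC _ mE).
have := probability_le1 (Pr (M n)) mE.
rewrite -(fineK fE) /= lee_fin -EFinB lte_fin => p1 pe.
by rewrite ger0_norm ?subr_ge0 // ltW.
Unshelve. all: by end_near. Qed.



Lemma tau_range_ratio tau : tau_range M tau -> ratio_cond M.
Proof.
move=> [[c1 c10 lo] [c2 c20 up]]; exists (c1 * c2); first exact: mulr_gt0.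
near=> n.
have n0 : (0 < n)%N by near: n; exact: nbhs_infty_gt.
have nR : 0 < n%:R :> R by rewrite ltr0n.
have := tail_level_gt0 (M n) n0; have l0 := lambda_d_gt0 (M n); have l1 := lambda_d1_gt0 (M n).
have D0 := d_over_n_gt0 (M n) n0; have s0 := tail_sum_gt0 (M n).
have r0 : 0 < eff_rank (M n) by rewrite divr_gt0.
have : lambda_d1 (M n) * (eff_rank (M n) / n%:R) * Num.sqrt (n_over_d (M n)) <=
    c1 * (tau n + lambda_d1 (M n) * (eff_rank (M n) / n%:R)) by near: n; exact: lo.
have : tau n + lambda_d1 (M n) * (eff_rank (M n) / n%:R) <=
    c2 * (lambda_d (M n) * Num.sqrt (d_over_n (M n))) by near: n; exact: up.
rewrite sqrt_n_over_d; set r := Num.sqrt _ => h1 h2 _.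
have rp : 0 < r by rewrite sqrtr_gt0.
have r2 : r * r = d_over_n (M n) by rewrite -expr2 sqr_sqrtr // ltW.
have := le_trans h2 (ler_wpM2l (ltW c10) h1).
rewrite ler_pdivrMr // => h.
rewrite ler_pdivrMr // -(@ler_pM2r _ (eff_rank (M n) / n%:R)) ?divr_gt0 //.
apply: (le_trans h); rewrite le_eqVlt; apply/orP; left; apply/eqP.
have -> : c1 * (c2 * (lambda_d (M n) * r)) * r = c1 * c2 * lambda_d (M n) * (r * r) by ring.
by rewrite r2 /d_over_n; field; rewrite !gt_eqF.
Unshelve. all: by end_near. Qed.

Hypothesis delta2_small : delta2 <= 1 / 160.
Hypothesis n_much_larger :
  much_larger (fun n => n%:R : R) (fun n => (dimd (M n))%:R).

Lemma eventually_d_over_n_le (e : R) : 0 < e -> \forall n \near \oo, d_over_n (M n) <= e.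
Proof.
move=> e0; have /cvgrPdist_le/(_ e e0) := n_much_larger.
by apply: filterS => n; rewrite sub0r normrN; apply: le_trans; exact: ler_norm.
Qed.

Lemma ridge_necessary tau : (forall n, 0 <= tau n) -> MSE_O_prob_away0 M tau ->
  tau_range M tau.
Proof.
(* The given constant comes without a sign, whereas the scalar bounds ask for a positive one. *)
move=> tau0 [C' [e [e0 away]]]; pose C := `|C'| + 1.
have C0 : 0 < C by rewrite ltr_wpDl.
have [_ [c1 c10 s1]] := noise; have [_ [c2 c20 h2]] := signal_size.
pose k := @tail_factor R sigma_x; pose c := 4 / 3 * k * (1 + c1 * C).
have k1 : 1 <= k := tail_factor_ge1 (M 1) isT.
have k0 : 0 < k by exact: lt_le_trans k1.
have a0 : 0 < 1 + c1 * C by rewrite ltr_pwDl // mulr_ge0 // ltW.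
have cp : 0 < c by apply: mulr_gt0 => //; apply: mulr_gt0.
have x0 : 0 < c * (k + 1) by rewrite mulr_gt0 // addr_gt0.
pose y := 1024 * c2 * C.
have y0 : 0 < y.
  by rewrite /y -mulrA; apply: mulr_gt0; [rewrite ltr0n|exact: mulr_gt0].
have z0 : 0 < 2 * (1 + y) by rewrite mulr_gt0 // addr_gt0.
suff range : \forall n \near \oo,
    tail_level (M n) * Num.sqrt (n_over_d (M n)) <= c * (tau n + tail_level (M n)) /\
    tau n + tail_level (M n) <= 2 * (1 + y) * (lambda_d (M n) * Num.sqrt (d_over_n (M n))).
  by split; [exists c|exists (2 * (1 + y))] => //; apply: filterS range => n [].
have x2 : 0 < (c * (k + 1))^-1 ^+ 2 by rewrite exprn_gt0 // invr_gt0.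
have y2 : 0 < y^-1 by rewrite invr_gt0.
near=> n.
have [ca cb cc] : [/\ cond_a (M n) 1000, cond_b (M n) 1000 & cond_c (M n) delta2].
  by near: n; exact: conds.
have [n0 _ _] := cond_dims ca cb; have l0 := lambda_d_gt0 (M n).
have hl : 1 <= c2 * (head_norm2 (M n) * lambda_d (M n) ^+ 2) by near: n; exact: h2.
have h0 : 0 < head_norm2 (M n).
  have := lt_le_trans ltr01 hl.
  by rewrite (pmulr_rgt0 _ c20) (pmulr_lgt0 _ (exprn_gt0 2 l0)).
have [w gw mw] : exists2 w : Om (M n), good_event w &
    mse (design w) (tau n) (signal w) (sigma2 (M n)) <= C' * d_over_n (M n).
  apply: MSE_event_witness => //; apply: (@lt_le_trans _ _ e%:E).
    by near: n; exact: bad_event_vanishes.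
  by near: n; exact: away.
have D0 := d_over_n_gt0 (M n) n0.
have s1n : 1 <= c1 * sigma2 (M n) by near: n; exact: s1.
have dd : 0 <= delta2 <= 1 / 160 by rewrite delta2_ge0.
have mC : mse (design w) (tau n) (signal w) (sigma2 (M n)) <= C * d_over_n (M n).
  apply: (le_trans mw); rewrite ler_pM2r // /C.
  by apply: le_trans (ler_norm _) _; rewrite lerDl.
apply: (mse_good_lower n0 dd c10 c20 C0 gw cc s1n h0 hl (tau0 n) mC).
- rewrite -/k -/c mulrC -(ler_pdivlMr _ _ x0) mul1r.
  have -> : (c * (k + 1))^-1 = Num.sqrt ((c * (k + 1))^-1 ^+ 2).
    by rewrite sqrtr_sqr ger0_norm // invr_ge0 ltW.
  by apply: ler_wsqrtr; near: n; exact: eventually_d_over_n_le.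
- rewrite -/y mulrC -(ler_pdivlMr _ _ y0) mul1r.
  by near: n; exact: eventually_d_over_n_le.
Unshelve. all: by end_near. Qed.

(** The witness is the lower end of the range itself. The ratio condition says that [tail_level] is
    at most a multiple of [lambda_d * d / n], which places this end below the upper one; adding
    [tail_level] at most doubles it because [d <= n]. *)
Lemma exists_tau_range : ratio_cond M ->
  exists2 tau : nat -> R, (forall n, 0 <= tau n) & tau_range M tau.
Proof.
move=> [c c0 ratio].
have t0 n : 0 <= tail_level (M n).
  by rewrite mulr_ge0 ?(ltW (lambda_d1_gt0 _)) // divr_ge0 // divr_ge0 ?(ltW (tail_sum_gt0 _)) // ltW // lambda_d1_gt0.
exists (fun n => tail_level (M n) * Num.sqrt (n_over_d (M n))).
  by move=> n; rewrite mulr_ge0 ?sqrtr_ge0.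
split.
  exists 1 => //; near=> n; rewrite mul1r lerDl; exact: t0.
exists (2 * c); first by rewrite mulr_gt0.
near=> n.
have [ca cb _] : [/\ cond_a (M n) 1000, cond_b (M n) 1000 & cond_c (M n) delta2].
  by near: n; exact: conds.
have [n0 _ _] := cond_dims ca cb; have [dn _] := ca.
have nR : 0 < n%:R :> R by rewrite ltr0n.
have D0 := d_over_n_gt0 (M n) n0; have l0 := lambda_d_gt0 (M n).
have l1 := lambda_d1_gt0 (M n).
have r0 : 0 < eff_rank (M n) by rewrite divr_gt0 // tail_sum_gt0.
have h : lambda_d1 (M n) / lambda_d (M n) <= c * ((dimd (M n))%:R / eff_rank (M n)).
  by near: n; exact: ratio.
rewrite sqrt_n_over_d -/(tail_level (M n)); set r := Num.sqrt _.
have rp : 0 < r by rewrite sqrtr_gt0.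
have r1 : r <= 1.
  by rewrite -sqrtr1 ler_wsqrtr // ler_pdivrMr // mul1r ler_nat.
have r2 : r * r = d_over_n (M n) by rewrite -expr2 sqr_sqrtr // ltW.
have tD : tail_level (M n) <= c * (lambda_d (M n) * (r * r)).
  rewrite r2; move: h; rewrite ler_pdivrMr // => h.
  apply: (le_trans (ler_wpM2r _ h)); first by rewrite divr_ge0 // ltW.
  rewrite le_eqVlt; apply/orP; left; apply/eqP; rewrite /d_over_n.
  by field; rewrite !gt_eqF.
have tr : tail_level (M n) / r <= c * (lambda_d (M n) * r).
  by rewrite ler_pdivrMr // -!mulrA.
have : tail_level (M n) <= tail_level (M n) / r.
  by rewrite ler_peMr // invf_ge1.
move=> /le_trans/(_ tr) h'; rewrite /= -[leRHS]mulrA mulr_natl mulr2n; exact: lerD.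
Unshelve. all: by end_near. Qed.

Lemma prob_to1_away0 tau : MSE_O_prob_to1 M tau -> MSE_O_prob_away0 M tau.
Proof.
move=> [C /fine_cvgP[fin /cvgrPdist_le/(_ (1 / 2))]]; rewrite divr_gt0 // => /(_ isT) near1.
exists C, (1 / 2); split; first by rewrite divr_gt0.
near=> n.
have fE : Pr (M n) (MSE_event (M := M) tau C (n := n)) \is a fin_num by near: n; exact: fin.
have : `|1 - fine (Pr (M n) (MSE_event (M := M) tau C (n := n)))| <= 1 / 2.
  by near: n; exact: near1.
rewrite -(fineK fE) /= lee_fin ler_norml => /andP[_]; lra.
Unshelve. all: by end_near. Qed.

End Asymptotic.

Theorem corollary5 (R : realType) :
  exists C0 : R, 0 < C0 /\
  forall (sigma_x delta2 : R) (M : forall n : nat, ridge_model sigma_x n),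
    0 < delta2 < 1 ->
    (\forall n \near \oo,
       [/\ cond_a (M n) C0, cond_b (M n) C0 & cond_c (M n) delta2]) ->
    asymp (fun n => sigma2 (M n)) (fun=> 1) ->
    asymp (fun n => head_norm2 (M n) * lambda_d (M n) ^+ 2) (fun=> 1) ->
    (* (i) *)
    (forall tau : nat -> R, (forall n, 0 <= tau n) ->
       ratio_cond M -> tau_range M tau -> MSE_O_prob_to1 M tau) /\
    (much_larger (fun n => n%:R : R) (fun n => (dimd (M n))%:R) ->
     64 * (Num.sqrt delta2 / (1 - Num.sqrt delta2)) < 1 ->
     (* (ii) *)
     (forall tau : nat -> R, (forall n, 0 <= tau n) ->
        MSE_O_prob_away0 M tau -> ratio_cond M /\ tau_range M tau) /\
     (* the conditions on the eigenvalue ratio are matched *)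
     ((ratio_cond M <->
        exists2 tau : nat -> R, (forall n, 0 <= tau n) &
          MSE_O_prob_to1 M tau) /\
      (ratio_cond M <->
        exists2 tau : nat -> R, (forall n, 0 <= tau n) &
          MSE_O_prob_away0 M tau))).
Proof.
exists 1000; split; first by rewrite ltr0n.
move=> sigma_x delta2 M /andP[d0 d1] conds noise signal_size.
have d0' := ltW d0; have d1' := ltW d1.
have sufficient tau : (forall n, 0 <= tau n) -> tau_range M tau -> MSE_O_prob_to1 M tau.
  exact: (ridge_sufficient d0' d1' conds noise signal_size).
split=> [tau tau0 _|large]; first exact: sufficient.
(* With [s] the square root of [delta2], the assumption reads [64 * s < 1 - s], so [delta2] is at
   most [1 / 65 ^ 2]. *)
move=> d64; have d160 : delta2 <= 1 / 160.
  set s := Num.sqrt delta2 in d64.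
  have s0 : 0 <= s by exact: sqrtr_ge0.
  have s1 : s < 1 by rewrite -sqrtr1 ltr_sqrt.
  have dE : delta2 = s * s by rewrite -expr2 sqr_sqrtr.
  have s65 : s <= 1 / 65.
    by move: d64; rewrite mulrA ltr_pdivrMr ?subr_gt0 // mul1r; lra.
  have := ler_pM s0 s0 s65 s65; rewrite -dE; lra.
have necessary tau : (forall n, 0 <= tau n) -> MSE_O_prob_away0 M tau -> tau_range M tau.
  exact: (ridge_necessary d0' conds noise signal_size d160 large).
have ratio1 tau : (forall n, 0 <= tau n) -> MSE_O_prob_away0 M tau -> ratio_cond M.
  by move=> tau0 /(necessary _ tau0); exact: tau_range_ratio.
split; [|split; split].
- by move=> tau tau0 h; split; [exact: ratio1 h|exact: necessary].
- by move=> /(exists_tau_range conds)[tau tau0 rg]; exists tau => //; exact: sufficient.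
- by move=> [tau tau0 /prob_to1_away0]; exact: ratio1.
- by move=> /(exists_tau_range conds)[tau tau0 rg]; exists tau => //; apply/prob_to1_away0/sufficient.
- by move=> [tau tau0]; exact: ratio1.
Qed.
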